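(* Suppose that conditions (A1), (A2), (A3) and (C1) (stated in the context) are satisfied. Then, with probability one, the empirical eigenvalue distribution $\mu_n(X_n)$ converges weakly, as $n\to\infty$, to the standard semi-circle distribution $\mu$, i.e. the probability measure on $\mathbb{R}$ with density $$\frac{d\mu}{dx}=\frac{1}{2\pi}\sqrt{4-x^2}\,\chi_{[-2,2]}(x).$$
   Context: For each $n\in\mathbb{N}$ let $a_n(p,q)$, $1\le p\le q\le n$, be real random variables (all defined on a common probability space), and set $a_n(q,p):=a_n(p,q)$. Let $X_n$ be the random real symmetric $n\times n$ matrix with entries $X_n(p,q)=\frac{1}{\sqrt n}a_n(p,q)$ for $1\le p\le q\le n$ and $X_n(p,q)=X_n(q,p)$ for $1\le q<p\le n$. If $\lambda_1^{(n)}\le\dots\le\lambda_n^{(n)}$ are the eigenvalues of $X_n$, the empirical eigenvalue distribution is $\mu_n(X_n)=\frac1n\sum_{k=1}^n\delta_{\lambda_k^{(n)}}$. Conditions: (A1) $\mathbb{E}(a_n(p,q))=0$ and $\mathbb{E}(a_n(p,q)^2)=1$ for all $1\le p\le q\le n$. (A2) For every $k\in\mathbb{N}$: $m_k:=\sup_{n\in\mathbb{N}}\max_{1\le p\le q\le n}\mathbb{E}(|a_n(p,q)|^k)<\infty$. (A3) For every $n$, the families $\{a_n(p,q): 1\le p\le q\le n,\ p+q=r\}$, $r=2,3,\dots,2n$, are independent (entries within one family may be dependent). (C1) For every $n$ there is a function $c_n:\{0,1,2,\dots\}\to\mathbb{R}$ such that (i) for all $p\le q$, $r\le s$ in $\{1,\dots,n\}$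 with $p+q=r+s$ one has $|\mathrm{Cov}(a_n(p,q),a_n(r,s))|=c_n(|p-r|)=c_n(|q-s|)$; and (ii) $\sum_{\tau=0}^{n-1}c_n(\tau)=o(n)$ as $n\to\infty$.
   Formalization: In (C1) the function c_n is required to be nonnegative; otherwise its values at τ never attained as |p−r| are unconstrained, negative ones could cancel the sum in (ii), and random Hankel matrices would contradict the claim. *)

(* Defs.v *)
From HB Require Import structures.
From mathcomp Require Import all_boot all_order all_algebra.
From mathcomp Require Import all_classical all_reals all_analysis.
From mathcomp Require Import measurable_realfun polyrcf complex ring lra.

Set Implicit Arguments.
Unset Strict Implicit.
Unset Printing Implicit Defensive.

Import Order.TTheory GRing.Theory Num.Theory.
Import numFieldNormedType.Exports.

Local Open Scope classical_set_scope.
Local Open Scope ring_scope.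

Section empirical_distribution.
Variable R : realType.

(* Sorted list of the real roots of the characteristic polynomial, repeated
   according to multiplicity; for a symmetric matrix it has length n
   (size_eigvals below). *)
Definition eigvals n (A : 'M[R]_n) : seq R :=
  flatten [seq nseq (mup x (char_poly A)) x | x <- rootsR (char_poly A)].

Lemma count_eigvals n (A : 'M[R]_n) x :
  count_mem x (eigvals A) = mup x (char_poly A).
Proof.
have p0 : char_poly A != 0 by rewrite monic_neq0// char_poly_monic.
rewrite /eigvals count_flatten -map_comp sumnE big_map /=.
under eq_bigr do rewrite count_nseq /=.
have [xr|xr] := boolP (x \in rootsR (char_poly A)).
  rewrite (bigD1_seq x) ?uniq_roots//= eqxx mul1n.
  by rewrite big1 ?addn0// => y /negbTE ->.
rewrite big1_seq => [|y /andP[_ yr]]; last first.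
  by case: eqVneq yr => // ->; rewrite (negbTE xr).
apply/esym/mupNroot; apply: contra xr => xr.
by have := roots_on_rootsR p0 x; rewrite in_itv /= xr => <-.
Qed.

Lemma sorted_eigvals n (A : 'M[R]_n) : sorted <=%R (eigvals A).
Proof.
have : sorted <%R (rootsR (char_poly A)) by exact: sorted_roots.
rewrite /eigvals; move: (rootsR _) => s.
rewrite lt_sorted_pairwise (sorted_pairwise le_trans).
elim: s => [//|x s IH] /= /andP[xs /IH ss].
rewrite pairwise_cat ss andbT; apply/andP; split.
  apply/allrelP => y z /nseqP[-> _] /flatten_mapP[t ts /nseqP[-> _]].
  by apply/ltW; exact: (allP xs).
by apply/(pairwiseP 0) => i j; rewrite !inE size_nseq => i0 j0 _; rewrite !nth_nseq i0 j0.
Qed.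

Lemma char_poly_symm n (A : 'M[R]_n) : A^T = A ->
  exists s : seq R, char_poly A = \prod_(x <- s) ('X - x%:P).
Proof.
move=> AT; pose f := real_complex R : {rmorphism R -> R[i]}.
case: n A AT => [|n] A AT.
  exists [::]; rewrite big_nil /char_poly [X in \det X]flatmx0 det_mx00//.
have fr x : f x \is Num.real by apply/complex_realP; exists x.
have hA : map_mx f A \is hermsymmx.
  apply: realsym_hermsym; last by apply/mxOverP => i j; rewrite mxE.
  apply/is_hermitianmxP; rewrite expr0 scale1r map_mx_id//.
  by rewrite map_trmx AT.
have [/orthomx_spectralP eqA dr] :=
  (hermitian_normalmx hA, hermitian_spectral_diag_real hA).
set D := spectral_diag _ in eqA dr; set U := spectralmx _ in eqA.
have Uu : U \in unitmx by exact: spectral_unit.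
have cpE : char_poly (map_mx f A) = \prod_i ('X - (D 0 i)%:P).
  have -> : char_poly (map_mx f A) = char_poly (diag_mx D).
    have UVU : map_mx polyC (invmx U) *m map_mx polyC U = 1%:M.
      by rewrite -map_mxM mulVmx// map_mx1.
    rewrite eqA /char_poly /char_poly_mx !map_mxM /=.
    have XE : 'X%:M = map_mx polyC (invmx U) *m 'X%:M *m map_mx polyC U.
      by rewrite mul_mx_scalar -scalemxAl UVU scalemx1.
    rewrite [X in \det (X - _) = _]XE.
    by rewrite -mulmxBl -mulmxBr !det_mulmx mulrAC -det_mulmx UVU det1 mul1r.
  rewrite char_poly_trig; last exact: diag_mx_is_trig.
  by apply: eq_bigr => i _; rewrite mxE eqxx mulr1n.
exists [seq complex.Re (D 0 i) | i <- enum 'I_n.+1].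
apply: (map_poly_inj f); rewrite map_char_poly cpE rmorph_prod /= big_map big_enum /=.
apply: eq_bigr => i _; rewrite map_polyXsubC /=.
have /mxOverP/(_ 0 i)/complex_realP[k Ek] := dr.
by rewrite /f Ek.
Qed.

Lemma char_poly_eigvals n (A : 'M[R]_n) : A^T = A ->
  char_poly A = \prod_(x <- eigvals A) ('X - x%:P).
Proof.
move=> /char_poly_symm[s sE]; rewrite sE; apply: perm_big.
by apply/allP => x _ /=; rewrite count_eigvals sE mu_prod_XsubC.
Qed.

Lemma size_eigvals n (A : 'M[R]_n) : A^T = A -> size (eigvals A) = n.
Proof.
move=> /char_poly_eigvals/(congr1 (fun p : {poly R} => size p)).
by rewrite size_char_poly size_prod_XsubC => -[].
Qed.

(* For n = 0 this is the zero measure. *)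
Definition esd n (A : 'M[R]_n) : {measure set R -> \bar R} :=
  mscale (n%:R^-1)%:nng (msum (fun k => \d_((eigvals A)`_k)) n).

End empirical_distribution.

Definition weak_cvg (R : realType) (mu_ : nat -> {measure set R -> \bar R})
    (mu : {measure set R -> \bar R}) :=
  forall f : R -> R, continuous f -> bounded_fun f ->
    (\int[mu_ n]_x (f x)%:E)%E @[n --> \oo] --> (\int[mu]_x (f x)%:E)%E.

Section semicircle.
Variable R : realType.
Local Notation mu := (@lebesgue_measure R).

Definition semicircle_pdf (x : R) : R :=
  (2 * pi)^-1 * Num.sqrt (4 - x ^+ 2) * \1_(`[-2, 2]) x.

Lemma semicircle_pdf_ge0 x : 0 <= semicircle_pdf x.
Proof. by rewrite /semicircle_pdf !mulr_ge0// ?invr_ge0 ?mulr_ge0 ?pi_ge0. Qed.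

Lemma continuous_sqrt4B : continuous (fun x : R => Num.sqrt (4 - x ^+ 2)).
Proof.
move=> x; apply: (cvg_comp _ Num.sqrt); last exact: sqrt_continuous.
by apply: cvgB; [exact: cvg_cst|exact: exprn_continuous].
Qed.

Lemma measurable_semicircle_pdf : measurable_fun setT semicircle_pdf.
Proof.
apply: measurable_funM; last exact: measurable_indic.
apply: measurable_funM => //.
by have := @continuous_measurable_fun R _ continuous_sqrt4B.
Qed.

Lemma integral_sqrt4B :
  (\int[mu]_(x in `[(-2)%R, 2%R]) (Num.sqrt (4 - x ^+ 2))%:E = (2 * pi)%:E)%E.
Proof.
pose F := fun t : R => 2 * sin t.
have dF (t : R) : is_derive t 1 F (2 * cos t).
  rewrite /F; apply: is_derive_eq. 
  by [].
have F'E : F^`()%classic = fun t => 2 * cos t.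
  by apply/funext => t; rewrite derive1E; apply: derive_val.
have cF : continuous F.
  by move=> t; apply/differentiable_continuous/derivable1_diffP; case: (dF t).
have cF' : continuous F^`()%classic.
  by rewrite F'E => t; apply: cvgM; [exact: cvg_cst|exact: continuous_cos].
have pi0 := pi_gt0 R.
have pi2 : - (pi / 2) < pi / 2 :> R by lra.
have FN : F (- (pi / 2)) = -2 by rewrite /F sinN sin_pihalf mulrN1.
have FP : F (pi / 2) = 2 by rewrite /F sin_pihalf mulr1.
have -> : `[(-2 : R), (2 : R)]%classic = `[F (- (pi / 2)), F (pi / 2)]%classic.
  by rewrite FN FP.
rewrite integration_by_substitution_increasing//; first last.
- by apply: continuous_subspaceT; exact: continuous_sqrt4B.
- split.
  + by move=> t _; case: (dF t).
  + by apply: cvg_at_right_filter; exact: cF.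
  + by apply: cvg_at_left_filter; exact: cF.
- apply/cvg_ex; exists (F^`()%classic (pi / 2)).
  by apply: cvg_at_left_filter; exact: cF'.
- apply/cvg_ex; exists (F^`()%classic (- (pi / 2))).
  by apply: cvg_at_right_filter; exact: cF'.
- by move=> /= x x' xI x'I xx'; rewrite /F ltr_pM2l// ltr_sin.
- exact: ltW.
pose G := fun t : R => 2 * t + 2 * (sin t * cos t).
pose g := fun t : R => 4 * cos t ^+ 2.
transitivity (\int[mu]_(x in `[(- (pi / 2))%R, (pi / 2)%R]) (g x)%:E)%E.
  apply: eq_integral => t; rewrite inE/= in_itv/= => tI.
  rewrite fctE /= F'E /g /F; congr EFin.
  have -> : 4 - (2 * sin t) ^+ 2 = (2 * cos t) ^+ 2.
    by rewrite !exprMn cos2sin2; ring.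
  by rewrite sqrtr_sqr ger0_norm ?mulr_ge0 ?cos_ge0_pihalf//; ring.
have dG (t : R) : is_derive t 1 G (g t).
  rewrite /G; apply: is_derive_eq.
  rewrite /GRing.scale/= /g; have := cos2Dsin2 t; set c := cos t; set s := sin t.
  by move=> /(canRL (addrK _)) E; nra.
have cG : continuous G.
  by move=> t; apply/differentiable_continuous/derivable1_diffP; case: (dG t).
rewrite (@continuous_FTC2 _ g G)//.
- rewrite /G sinN cosN sin_pihalf cos_pihalf -EFinB; congr EFin; lra.
- apply: continuous_subspaceT => t; apply: cvgM; first exact: cvg_cst.
  by apply: (cvg_comp _ (fun x => x ^+ 2)); [exact: continuous_cos|exact: exprn_continuous].
- split.
  + by move=> t _; case: (dG t).
  + by apply: cvg_at_right_filter; exact: cG.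
  + by apply: cvg_at_left_filter; exact: cG.
- by move=> t _; rewrite derive1E; apply: derive_val.
Qed.

Lemma integral_semicircle_pdf : (\int[mu]_x (semicircle_pdf x)%:E = 1)%E.
Proof.
transitivity (\int[mu]_(x in `[(-2)%R, 2%R])
    ((2 * pi)^-1%:E * (Num.sqrt (4 - x ^+ 2))%:E))%E.
  rewrite [RHS]integral_mkcond; apply: eq_integral => x _.
  rewrite /semicircle_pdf patchE indicE; case: ifPn => _; first by rewrite mulr1 EFinM.
  by rewrite mulr0.
rewrite ge0_integralZl//.
- by rewrite integral_sqrt4B -EFinM mulVf// gt_eqF// mulr_gt0// pi_gt0.
- apply/measurable_EFinP/measurable_funTS.
  by have := @continuous_measurable_fun R _ continuous_sqrt4B.
- by rewrite lee_fin invr_ge0 mulr_ge0// pi_ge0.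
Qed.

Definition semicircle (A : set R) : \bar R :=
  (\int[mu]_(x in A) (semicircle_pdf x)%:E)%E.

Let semicircle0 : semicircle set0 = 0%E.
Proof. by rewrite /semicircle integral_set0. Qed.

Let semicircle_ge0 A : (0 <= semicircle A)%E.
Proof. by apply: integral_ge0 => x _; rewrite lee_fin semicircle_pdf_ge0. Qed.

Let semicircle_sigma_additive : semi_sigma_additive semicircle.
Proof.
move=> /= A mA tA mUA; rewrite /semicircle ge0_integral_bigcup//=.
- apply: is_cvg_ereal_nneg_natsum_cond => n _ _.
  by apply: integral_ge0 => x _; rewrite lee_fin semicircle_pdf_ge0.
- apply/measurable_funTS/measurable_EFinP.
  exact: measurable_semicircle_pdf.
- by move=> x _; rewrite lee_fin semicircle_pdf_ge0.
Qed.

HB.instance Definition _ := isMeasure.Build _ _ _ semicircle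
  semicircle0 semicircle_ge0 semicircle_sigma_additive.

Let semicircle_setT : semicircle [set: _] = 1%E.
Proof. exact: integral_semicircle_pdf. Qed.

HB.instance Definition _ :=
  @Measure_isProbability.Build _ _ R semicircle semicircle_setT.

End semicircle.

Section random_matrix.
Context d (T : measurableType d) (R : realType) (P : probability T R).

Definition generated_sigma_algebra I (D : set I) (X : I -> T -> R) :
    set (set T) :=
  <<s \bigcup_(i in D) preimage_set_system setT (X i) measurable >>.

Definition mutually_independent (J : finType) (F : J -> set (set T)) :=
  forall (S : {set J}) (E : J -> set T), (forall j, j \in S -> F j (E j)) ->
    P (\bigcap_(j in [set` S]) E j) = (\prod_(j in S) P (E j))%E.

(* Indices run over 0, ..., n - 1 instead of 1, ..., n.  Only the entries
   a p q with p <= q are ever used. *)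
Variable a : forall n : nat, 'I_n -> 'I_n -> {RV P >-> R}.

Definition random_mx n (w : T) : 'M[R]_n := \matrix_(p, q)
  ((Num.sqrt n%:R)^-1 * (if (p <= q)%N then a p q w else a q p w)).

Lemma tr_random_mx n w : (random_mx n w)^T = random_mx n w.
Proof.
apply/matrixP => p q; rewrite !mxE; congr (_ * _).
by case: ltngtP => // /val_inj ->.
Qed.

Definition condA1 := forall n (p q : 'I_n), (p <= q)%N ->
  ('E_P[a p q] = 0)%E /\ ('E_P[fun w => (a p q w ^+ 2)%R] = 1)%E.

Definition condA2 := forall k : nat,
  (ereal_sup [set m | exists n (p q : 'I_n),
     (p <= q)%N /\ m = 'E_P[fun w => (`|a p q w| ^+ k)%R]] < +oo)%E.

(* With 0-based indices, p + q ranges over 0, ..., 2n - 2. *)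
Definition condA3 := forall n,
  mutually_independent (fun r : 'I_(n.*2.-1) =>
    generated_sigma_algebra
      [set pq : 'I_n * 'I_n | (pq.1 <= pq.2)%N /\ (pq.1 + pq.2 = r)%N]
      (fun pq => a pq.1 pq.2)).

(* The covariance condition only pins down c n tau for about half of the
   tau < n.  As c n stands for the absolute value of a covariance it is taken
   to be nonnegative everywhere; otherwise negative values at the remaining tau
   could cancel the sum and void the o(n) condition (a Hankel matrix with
   i.i.d. entries would qualify). *)
Definition condC1 := exists c : nat -> nat -> R,
  [/\ forall n tau, 0 <= c n tau,
      forall n (p q r s : 'I_n),
        (p <= q)%N -> (r <= s)%N -> (p + q = r + s)%N ->
        `|covariance P (a p q) (a r s)|%E = (c n `|p%:Z - r%:Z|%N)%:E /\
        c n `|p%:Z - r%:Z|%N = c n `|q%:Z - s%:Z|%N &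
      (fun n => \sum_(tau < n) c n tau : R^o) =o_\oo (fun n => n%:R : R^o)].

End random_matrix.

(* Main.v *)
(** Write [r_j = p_j + p_(j+1)] for the index sums along a closed walk [p] of
    length [k]; a step of [p] stands for an entry on the anti-diagonal [r_j].
    By independence of the anti-diagonals, the moment along [p] vanishes if
    some [r_j] is not repeated.  A walk is determined by its start and its
    vertex sums, so walks with fewer than [k / 2] distinct sums are negligible,
    and if a walk without consecutive equal sums has its sums paired, then
    beyond its first repetition [r_i = r_j], [i + 1 < j], the covariance
    condition leaves only [o (n)] instead of [n] choices for [p_j].  Consecutive
    equal sums mean a backtrack [p_h = p_(h+2)], which can be removed at the
    cost of a factor [n].  Hence, if [f k h] denotes the limit of the normalized
    moments along the closed walks with no backtrack in the first [h] steps,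
    then [f k k = 0] for [k > 0] and [f (k+2) (h+1) = f (k+2) (h+2) + f k h].
    The integrals of [x ^ (k - h) * S_h x] against the semicircle law, where
    [S_h] is the Chebyshev polynomial with [S_(h+2) = x * S_(h+1) - S_h],
    satisfy the same relations, so no counting of pairings is needed.

    For almost sure convergence, the fourth central moment of the normalized
    trace is [O (n ^ -2)]: four closed walks contribute only if every sum is
    repeated and every walk shares a sum with another one, and a sum occurring
    only once in a walk is determined by the others because the walk closes
    up.  Finally, convergence of all moments implies weak convergence by
    Weierstrass approximation. *)

Require Import Defs.
From HB Require Import structures.
From mathcomp Require Import all_boot all_order all_algebra.
From mathcomp Require Import all_classical all_reals all_analysis.
From mathcomp Require Import measurable_realfun complex ring lra zify.

Set Implicit Arguments.
Unset Strict Implicit.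
Unset Printing Implicit Defensive.

Import Order.TTheory GRing.Theory Num.Theory.
Import numFieldNormedType.Exports.

Local Open Scope classical_set_scope.
Local Open Scope ring_scope.

(** * Random variables with finite moments and independence *)

(** Entries on one anti-diagonal may depend on each other in any way that (C1) allows, so only
    covariances of pairs carry information. A moment in which some sum occurs three times or more is
    merely bounded, and such walks have to be negligible by their number: there are
    [O (n ^ (m + 1))] walks with [m] distinct sums, against the normalization [n ^ (1 + k / 2)]. A
    covariance depends on a distance between vertices, and the distance to an earlier vertex fixes
    [p_j] up to a sign. Summing over the distances thus replaces the [n] choices of [p_j] by the sum
    of [c]. At a backtrack the two entries coincide, their covariance is 1 and nothing is gained;
    this is why backtracks are treated separately. The fourth moment is taken because the same count
    for two walks saves a single factor [n], and [n ^ -1] is not summable. *)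

Section finite_moments.
Context d (T : measurableType d) (R : realType) (P : probability T R).
Implicit Types (X Y : T -> R).
Local Notation Ex X := (Rintegral P setT X).

(** Such variables form an algebra, so the integrability of the polynomial expressions below follows
    from their shape alone. *)
Definition finite_moments X := measurable_fun setT X /\
  forall k, P.-integrable setT (fun w => (`|X w| ^+ k)%:E).

Lemma le_finite_moments X Y : measurable_fun setT X ->
  (forall w, `|X w| <= `|Y w|) -> finite_moments Y -> finite_moments X.
Proof.
move=> mX XY [mY iY]; split => // k; apply: (le_integrable _ _ _ (iY k)) => //.
  by apply/measurable_EFinP/measurable_funX; exact: measurableT_comp.
by move=> w _; rewrite lee_fin !normrX !normr_id lerXn2r ?nnegrE.
Qed.

Lemma finite_moments_cst c : finite_moments (cst c).
Proof.
split; first exact: measurable_cst.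
by move=> k; apply: (@finite_measure_integrable_cst _ _ _ _ _ (`|c| ^+ k)).
Qed.

Lemma finite_moments_integrable X : finite_moments X ->
  P.-integrable setT (EFin \o X).
Proof.
move=> [mX /(_ 1%N) iX]; apply: (le_integrable _ _ _ iX) => //.
  exact/measurable_EFinP.
by move=> w _; rewrite lee_fin normr_id.
Qed.

Lemma finite_momentsM X Y : finite_moments X -> finite_moments Y ->
  finite_moments (fun w => X w * Y w).
Proof.
move=> [mX iX] [mY iY].
have mXY : measurable_fun setT (fun w => X w * Y w) by exact: measurable_funM.
split=> // k.
apply: (le_integrable _ _ _ (integrableD _ (iX (k + k)%N) (iY (k + k)%N))) => //.
  by apply/measurable_EFinP/measurable_funX; exact: measurableT_comp.
move=> w _; rewrite -EFinD lee_fin normrX normr_id normrM.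
rewrite [leRHS]ger0_norm ?addr_ge0//= !exprD exprMn.
set x := _ ^+ k; set y := _ ^+ k.
have [x0 y0] : 0 <= x /\ 0 <= y by rewrite !exprn_ge0.
by nra.
Qed.

Lemma finite_momentsD X Y : finite_moments X -> finite_moments Y ->
  finite_moments (fun w => X w + Y w).
Proof.
move=> fX fY; have [[mX iX] [mY iY]] := (fX, fY).
have mXY : measurable_fun setT (fun w => X w + Y w) by exact: measurable_funD.
split=> // k.
have h1 : P.-integrable setT (fun w => (2 ^+ k)%:E * (`|X w| ^+ k)%:E)%E.
  exact: integrableZl.
have h2 : P.-integrable setT (fun w => (2 ^+ k)%:E * (`|Y w| ^+ k)%:E)%E.
  exact: integrableZl.
apply: (le_integrable _ _ _ (integrableD _ h1 h2)) => //.
  by apply/measurable_EFinP/measurable_funX; exact: measurableT_comp.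
move=> w _; rewrite -!EFinM -EFinD lee_fin normrX normr_id.
rewrite [leRHS]ger0_norm ?addr_ge0 ?mulr_ge0//= -!exprMn.
have [xy|/ltW xy] := leP `|X w| `|Y w|.
  rewrite -[leLHS]add0r; apply: lerD; first by rewrite exprn_ge0// mulr_ge0.
  rewrite lerXn2r ?nnegrE ?mulr_ge0//.
  by apply: (le_trans (ler_normD _ _)); lra.
rewrite -[leLHS]addr0; apply: lerD; last by rewrite exprn_ge0// mulr_ge0.
rewrite lerXn2r ?nnegrE ?mulr_ge0//.
by apply: (le_trans (ler_normD _ _)); lra.
Qed.

Lemma finite_momentsZ c X : finite_moments X -> finite_moments (fun w => c * X w).
Proof. by apply: finite_momentsM; exact: finite_moments_cst. Qed.

Lemma finite_momentsB X Y : finite_moments X -> finite_moments Y ->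
  finite_moments (fun w => X w - Y w).
Proof.
move=> fX fY; apply: finite_momentsD => //.
by under eq_fun do rewrite -mulN1r; exact: finite_momentsZ.
Qed.

Lemma finite_moments_sum I (s : seq I) (p : pred I) (X : I -> T -> R) :
  (forall i, p i -> finite_moments (X i)) ->
  finite_moments (fun w => \sum_(i <- s | p i) X i w).
Proof.
move=> fX; elim: s => [|i s IH].
  by under eq_fun do rewrite big_nil; exact: finite_moments_cst.
have [pi|/negbTE pi] := boolP (p i); last by under eq_fun do rewrite big_cons pi.
under eq_fun do rewrite big_cons pi.
by apply: finite_momentsD => //; exact: fX.
Qed.

Lemma finite_moments_prod I (s : seq I) (p : pred I) (X : I -> T -> R) :
  (forall i, p i -> finite_moments (X i)) ->
  finite_moments (fun w => \prod_(i <- s | p i) X i w).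
Proof.
move=> fX; elim: s => [|i s IH].
  by under eq_fun do rewrite big_nil; exact: finite_moments_cst.
have [pi|/negbTE pi] := boolP (p i); last by under eq_fun do rewrite big_cons pi.
under eq_fun do rewrite big_cons pi.
by apply: finite_momentsM => //; exact: fX.
Qed.

Lemma finite_momentsX X n : finite_moments X -> finite_moments (fun w => X w ^+ n).
Proof.
move=> fX; elim: n => [|n IH]; first by under eq_fun do rewrite expr0; exact: finite_moments_cst.
by under eq_fun do rewrite exprS; exact: finite_momentsM.
Qed.

Lemma finite_moments_indic A : measurable A -> finite_moments (\1_A : T -> R).
Proof.
move=> mA; apply: (@le_finite_moments _ (cst 1)); last exact: finite_moments_cst.
  exact: measurable_indic.
by move=> w; rewrite indicE /= normr1 ger0_norm//; case: (_ \in _).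
Qed.

Lemma finite_moments_norm X : finite_moments X -> finite_moments (fun w => `|X w|).
Proof.
move=> fX; apply: (le_finite_moments _ _ fX).
  by case: fX => ? _; exact: measurableT_comp.
by move=> w; rewrite normr_id.
Qed.

Lemma ExD X Y : finite_moments X -> finite_moments Y ->
  Ex (fun w => X w + Y w) = Ex X + Ex Y.
Proof. by move=> /finite_moments_integrable ? /finite_moments_integrable ?; exact: RintegralD. Qed.

Lemma ExB X Y : finite_moments X -> finite_moments Y ->
  Ex (fun w => X w - Y w) = Ex X - Ex Y.
Proof. by move=> /finite_moments_integrable ? /finite_moments_integrable ?; exact: RintegralB. Qed.

Lemma ExZ c X : finite_moments X -> Ex (fun w => c * X w) = c * Ex X.
Proof. by move=> /finite_moments_integrable ?; exact: RintegralZl. Qed.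

Lemma Ex_cst c : Ex (cst c) = c.
Proof.
by have := Rintegral_cst P measurableT c; rewrite -[X in fine X]/(P setT) probability_setT mulr1.
Qed.

Lemma Ex_sum I (s : seq I) (p : pred I) (X : I -> T -> R) :
  (forall i, p i -> finite_moments (X i)) ->
  Ex (fun w => \sum_(i <- s | p i) X i w) = \sum_(i <- s | p i) Ex (X i).
Proof.
move=> fX; elim: s => [|i s IH].
  by under eq_fun do rewrite big_nil; rewrite big_nil; exact: Ex_cst.
have [pi|/negbTE pi] := boolP (p i); last first.
  by under eq_fun do rewrite big_cons pi; rewrite big_cons pi.
under eq_fun do rewrite big_cons pi; rewrite big_cons pi.
rewrite -IH ExD//; [exact: fX|exact: finite_moments_sum].
Qed.

Lemma le_Ex X Y : finite_moments X -> finite_moments Y ->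
  (forall w, X w <= Y w) -> Ex X <= Ex Y.
Proof.
by move=> /finite_moments_integrable ? /finite_moments_integrable ? XY; exact: le_Rintegral.
Qed.

Lemma le_norm_Ex X : finite_moments X -> `|Ex X| <= Ex (fun w => `|X w|).
Proof. by move=> /finite_moments_integrable ?; exact: le_normr_Rintegral. Qed.

Lemma Ex_fine X : finite_moments X -> (\int[P]_w (X w)%:E = (Ex X)%:E)%E.
Proof.
move=> /finite_moments_integrable iX; rewrite /Rintegral fineK//.
exact: integrable_fin_num.
Qed.

Lemma Ex_indic A : measurable A -> Ex \1_A = fine (P A).
Proof. by move=> mA; rewrite /Rintegral integral_indic// setIT. Qed.

Lemma Ex_dominated (Xn : nat -> T -> R) X Y :
  (forall n, measurable_fun setT (Xn n)) -> measurable_fun setT X ->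
  finite_moments Y -> (forall w, Xn n w @[n --> \oo] --> X w) ->
  (forall n w, `|Xn n w| <= Y w) ->
  Ex (Xn n) @[n --> \oo] --> Ex X.
Proof.
move=> mXn mX fY XnX XnY.
have [] := @dominated_convergence _ _ _ P setT measurableT
  (fun n => EFin \o Xn n) (EFin \o X) (EFin \o Y).
- by move=> n; exact/measurable_EFinP.
- exact/measurable_EFinP.
- apply: aeW => w _; apply: cvg_EFin; last exact: XnX.
  by apply: nearW.
- exact: finite_moments_integrable.
- by apply: aeW => w n _; rewrite lee_fin.
move=> iX _ cv; apply: fine_cvg.
by rewrite fineK//; exact: integrable_fin_num.
Qed.

Import HBNNSimple.

(* It suffices to treat the nonnegative and nonpositive parts of [X], each a
   dominated limit of simple functions of [X]. *)
Lemma Ex_mul_of_indic G X : finite_moments G -> finite_moments X ->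
  (forall B, measurable B ->
     Ex (fun w => G w * \1_(X @^-1` B) w) = Ex G * Ex (\1_(X @^-1` B) : T -> R)) ->
  Ex (fun w => G w * X w) = Ex G * Ex X.
Proof.
move=> fG fX GB.
have mXB B : measurable B -> measurable (X @^-1` B).
  by move=> mB; rewrite -[X in measurable X]setTI; case: fX => mX _; exact: mX.
(* The positive and the negative part of [X] both have the form [g \o X] with [0 <= g y <= |y|], and
   this bound gives them finite moments. *)
suff pos (g : R -> R) : measurable_fun setT g -> (forall y, 0 <= g y <= `|y|) ->
    Ex (fun w => G w * g (X w)) = Ex G * Ex (g \o X).
  pose gp (y : R) : R := Num.max y 0; pose gn (y : R) : R := Num.max (- y) 0.
  have mgp : measurable_fun setT gp by exact: measurable_maxr.
  have mgn : measurable_fun setT gn.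
    by apply: measurable_maxr => //; exact: measurableT_comp.
  have gpi y : 0 <= gp y <= `|y|.
    by rewrite /gp le_max lexx orbT ge_max ler_norm normr_ge0.
  have gni y : 0 <= gn y <= `|y|.
    by rewrite /gn le_max lexx orbT ge_max normr_ge0 -normrN ler_norm.
  have Xpn w : X w = gp (X w) - gn (X w).
    rewrite /gp /gn; have [x0|/ltW x0] := lerP 0 (X w).
      by rewrite max_r ?oppr_le0// subr0.
    by rewrite max_l ?oppr_ge0// sub0r opprK.
  have fg (g : R -> R) : measurable_fun setT g -> (forall y, 0 <= g y <= `|y|) ->
      finite_moments (g \o X).
    move=> mg gi; apply: (le_finite_moments _ _ fX).
      by apply: measurableT_comp => //; case: fX.
    by move=> w; have /andP[g0 gl] := gi (X w); rewrite /= ger0_norm.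
  under eq_Rintegral do rewrite Xpn mulrBr.
  have -> : Ex X = Ex (fun w => gp (X w) - gn (X w)) by apply: eq_Rintegral => w _.
  rewrite (ExB (finite_momentsM fG (fg gp mgp gpi)) (finite_momentsM fG (fg gn mgn gni))).
  by rewrite (ExB (fg gp mgp gpi) (fg gn mgn gni)) pos// pos// mulrBr.
move=> mg gi.
have g0 y : (0 <= (g y)%:E)%E by rewrite lee_fin; case/andP: (gi y).
have fgX : finite_moments (g \o X).
  apply: (le_finite_moments _ _ fX).
    by apply: measurableT_comp => //; case: fX.
  by move=> w; have /andP[? gl] := gi (X w); rewrite /= ger0_norm.
have mg' : measurable_fun setT (EFin \o g) by exact/measurable_EFinP.
(* The approximation is made on the real line and then composed with [X]: its level sets become
   preimages under [X], the events that [GB] speaks of. *)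
pose h := nnsfun_approx measurableT mg'.
have hg y : h n y @[n --> \oo] --> g y.
  by have /fine_cvgP[_] := cvg_nnsfun_approx measurableT mg' (fun y _ => g0 y) (x := y) I.
have hle n y : 0 <= h n y <= g y.
  rewrite fun_ge0/=.
  have <- : limn (fun n => h n y) = g y by apply/cvg_lim.
  apply: (nondecreasing_cvgn_le (u_ := fun n => h n y)).
    by move=> p q pq; apply/lefP/(nd_nnsfun_approx measurableT mg' pq).
  by apply/cvg_ex; exists (g y).
have fhX n : finite_moments (h n \o X).
  apply: (le_finite_moments _ _ fgX).
    by apply: measurableT_comp => //; case: fX.
  by move=> w /=; have /andP[h0 hl] := hle n (X w); rewrite !ger0_norm// (le_trans h0).
have step n : Ex (fun w => G w * h n (X w)) = Ex G * Ex (h n \o X).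
  pose r : seq R := finmap.enum_fset (fset_set (range (h n))).
  have hE (y : R) : h n y = \sum_(z <- r) z * \1_(h n @^-1` [set z]) y.
    by rewrite {1}(fimfunE (h n)) fsbig_finite.
  have fI z : finite_moments (\1_(X @^-1` (h n @^-1` [set z])) : T -> R).
    apply/finite_moments_indic/mXB; rewrite -[X in measurable X]setTI.
    exact: measurable_funP.
  transitivity (\sum_(z <- r) z * (Ex G * Ex (\1_(X @^-1` (h n @^-1` [set z])) : T -> R))).
    under eq_Rintegral do rewrite hE mulr_sumr.
    rewrite Ex_sum; last first.
      by move=> z _; apply/finite_momentsM/finite_momentsZ => //; exact: fI.
    apply: eq_bigr => z _; rewrite -GB; last first.
      by rewrite -[X in measurable X]setTI; exact: measurable_funP.
    rewrite -ExZ; last by apply: finite_momentsM.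
    by apply: eq_Rintegral => w _; rewrite mulrCA.
  rewrite [in RHS](_ : h n \o X = fun w => \sum_(z <- r) z * \1_(X @^-1` (h n @^-1` [set z])) w).
    rewrite Ex_sum => [|z _]; last exact: finite_momentsZ.
    by rewrite mulr_sumr; apply: eq_bigr => z _; rewrite ExZ// mulrCA.
  by apply/funext => w; rewrite /= hE.
have c1 : Ex (h n \o X) @[n --> \oo] --> Ex (g \o X).
  apply: (@Ex_dominated (fun n => h n \o X) (g \o X) (g \o X)) => //.
  - by move=> n; case: (fhX n).
  - by case: fgX.
  - by move=> w; exact: hg.
  - by move=> n w; have /andP[h0 hl] := hle n (X w); rewrite ger0_norm.
have c2 : Ex (fun w => G w * h n (X w)) @[n --> \oo] --> Ex (fun w => G w * g (X w)).
  apply: (@Ex_dominated (fun n w => G w * h n (X w)) _ (fun w => `|G w * g (X w)|)) => //.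
  - by move=> n; case: (finite_momentsM fG (fhX n)).
  - by case: (finite_momentsM fG fgX).
  - exact: finite_moments_norm (finite_momentsM fG fgX).
  - by move=> w; apply: cvgM; [exact: cvg_cst|exact: hg].
  - move=> n w; rewrite !normrM ler_wpM2l//.
    by have /andP[h0 hl] := hle n (X w); rewrite !ger0_norm// (le_trans h0).
have c3 : Ex (fun w => G w * h n (X w)) @[n --> \oo] --> Ex G * Ex (g \o X).
  under eq_fun do rewrite step.
  by apply: cvgM; [exact: cvg_cst|exact: c1].
exact: cvg_unique c2 c3.
Qed.
End finite_moments.

(** * Independence: from events to products of random variables *)

Section independence.
Context d (T : measurableType d) (R : realType) (P : probability T R).
Local Notation Ex X := (Rintegral P setT X).

Lemma Ex_prod_indep (J : finType) (F : J -> set (set T)) (Y : J -> T -> R) (s : seq J) :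
  mutually_independent P F -> uniq s -> (forall j, finite_moments P (Y j)) ->
  (forall j B, measurable B -> F j (Y j @^-1` B)) ->
  Ex (fun w => \prod_(j <- s) Y j w) = \prod_(j <- s) Ex (Y j).
Proof.
move=> indF us fY FY.
(* Independence is given for events. The induction on [s] therefore admits indicators on [S] beside
   the variables on [s]; each step tests one variable against a set [B], which turns it into an
   indicator. *)
suff H (S : {set J}) (E : J -> set T) : (forall j, j \in S -> j \notin s) ->
    (forall j, F j (E j)) -> (forall j, measurable (E j)) ->
    Ex (fun w => (\prod_(j in S) \1_(E j) w) * \prod_(j <- s) Y j w) =
    \prod_(j in S) Ex (\1_(E j) : T -> R) * \prod_(j <- s) Ex (Y j).
  (* [H] asks for an event of [F j] at every index; the whole space, written as a preimage under
     [Y j], is one by [FY]. *)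
  have := @H finset.set0 (fun j => Y j @^-1` setT).
  rewrite big_set0 mul1r => <-.
  - by apply: eq_Rintegral => w _; rewrite big_set0 mul1r.
  - by move=> j; rewrite finset.inE.
  - by move=> j; exact: FY.
  - by move=> j; rewrite preimage_setT; exact: measurableT.
elim: s us S E => [_ S E _ FE mE|j s IH /= /andP[js us] S E SE FE mE].
  rewrite big_nil mulr1; under eq_Rintegral do rewrite big_nil mulr1.
  have -> : (fun w => \prod_(j in S) \1_(E j) w) =
            \1_(\bigcap_(j in [set` S]) E j) :> (T -> R).
    apply/funext => w; rewrite indicE.
    have [wE|wE] := boolP (w \in _).
      by rewrite big1// => j jS; rewrite indicE mem_set//; move: wE; rewrite inE; apply.
    have [/forallP h|] := boolP [forall j, (j \in S) ==> (w \in E j)].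
      case/negP: wE; rewrite inE => j jS; rewrite -inE; exact: (implyP (h j)).
    rewrite negb_forall => /existsP[j]; rewrite negb_imply => /andP[jS wEj].
    by rewrite (bigD1 j)//= indicE (negbTE wEj) mul0r.
  rewrite Ex_indic; last first.
    by apply: fin_bigcap_measurable => //; exact: finite_finset.
  rewrite indF => [|j _]; last exact: FE.
  under [RHS]eq_bigr do rewrite Ex_indic//.
  rewrite (eq_bigr (fun j => (fine (P (E j)))%:E)) => [|j _]; last first.
    by rewrite fineK// fin_num_measure.
  by rewrite prodEFin.
rewrite big_cons mulrCA mulrC.
pose G w := (\prod_(j in S) \1_(E j) w) * \prod_(j <- s) Y j w.
have fG : finite_moments P G.
  apply: finite_momentsM; apply: finite_moments_prod => // i _.
  exact: finite_moments_indic.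
have EG : Ex G = \prod_(j in S) Ex (\1_(E j) : T -> R) * \prod_(j <- s) Ex (Y j).
  by apply: IH => // i iS; have := SE _ iS; rewrite inE negb_or => /andP[].
have jS : j \notin S by apply/negP => /SE; rewrite inE eqxx.
rewrite -EG -(@Ex_mul_of_indic _ _ _ P G (Y j))//.
  by apply: eq_Rintegral => w _; rewrite big_cons /G mulrCA mulrC.
move=> B mB.
pose E' i := if i == j then Y j @^-1` B else E i.
have E'S i : i \in S -> E' i = E i.
  by move=> iS; rewrite /E'; case: eqVneq jS => // <-; rewrite iS.
have E'j : E' j = Y j @^-1` B by rewrite /E' eqxx.
transitivity (Ex (fun w => (\prod_(i in j |: S) \1_(E' i) w) * \prod_(i <- s) Y i w)).
  apply: eq_Rintegral => w _; rewrite big_setU1//= E'j mulrC -mulrA; congr (_ * (_ * _)).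
  by apply: eq_bigr => i /E'S ->.
rewrite IH//.
- rewrite big_setU1//= E'j -mulrA mulrC EG; congr (_ * _ * _).
  by apply: eq_bigr => i /E'S ->.
- move=> i; rewrite finset.in_setU1 => /orP[/eqP->//|/SE].
  by rewrite inE negb_or => /andP[].
- by move=> i; rewrite /E'; case: eqP => [->|_]; [exact: FY|exact: FE].
- move=> i; rewrite /E'; case: eqP => // _.
  by rewrite -[X in measurable X]setTI; case: (fY j) => mY _; exact: mY.
Qed.

Lemma preimage_generated (I : Type) (D : set I) (X : I -> T -> R)
    (E : eqType) (s : seq E) (f : E -> I) (p : pred E) B :
  (forall e, p e -> D (f e)) -> measurable B ->
  generated_sigma_algebra D X ((fun w => \prod_(e <- s | p e) X (f e) w) @^-1` B).
Proof.
move=> pD mB.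
set G := \bigcup_(i in D) preimage_set_system setT (X i) measurable.
(* Measurability for the generated algebra is known for indices in [D] only, so the factors that
   fail [p] are replaced by 1. *)
have mX (e : E) : measurable_fun setT
    ((fun w => if p e then X (f e) w else 1) : g_sigma_algebraType G -> R).
  have [pe|_] := boolP (p e); last exact: measurable_cst.
  move=> _ C mC; rewrite setTI; apply: sub_gen_smallest; exists (f e); first exact: pD.
  by exists C => //; rewrite setTI.
have : measurable_fun setT
    ((fun w => \prod_(e <- s) (if p e then X (f e) w else 1)) : g_sigma_algebraType G -> R).
  exact: measurable_prod.
move=> /(_ measurableT B mB); rewrite setTI.
by under [X in X @^-1` _]eq_fun do rewrite -big_mkcond.
Qed.

End independence.

(** * Mixed moments of the matrix entries *)

Section entry_moments.
Context d (T : measurableType d) (R : realType) (P : probability T R).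
Variable a : forall n : nat, 'I_n -> 'I_n -> {RV P >-> R}.
Local Notation Ex X := (Rintegral P setT X).

Definition entry n (e : 'I_n * 'I_n) : T -> R :=
  if (e.1 <= e.2)%N then a e.1 e.2 else a e.2 e.1.

Definition monomial n (s : seq ('I_n * 'I_n)) (w : T) : R :=
  \prod_(e <- s) entry e w.

Definition mixed_moment n (s : seq ('I_n * 'I_n)) : R := Ex (monomial s).

Lemma entryC n (x y : 'I_n) : entry (x, y) = entry (y, x).
Proof. by rewrite /entry /=; case: ltngtP => // /val_inj ->. Qed.

Lemma monomial_cat n (s t : seq ('I_n * 'I_n)) w :
  monomial (s ++ t) w = monomial s w * monomial t w.
Proof. exact: big_cat. Qed.

Lemma mixed_moment_perm n (s t : seq ('I_n * 'I_n)) : perm_eq s t ->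
  mixed_moment s = mixed_moment t.
Proof. by move=> st; apply: eq_Rintegral => w _; exact: perm_big. Qed.

Lemma mixed_moment_nil n : mixed_moment ([::] : seq ('I_n * 'I_n)) = 1.
Proof.
rewrite /mixed_moment (_ : monomial _ = cst 1) ?Ex_cst//.
by apply/funext => w; rewrite /monomial big_nil.
Qed.

Hypothesis A1 : condA1 a.
Hypothesis A2 : condA2 a.

Lemma entry_ind (Q : (T -> R) -> Prop) :
  (forall n (p q : 'I_n), (p <= q)%N -> Q (a p q)) ->
  forall n (e : 'I_n * 'I_n), Q (entry e).
Proof.
move=> H n [x y]; rewrite /entry /=; case: leqP => xy; apply: H => //.
exact: ltnW.
Qed.

Lemma entry_moment_bound k : exists2 m : R, 0 <= m & forall n (e : 'I_n * 'I_n),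
  (\int[P]_w (`|entry e w| ^+ k)%:E <= m%:E)%E.
Proof.
have := A2 k; set s := ereal_sup _ => s_fin.
(* The maximum with 0 makes the bound nonnegative and excludes [-oo] without exhibiting an element
   of the set. *)
exists (fine (Order.max s 0)%E).
  by rewrite fine_ge0// le_max lexx orbT.
apply: (@entry_ind (fun X => \int[P]_w (`|X w| ^+ k)%:E <= _)%E) => n p q pq.
rewrite fineK; last first.
  rewrite ge0_fin_numE ?le_max ?lexx ?orbT// gt_max s_fin/= ltry//.
rewrite le_max; apply/orP; left; apply: ereal_sup_ubound; exists n, p, q.
by split => //; rewrite unlock.
Qed.

Lemma finite_moments_entry n (e : 'I_n * 'I_n) : finite_moments P (entry e).
Proof.
have me : measurable_fun setT (entry e) by rewrite /entry; case: ifP.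
split => // k; have [m _ mP] := entry_moment_bound k.
apply/integrableP; split.
  by apply/measurable_EFinP/measurable_funX; exact: measurableT_comp.
apply: le_lt_trans (ltry m); apply: le_trans (mP _ e).
rewrite le_eqVlt; apply/orP; left; apply/eqP/eq_integral => w _.
by rewrite /= ger0_norm.
Qed.

Lemma finite_moments_monomial n (s : seq ('I_n * 'I_n)) : finite_moments P (monomial s).
Proof. by apply: finite_moments_prod => e _; exact: finite_moments_entry. Qed.

(* [2 |x y| <= x^2 + y^2] trades one factor for doubled exponents. *)
Lemma Ex_prod_entry_bound N j : exists2 K : R, 0 <= K &
  forall n (s : seq ('I_n * 'I_n)), size s = N ->
  Ex (fun w => \prod_(e <- s) `|entry e w| ^+ j) <= K.
Proof.
elim: N j => [|N IH] j.
  exists 1 => // n s /size0nil ->.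
  by under eq_Rintegral do rewrite big_nil; rewrite Ex_cst.
have [K K0 KP] := IH (j * 2)%N; have [m m0 mP] := entry_moment_bound (j * 2)%N.
exists (m + K) => [|n [//|e s] /= [sN]]; first exact: addr_ge0.
have fe i : finite_moments P (fun w => `|entry e w| ^+ i).
  by apply: finite_momentsX; apply: finite_moments_norm; exact: finite_moments_entry.
have fs i : finite_moments P (fun w => \prod_(e <- s) `|entry e w| ^+ i).
  apply: finite_moments_prod => f _.
  by apply: finite_momentsX; apply: finite_moments_norm; exact: finite_moments_entry.
apply: (@le_trans _ _ (Ex (fun w => `|entry e w| ^+ (j * 2) +
    \prod_(e <- s) `|entry e w| ^+ (j * 2)))).
  apply: le_Ex => [||w].
  - by under eq_fun do rewrite big_cons; exact: finite_momentsM.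
  - exact: finite_momentsD.
  - have -> : \prod_(f <- s) `|entry f w| ^+ (j * 2) = (\prod_(f <- s) `|entry f w| ^+ j) ^+ 2.
      by rewrite -prodrXl; apply: eq_bigr => f _; rewrite exprM.
    rewrite big_cons exprM; set x := `|_| ^+ j; set y := \prod_(_ <- _) _.
    have x0 : 0 <= x by exact: exprn_ge0.
    have y0 : 0 <= y by apply: prodr_ge0 => i _; exact: exprn_ge0.
    by nra.
rewrite ExD//; apply: lerD; last exact: KP.
by rewrite -lee_fin -Ex_fine//; exact: mP.
Qed.

Lemma mixed_moment_bound : exists K : nat -> R, forall n (s : seq ('I_n * 'I_n)),
  `|mixed_moment s| <= K (size s).
Proof.
have H N : exists K : R, forall n (s : seq ('I_n * 'I_n)), size s = N ->
    `|mixed_moment s| <= K.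
  have [K _ KP] := Ex_prod_entry_bound N 1; exists K => n s sN.
  apply: le_trans (KP n s sN); apply: le_trans (le_norm_Ex _) _.
    exact: finite_moments_monomial.
  rewrite le_eqVlt; apply/orP; left; apply/eqP; apply: eq_Rintegral => w _.
  by rewrite /monomial normr_prod.
have [K KP] := choice H; exists K => n s; exact: KP.
Qed.

Lemma mixed_moment1 n (e : 'I_n * 'I_n) : mixed_moment [:: e] = 0.
Proof.
have E0 : Ex (entry e) = 0.
  apply: (@entry_ind (fun X => Ex X = 0)) => m p q pq.
  by have [+ _] := A1 pq; rewrite unlock /Rintegral => ->.
by rewrite -E0; apply: eq_Rintegral => w _; rewrite /monomial big_seq1.
Qed.

Lemma mixed_moment_sqr n (x y : 'I_n) : mixed_moment [:: (x, y); (y, x)] = 1.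
Proof.
have E1 (e : 'I_n * 'I_n) : Ex (fun w => entry e w ^+ 2) = 1.
  apply: (@entry_ind (fun X => Ex (fun w => X w ^+ 2) = 1)) => m p q pq.
  by have [_] := A1 pq; rewrite unlock /Rintegral => ->.
rewrite -(E1 (x, y)); apply: eq_Rintegral => w _.
by rewrite /monomial big_cons big_seq1 entryC expr2.
Qed.

(** (C1) compares sorted index pairs. If both pairs or neither get swapped, the relevant distance is
    [|x - x'| = |y - y'|]; if exactly one is swapped, it is [|y - x'| = |x - y'|]. The sum of the
    two terms covers all cases. *)
Lemma mixed_moment_cov n (c : nat -> R) :
  (forall tau, 0 <= c tau) ->
  (forall (p q r s : 'I_n), (p <= q)%N -> (r <= s)%N -> (p + q = r + s)%N ->
    `|covariance P (a p q) (a r s)|%E = (c `|p%:Z - r%:Z|%N)%:E) ->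
  forall x y x' y' : 'I_n, (x + y = x' + y')%N ->
  `|mixed_moment [:: (x, y); (x', y')]| <= c `|x%:Z - x'%:Z|%N + c `|y%:Z - x'%:Z|%N.
Proof.
move=> c0 cP.
have H (p q r s : 'I_n) : (p <= q)%N -> (r <= s)%N -> (p + q = r + s)%N ->
    `|Ex (fun w => a p q w * a r s w)| = c `|p%:Z - r%:Z|%N.
  move=> pq rs pqrs; have := cP p q r s pq rs pqrs.
  rewrite unlock (A1 pq).1 (A1 rs).1 unlock /=.
  have -> : ((a p q \- cst 0) * (a r s \- cst 0)) = (fun w => a p q w * a r s w).
    by apply/funext => w; rewrite /GRing.mul/= !subr0.
  rewrite Ex_fine => [[]//|].
  have := finite_momentsM (finite_moments_entry (p, q)) (finite_moments_entry (r, s)).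
  by rewrite /entry /= pq rs.
move=> x y x' y' xy.
have -> : mixed_moment [:: (x, y); (x', y')] = Ex (fun w => entry (x, y) w * entry (x', y') w).
  by apply: eq_Rintegral => w _; rewrite /monomial big_cons big_seq1.
rewrite /entry /=; case: leqP => xy1; case: leqP => xy2.
- by rewrite H// lerDl.
- rewrite H ?(ltnW xy2)//; last by rewrite xy addnC.
  have -> : `|x%:Z - y'%:Z|%N = `|y%:Z - x'%:Z|%N by lia.
  by rewrite lerDr.
- by rewrite H ?(ltnW xy1)// 1?addnC// lerDr.
- rewrite H ?(ltnW xy1) ?(ltnW xy2)//; last by rewrite addnC xy addnC.
  have -> : `|y%:Z - y'%:Z|%N = `|x%:Z - x'%:Z|%N by lia.
  by rewrite lerDl.
Qed.

Hypothesis A3 : condA3 a.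

(** Both sides factor over the anti-diagonals. Each anti-diagonal meets at most one of [s] and [t],
    and the other list contributes an empty product there. *)
Lemma mixed_moment_cat n (s t : seq ('I_n * 'I_n)) :
  (forall e f, e \in s -> f \in t -> (e.1 + e.2 != f.1 + f.2 :> nat)%N) ->
  mixed_moment (s ++ t) = mixed_moment s * mixed_moment t.
Proof.
move=> st.
have vP (e : 'I_n * 'I_n) : (e.1 + e.2 < n.*2.-1)%N.
  by have := ltn_ord e.1; have := ltn_ord e.2; lia.
pose v e := Ordinal (vP e).
pose Y (s : seq ('I_n * 'I_n)) j w := \prod_(e <- s | v e == j) entry e w.
have fY u j : finite_moments P (Y u j).
  by apply: finite_moments_prod => e _; exact: finite_moments_entry.
have mY u : mixed_moment u = \prod_j Ex (Y u j).
  rewrite -(Ex_prod_indep (@A3 n))//.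
  - by apply: eq_Rintegral => w _; rewrite /monomial (partition_big v predT).
  - by rewrite /index_enum -enumT enum_uniq.
  - move=> j B mB; pose f (e : 'I_n * 'I_n) := if (e.1 <= e.2)%N then e else (e.2, e.1).
    have := preimage_generated
      (D := [set pq : 'I_n * 'I_n | (pq.1 <= pq.2)%N /\ (pq.1 + pq.2 = j)%N])
      (X := fun pq => a pq.1 pq.2) (f := f) (p := fun e => v e == j) u _ mB.
    rewrite (_ : (fun w => _) = Y u j); last first.
      apply/funext => w; apply: eq_bigr => e _.
      by rewrite /f /entry; case: ifP.
    apply => // e /eqP <-; rewrite /f /=.
    have [ee|/ltnW ee] := leqP e.1 e.2; first by [].
    by split => //=; rewrite addnC.
rewrite !mY -big_split; apply: eq_bigr => j _ /=.
have YE u : (forall e, e \in u -> v e != j) -> Y u j = cst 1.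
  by move=> uj; apply/funext => w; rewrite /Y big_seq_cond big1// => e /andP[/uj/negbTE ->].
have Ycat w : Y (s ++ t) j w = Y s j w * Y t j w by exact: big_cat.
have [/hasP[e es /eqP vej]|/hasPn sj] := boolP (has (fun e => v e == j) s).
  have Yt : Y t j = cst 1.
    apply: YE => f ft; apply: contra (st _ _ es ft) => /eqP vfj.
    by apply/eqP; have := congr1 val vej; rewrite -vfj.
  rewrite Yt Ex_cst mulr1; apply: eq_Rintegral => w _.
  by apply: (etrans (Ycat w)); rewrite Yt mulr1.
have Ys : Y s j = cst 1 by exact: YE.
rewrite Ys Ex_cst mul1r; apply: eq_Rintegral => w _.
by apply: (etrans (Ycat w)); rewrite Ys mul1r.
Qed.

End entry_moments.

(** * Moments of the semicircle distribution *)

Section semicircle_integral.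
Variable R : realType.
Local Notation mu := (@lebesgue_measure R).
Local Notation sc := (@semicircle R).
Local Open Scope ereal_scope.

Import HBNNSimple.

Lemma measurable_EFin_semicircle_pdf D :
  measurable_fun D (fun x => (@semicircle_pdf R x)%:E).
Proof. by apply/measurable_EFinP; apply: measurable_funTS; exact: measurable_semicircle_pdf. Qed.

(** [semicircle] is defined by its values on sets, so the density enters the integral for simple
    functions first; monotone convergence under both measures does the rest. *)
Lemma ge0_integral_semicircle (f : R -> \bar R) : measurable_fun setT f ->
  (forall x, 0 <= f x) ->
  \int[sc]_x f x = \int[mu]_x (f x * (semicircle_pdf x)%:E).
Proof.
move=> mf f0; pose h := nnsfun_approx measurableT mf.
have pdf0 x : 0 <= (@semicircle_pdf R x)%:E by rewrite lee_fin semicircle_pdf_ge0.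
have mpdf := @measurable_EFin_semicircle_pdf setT.
have fh x : f x = lim (((h n x)%:E : \bar R) @[n --> \oo]).
  by apply/esym/cvg_lim => //; exact: (cvg_nnsfun_approx measurableT mf (fun x _ => f0 x)).
have mh n : measurable_fun setT (fun x => (h n x)%:E).
  exact/measurable_EFinP/measurable_funTS.
have hnd (x : R) m n : (m <= n)%N -> (h m x <= h n x)%R.
  by move=> mn; exact/lefP/nd_nnsfun_approx.
transitivity (lim (\int[sc]_x (h n x)%:E @[n --> \oo])).
  rewrite -monotone_convergence//=.
  - by apply: eq_integral => x _.
  - by move=> n x _; rewrite lee_fin.
  - by move=> x _ m n mn; rewrite lee_fin; exact: hnd.
transitivity (lim (\int[mu]_x ((h n x)%:E * (semicircle_pdf x)%:E) @[n --> \oo])); last first.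
  rewrite -monotone_convergence//=.
  - apply: eq_integral => x _; apply/cvg_lim => //.
    apply: cvgeZr => //.
    exact: (cvg_nnsfun_approx measurableT mf (fun x _ => f0 x)).
  - by move=> n; apply: emeasurable_funM; [exact: mh|exact: mpdf].
  - by move=> n x _; rewrite mule_ge0// lee_fin.
  - move=> x _ m n mn; rewrite lee_wpmul2r// lee_fin; exact: hnd.
apply: congr_lim; apply/funext => n.
have hE x : (h n x)%:E = \sum_(y \in range (h n)) (y * \1_(h n @^-1` [set y]) x)%:E :> \bar R.
  by rewrite {1}(fimfunE (h n)) fsumEFin.
have mI (y : R) : measurable (h n @^-1` [set y]).
  by rewrite -[X in measurable X]setTI; exact: measurable_funP.
have m1 (y : R) : measurable_fun setT (fun x => (y * \1_(h n @^-1` [set y]) x)%:E).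
  by apply/measurable_EFinP; apply: measurable_funM => //; exact: measurable_indic.
under eq_integral do rewrite hE.
rewrite ge0_integral_fsum//; last by move=> y x _; exact: nnfun_muleindic_ge0.
transitivity (\int[mu]_x (\sum_(y \in range (h n))
    ((y * \1_(h n @^-1` [set y]) x)%:E * (semicircle_pdf x)%:E))); last first.
  apply: eq_integral => x _; rewrite hE ge0_mule_fsuml// => y.
  exact: nnfun_muleindic_ge0.
rewrite ge0_integral_fsum//; last 2 first.
  - by move=> y; apply: emeasurable_funM; [exact: m1|exact: mpdf].
  - by move=> y x _; rewrite mule_ge0//; exact: nnfun_muleindic_ge0.
apply: eq_fsbigr => y /[!inE] -[z _ zy].
have y0 : (0 <= y)%R by rewrite -zy.
under eq_integral do rewrite EFinM.
under [RHS]eq_integral do rewrite EFinM -muleA.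
have m1' : measurable_fun setT (fun x => (\1_(h n @^-1` [set y]) x)%:E : \bar R).
  exact/measurable_EFinP/measurable_indic.
rewrite [LHS]ge0_integralZl//.
rewrite [RHS]ge0_integralZl//; last 2 first.
- by apply: emeasurable_funM; [exact: m1'|exact: mpdf].
- by move=> x _; rewrite mule_ge0// lee_fin.
congr (_ * _); rewrite integral_indic// setIT /= /semicircle.
rewrite integral_mkcond; apply: eq_integral => x _.
by rewrite patchE indicE; case: ifPn => _; rewrite ?mul1e ?mul0e.
Qed.

Lemma integral_semicircle (f : R -> R) : measurable_fun setT f ->
  \int[sc]_x (f x)%:E = \int[mu]_x (f x * semicircle_pdf x)%:E.
Proof.
move=> mf; have mEf : measurable_fun setT (EFin \o f) by exact/measurable_EFinP.
rewrite integralE [RHS]integralE.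
rewrite !ge0_integral_semicircle//; [|exact: measurable_funeneg|exact: measurable_funepos].
have p0 (x : R) : (0 <= semicircle_pdf x)%R by exact: semicircle_pdf_ge0.
congr (_ - _); apply: eq_integral => x _.
  rewrite !funeposE -!EFin_max -EFinM; congr EFin.
  by rewrite maxr_pMl// mul0r.
rewrite !funenegE -!EFinN -!EFin_max -EFinM; congr EFin.
by rewrite maxr_pMl// mul0r mulNr.
Qed.

End semicircle_integral.

Section semicircle_moments.
Variable R : realType.
Local Notation mu := (@lebesgue_measure R).
Local Notation sc := (@semicircle R).
Local Notation Ex X := (Rintegral sc setT X).

Lemma semicircle_norm_moment k : (\int[sc]_x (`|x| ^+ k)%:E <= (2 ^+ k)%:E)%E.
Proof.
have mk : measurable_fun setT (fun x : R => `|x| ^+ k).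
  by apply: measurable_funX; exact: normr_measurable.
rewrite integral_semicircle//.
rewrite -[leRHS]mule1 -integral_semicircle_pdf -ge0_integralZl//; last 2 first.
- exact: measurable_EFin_semicircle_pdf.
- by move=> x _; rewrite lee_fin semicircle_pdf_ge0.
apply: ge0_le_integral => //.
- by move=> x _; rewrite lee_fin mulr_ge0// semicircle_pdf_ge0.
- by apply/measurable_EFinP; apply: measurable_funM => //; exact: measurable_semicircle_pdf.
- by apply: emeasurable_funM => //; exact: measurable_EFin_semicircle_pdf.
move=> x _; rewrite -EFinM lee_fin.
have [xI|xI] := boolP (x \in `[-2, 2]).
  rewrite ler_wpM2r ?semicircle_pdf_ge0// lerXn2r ?nnegrE//.
  by rewrite ler_norml; move: xI; rewrite in_itv.
rewrite /semicircle_pdf indicE memNset ?mulr0//=.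
by apply/negP; rewrite -topredE/= in xI.
Qed.

Lemma finite_moments_semicircle : finite_moments sc (@id R).
Proof.
split=> [|k]; first exact: measurable_id.
apply/integrableP; split.
  by apply/measurable_EFinP; apply: measurable_funX; exact: normr_measurable.
apply: le_lt_trans (ltry (2 ^+ k)); apply: le_trans (semicircle_norm_moment k).
rewrite le_eqVlt; apply/orP; left; apply/eqP/eq_integral => x _.
by rewrite /= ger0_norm.
Qed.

(** [cheb h x] is [U_h (x / 2)] with [U_h] the Chebyshev polynomial of the second kind. These are
    the orthogonal polynomials of the semicircle law, and [semicircle_cheb] is their orthogonality
    to the constant 1. *)
Fixpoint cheb (h : nat) (x : R) : R :=
  match h with
  | 0%N => 1
  | h'.+1 => match h' with 0%N => x | h''.+1 => x * cheb h' x - cheb h'' x end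
  end.

Lemma chebSS h x : cheb h.+2 x = x * cheb h.+1 x - cheb h x.
Proof. by []. Qed.

Lemma cheb_ind2 (Q : (R -> R) -> Prop) : Q (cheb 0) -> Q (cheb 1) ->
  (forall h, Q (cheb h) -> Q (cheb h.+1) -> Q (cheb h.+2)) -> forall h, Q (cheb h).
Proof.
move=> Q0 Q1 QS h; suff: Q (cheb h) /\ Q (cheb h.+1) by case.
by elim: h => // h [Qh QSh]; split => //; exact: QS.
Qed.

Lemma finite_moments_cheb h : finite_moments sc (cheb h).
Proof.
apply: cheb_ind2 => [||{}h H0 H1]; first exact: finite_moments_cst.
  exact: finite_moments_semicircle.
apply: finite_momentsB => //; apply: finite_momentsM => //.
exact: finite_moments_semicircle.
Qed.

Lemma continuous_cheb h : continuous (cheb h).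
Proof.
apply: (@cheb_ind2 (fun f => continuous f)) => [||{}h H0 H1] x.
- exact: cvg_cst.
- exact: cvg_id.
by apply: cvgB; [apply: cvgM; [exact: cvg_id|exact: H1]|exact: H0].
Qed.

Lemma cheb_cos h u : cheb h (2 * cos u) * sin u = sin (h.+1%:R * u).
Proof.
suff: cheb h (2 * cos u) * sin u = sin (h.+1%:R * u) /\
      cheb h.+1 (2 * cos u) * sin u = sin (h.+2%:R * u) by case.
elim: h => [|h [H0 H1]].
  split; rewrite /= ?mul1r//.
  by have -> : 2 * u = u + u; [ring|rewrite sinD; ring].
split => //; set x := 2 * cos u in H0 H1 *.
have -> : cheb h.+2 x * sin u = x * (cheb h.+1 x * sin u) - cheb h x * sin u.
  by rewrite chebSS; ring.
rewrite H1 H0 /x.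
have -> : h.+3%:R * u = h.+2%:R * u + u by rewrite -natr1; ring.
have -> : h.+1%:R * u = h.+2%:R * u - u by rewrite -[in RHS]natr1; ring.
by rewrite sinB sinD; ring.
Qed.

Lemma integral_cheb_sqrt4B h : (0 < h)%N ->
  (\int[mu]_(x in `[(-2)%R, 2%R]) (cheb h x * Num.sqrt (4 - x ^+ 2))%:E = 0)%E.
Proof.
move=> h0; pose F := fun t : R => 2 * cos t.
have dF (t : R) : is_derive t 1 F (- (2 * sin t)).
  rewrite /F; apply: is_derive_eq.
  by rewrite /GRing.scale/=; ring.
have F'E : F^`()%classic = fun t => - (2 * sin t).
  by apply/funext => t; rewrite derive1E; apply: derive_val.
have cF : continuous F.
  by move=> t; apply/differentiable_continuous/derivable1_diffP; case: (dF t).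
have cF' : continuous F^`()%classic.
  rewrite F'E => t; apply: cvgN; apply: cvgM; first exact: cvg_cst.
  exact: continuous_sin.
have pi0 := pi_gt0 R.
have FN : F pi = -2 by rewrite /F cospi mulrN1.
have FP : F 0 = 2 by rewrite /F cos0 mulr1.
have -> : `[(-2 : R), (2 : R)]%classic = `[F pi, F 0]%classic by rewrite FN FP.
rewrite integration_by_substitution_decreasing ?ltW//; first last.
- apply: continuous_subspaceT => x; apply: cvgM; first exact: continuous_cheb.
  exact: continuous_sqrt4B.
- split.
  + by move=> t _; case: (dF t).
  + by apply: cvg_at_right_filter; exact: cF.
  + by apply: cvg_at_left_filter; exact: cF.
- apply/cvg_ex; exists (F^`()%classic pi).
  by apply: cvg_at_left_filter; exact: cF'.
- apply/cvg_ex; exists (F^`()%classic 0).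
  by apply: cvg_at_right_filter; exact: cF'.
- by move=> /= x y xI yI xy; rewrite /F ltr_pM2l// ltr_cos.
(* Under [x = 2 cos t] the integrand becomes [4 sin ((h + 1) t) sin t = 2 (cos (h t) - cos ((h + 2)
   t))]. Its primitive [G] divides by [h], hence [0 < h], and vanishes at both 0 and [pi]. *)
pose G := fun t : R => 2 * (h%:R^-1 * sin (h%:R * t) - h.+2%:R^-1 * sin (h.+2%:R * t)).
pose g := fun t : R => 2 * (cos (h%:R * t) - cos (h.+2%:R * t)).
transitivity (\int[mu]_(x in `[0%R, pi]) (g x)%:E)%E.
  apply: eq_integral => t; rewrite inE/= in_itv/= => tI.
  rewrite !fctE /= F'E /g opprK; congr EFin.
  have -> : 4 - F t ^+ 2 = (2 * sin t) ^+ 2.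
    by rewrite /F !exprMn sin2cos2; ring.
  rewrite sqrtr_sqr ger0_norm ?mulr_ge0 ?sin_ge0_pi//.
  transitivity (4 * (cheb h (F t) * sin t) * sin t); first by ring.
  rewrite cheb_cos.
  have -> : h%:R * t = h.+1%:R * t - t by rewrite -[in RHS]natr1; ring.
  have -> : h.+2%:R * t = h.+1%:R * t + t by rewrite -[in LHS]natr1; ring.
  by rewrite cosB cosD; ring.
have hn0 : h%:R != 0 :> R by rewrite pnatr_eq0 -lt0n.
have dS (c t : R) : c != 0 -> is_derive t 1 (fun t : R => c^-1 * sin (c * t)) (cos (c * t)).
  move=> c0; apply: is_derive_eq; rewrite /GRing.scale/=.
  by field.
have dG (t : R) : is_derive t 1 G (g t).
  have d1 := dS h%:R t hn0.
  have d2 : is_derive t 1 (fun t : R => h.+2%:R^-1 * sin (h.+2%:R * t)) (cos (h.+2%:R * t)).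
    by apply: dS; rewrite pnatr_eq0.
  exact: is_derive_eq.
have cG : continuous G.
  by move=> t; apply/differentiable_continuous/derivable1_diffP; case: (dG t).
have sinpi (m : nat) : sin (m%:R * pi) = 0 :> R.
  elim: m => [|m IH]; first by rewrite mul0r sin0.
  by rewrite -natr1 mulrDl mul1r sinDpi IH oppr0.
rewrite (@continuous_FTC2 _ g G)//.
- by rewrite /G !sinpi !mulr0 !sin0 !mulr0 !subrr !mulr0 subee.
- apply: continuous_subspaceT => t.
  have cc (c : R) : cos (c * t) @[t --> t] --> cos (c * t).
    apply: (cvg_comp _ cos); last exact: continuous_cos.
    by apply: cvgM; [exact: cvg_cst|exact: cvg_id].
  by apply: cvgM; [exact: cvg_cst|apply: cvgB; exact: cc].
- split.
  + by move=> t _; case: (dG t).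
  + by apply: cvg_at_right_filter; exact: cG.
  + by apply: cvg_at_left_filter; exact: cG.
- by move=> t _; rewrite derive1E; apply: derive_val.
Qed.

Lemma semicircle_cheb h : Ex (cheb h) = (h == 0)%:R.
Proof.
case: h => [|h]; first exact: Ex_cst.
rewrite /Rintegral integral_semicircle; last by case: (finite_moments_cheb h.+1).
transitivity (fine (\int[mu]_(x in `[(-2)%R, 2%R])
    ((2 * pi)^-1%:E * (cheb h.+1 x * Num.sqrt (4 - x ^+ 2))%:E))%E).
  rewrite [in RHS]integral_mkcond; congr fine; apply: eq_integral => x _.
  rewrite /semicircle_pdf patchE indicE; case: ifPn => _.
    by rewrite mulr1 -EFinM mulrCA.
  by rewrite !mulr0.
rewrite integralZl//; first by rewrite integral_cheb_sqrt4B// mule0.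
apply: continuous_compact_integrable; first exact: segment_compact.
apply: continuous_subspaceT => x; apply: cvgM; first exact: continuous_cheb.
exact: continuous_sqrt4B.
Qed.

End semicircle_moments.

(** * Empirical distributions of symmetric matrices *)

Section spectral_moments.
Variable R : realType.

Lemma char_poly_conj (F : fieldType) n (U A : 'M[F]_n) : U \in unitmx ->
  char_poly (invmx U *m A *m U) = char_poly A.
Proof.
move=> Uu; pose U' := map_mx polyC U; pose V' := map_mx polyC (invmx U).
have VU : V' *m U' = 1%:M by rewrite -map_mxM mulVmx// map_mx1.
have -> : char_poly (invmx U *m A *m U) = \det (V' *m char_poly_mx A *m U').
  rewrite /char_poly /char_poly_mx mulmxBr mulmxBl mul_mx_scalar -scalemxAl VU.
  by rewrite scalemx1 !map_mxM.
by rewrite !det_mulmx mulrAC -det_mulmx VU det1 mul1r.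
Qed.

Lemma diag_mx_exp (F : comNzRingType) n (D : 'rV[F]_n.+1) k :
  diag_mx D ^+ k = diag_mx (\row_j D 0 j ^+ k).
Proof.
elim: k => [|k IH].
  by rewrite expr0; apply/matrixP => i j; rewrite !mxE expr0.
rewrite exprS IH; apply/matrixP => i j; rewrite -mulmxE mul_diag_mx !mxE.
by rewrite exprS mulrnAr.
Qed.

Lemma conj_exp (F : fieldType) n (U A : 'M[F]_n.+1) k : U \in unitmx ->
  (invmx U *m A *m U) ^+ k = invmx U *m A ^+ k *m U.
Proof.
move=> Uu; elim: k => [|k IH]; first by rewrite !expr0 mulmx1 mulVmx.
by rewrite !exprS IH -!mulmxE -!mulmxA mulKVmx// !mulmxA.
Qed.

(** The spectral theorem is applied over [R[i]], while [eigvals] lists real roots. The two lists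
    agree up to order because both split the same characteristic polynomial. *)
Lemma trace_exp_eigvals n (A : 'M[R]_n.+1) k : A^T = A ->
  \tr (A ^+ k) = \sum_(x <- eigvals A) x ^+ k.
Proof.
move=> AT; pose f := real_complex R : {rmorphism R -> R[i]}.
have fr x : f x \is Num.real by apply/complex_realP; exists x.
have hA : map_mx f A \is hermsymmx.
  apply: realsym_hermsym; last by apply/mxOverP => i j; rewrite mxE.
  by apply/is_hermitianmxP; rewrite expr0 scale1r map_mx_id// map_trmx AT.
have [/orthomx_spectralP eqA dr] :=
  (hermitian_normalmx hA, hermitian_spectral_diag_real hA).
set D := spectral_diag _ in eqA dr; set U := spectralmx _ in eqA.
have Uu : U \in unitmx by exact: spectral_unit.
pose s := [seq complex.Re (D 0 i) | i <- enum 'I_n.+1].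
have fD i : f (complex.Re (D 0 i)) = D 0 i.
  by have /mxOverP/(_ 0 i)/complex_realP[x Ex] := dr; rewrite /f Ex.
have : char_poly (map_mx f A) = \prod_i ('X - (D 0 i)%:P).
  rewrite eqA char_poly_conj// char_poly_trig; last exact: diag_mx_is_trig.
  by apply: eq_bigr => i _; rewrite mxE eqxx mulr1n.
rewrite -map_char_poly => cpD.
have /prod_XsubC_eq es :
    \prod_(x <- eigvals A) ('X - x%:P) = \prod_(x <- s) ('X - x%:P).
  rewrite -char_poly_eigvals//; apply: (map_poly_inj f).
  rewrite cpD rmorph_prod /= big_map big_enum /=.
  by apply: eq_bigr => i _; rewrite /= map_polyXsubC /= fD.
rewrite (perm_big _ es) big_map big_enum /=; apply: (fmorph_inj f).
transitivity (\sum_i D 0 i ^+ k); last first.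
  by rewrite rmorph_sum; apply: eq_bigr => i _; rewrite rmorphXn /= fD.
have -> : f (\tr (A ^+ k)) = \tr (map_mx f A ^+ k).
  by rewrite -trace_map_mx; congr (\tr _); exact: (rmorphXn (map_mx f) k A).
rewrite eqA conj_exp// mxtrace_mulC mulmxA mulmxV// mul1mx diag_mx_exp.
by rewrite mxtrace_diag; apply: eq_bigr => i _; rewrite mxE.
Qed.

Lemma integral_esd n (A : 'M[R]_n) (f : R -> R) : A^T = A ->
  measurable_fun setT f ->
  (\int[esd A]_x (f x)%:E = (n%:R^-1 * \sum_(x <- eigvals A) f x)%:E)%E.
Proof.
move=> AT mf.
have H (g : R -> R) : measurable_fun setT g -> (forall x, 0 <= g x) ->
    (\int[esd A]_x (g x)%:E = (n%:R^-1 * \sum_(x <- eigvals A) g x)%:E)%E.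
  move=> mg g0; have mEg : measurable_fun setT (EFin \o g) by exact/measurable_EFinP.
  rewrite ge0_integral_mscale//; last by move=> x _; rewrite lee_fin.
  rewrite ge0_integral_measure_sum//; last by move=> x _; rewrite lee_fin.
  rewrite (big_nth 0) size_eigvals// big_mkord EFinM -sumEFin; congr (_ * _)%E.
  by apply: eq_bigr => i _; rewrite integral_dirac// diracT mul1e.
have mEf : measurable_fun setT (EFin \o f) by exact/measurable_EFinP.
rewrite integralE.
have pE x : ((EFin \o f)^\+ x = (Num.max (f x) 0)%:E)%E by rewrite funeposE -EFin_max.
have nE x : ((EFin \o f)^\- x = (Num.max (- f x) 0)%:E)%E by rewrite funenegE -EFinN -EFin_max.
under eq_integral do rewrite pE; under [X in (_ - X)%E]eq_integral do rewrite nE.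
rewrite !H.
- rewrite -EFinB -mulrBr -sumrB; congr (_ * _)%:E; apply: eq_bigr => x _.
  have [x0|/ltW x0] := lerP 0 (f x).
    by rewrite max_r ?oppr_le0// subr0.
  by rewrite max_l ?oppr_ge0// sub0r opprK.
- by apply: measurable_maxr => //; exact: measurableT_comp.
- by move=> x; rewrite le_max lexx orbT.
- exact: measurable_maxr.
- by move=> x; rewrite le_max lexx orbT.
Qed.

End spectral_moments.

(** * The method of moments *)

Section weierstrass.
Variable R : realType.

Lemma uniform_continuous_itv (f : R -> R) (a b e : R) : continuous f -> 0 < e ->
  exists2 d : R, 0 < d &
    forall x y, x \in `[a, b] -> `|x - y| < d -> `|f x - f y| <= e.
Proof.
move=> cf e0.
have /compact_near_coveringP cpt : compact `[a, b] by exact: segment_compact.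
pose Q (d x : R) := forall y, `|x - y| < d -> `|f x - f y| <= e.
have H : \forall d \near (0 : R)^'+, `[a, b] `<=` Q d.
  apply: cpt => x _.
  have e20 : 0 < e / 2 by exact: divr_gt0.
  have /cvgrPdist_lt/(_ _ e20)/nbhs_ballP[d /= d0 dP] := cf x.
  exists (ball x (d / 2), [set r | r < d / 2]) => /=.
    split; first by apply: nbhsx_ballx; exact: divr_gt0.
    by apply: nbhs_right_lt; exact: divr_gt0.
  move=> [x' r] /= [xx' rd] y x'y.
  have h1 : `|f x - f x'| < e / 2.
    apply: dP; rewrite /ball/=; apply: lt_le_trans xx' _.
    by have := d0; lra.
  have h2 : `|f x - f y| < e / 2.
    apply: dP; rewrite /ball/= (_ : x - y = (x - x') + (x' - y)); last by ring.
    apply: le_lt_trans (ler_normD _ _) _; rewrite (splitr d).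
    by apply: ltrD => //; exact: lt_trans rd.
  rewrite (_ : f x' - f y = (f x - f y) - (f x - f x')); last by ring.
  by apply: le_trans (ler_normB _ _) _; rewrite (splitr e); apply: ltW; apply: ltrD.
have [d [d0 dP]] := filter_ex (filterI (nbhs_right_gt (0 : R)) H).
by exists d => // x y xab; exact: dP.
Qed.

(* The Bernstein operator, by conditioning on the first of [N] Bernoulli
   trials; [phi k] stands for the value at [k] successes. *)
Fixpoint bern N (phi : nat -> R) : {poly R} :=
  if N is N'.+1 then
    'X * bern N' (fun k => phi k.+1) + (1 - 'X) * bern N' phi
  else (phi 0%N)%:P.

Lemma bernS N phi x : (bern N.+1 phi).[x] =
  x * (bern N (fun k => phi k.+1)).[x] + (1 - x) * (bern N phi).[x].
Proof. by rewrite /= !hornerE. Qed.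

Lemma bern_linear N (c d e x : R) (phi psi : nat -> R) :
  (bern N (fun k => c * phi k + d * psi k + e)).[x] =
  c * (bern N phi).[x] + d * (bern N psi).[x] + e.
Proof.
elim: N phi psi => [|N IH] phi psi; first by rewrite /= !hornerC.
by rewrite !bernS !IH; ring.
Qed.

Lemma le_bern N (phi psi : nat -> R) x : 0 <= x <= 1 ->
  (forall k, (k <= N)%N -> phi k <= psi k) -> (bern N phi).[x] <= (bern N psi).[x].
Proof.
move=> /andP[x0 x1]; elim: N phi psi => [|N IH] phi psi H.
  by rewrite /= !hornerC H.
rewrite !bernS lerD// ler_wpM2l ?subr_ge0// IH// => k kN; apply: H => //.
exact: leqW.
Qed.

(** The second moment of the binomial law about a point [c]. It is general in [c] because a success
    in the first trial moves [c] by one in the induction; it is used for [c = N x]. *)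
Lemma bern_variance N (c x : R) :
  (bern N (fun k => (k%:R - c) ^+ 2)).[x] = (N%:R * x - c) ^+ 2 + N%:R * x * (1 - x).
Proof.
elim: N c => [|N IH] c; first by rewrite /= !hornerC; ring.
rewrite bernS IH; have -> : (fun k => (k.+1%:R - c) ^+ 2) = (fun k => (k%:R - (c - 1)) ^+ 2).
  by apply/funext => k; rewrite -natr1; congr (_ ^+ 2); ring.
by rewrite IH -natr1; ring.
Qed.

Lemma weierstrass01 (g : R -> R) (M e : R) : continuous g ->
  (forall x, `|g x| <= M) -> 0 < e ->
  exists p : {poly R}, forall x, 0 <= x <= 1 -> `|g x - p.[x]| <= e.
Proof.
move=> cg gM e0.
have e20 : 0 < e / 2 by exact: divr_gt0.
have [d d0 dP] := @uniform_continuous_itv g 0 1 _ cg e20.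
have M0 : 0 <= M by apply: le_trans (gM 0).
(* Where [|x - k / N| >= d], the trivial bound [2 M] is at most [C (x - k / N)^2]. Averaging this
   with the binomial variance leaves [C x (1 - x) / N <= C / N]. *)
pose C := 2 * M / d ^+ 2.
have C0 : 0 <= C by apply: divr_ge0; [exact: mulr_ge0|exact: sqr_ge0].
have [N N0 NC] : exists2 N : nat, (0 < N)%N & C / N%:R <= e / 2.
  pose N := (Num.trunc (C / (e / 2))).+1; exists N => //.
  rewrite ler_pdivrMr ?ltr0n// mulrC -ler_pdivrMr//.
  by apply: ltW; exact: truncnS_gt.
have nN0 : N%:R != 0 :> R by rewrite pnatr_eq0 -lt0n.
pose phi (k : nat) := g (k%:R / N%:R).
exists (bern N phi) => x x01; have /andP[x0 x1] := x01.
pose psi (k : nat) := (k%:R - N%:R * x) ^+ 2.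
have key k : (k <= N)%N -> `|g x - phi k| <= e / 2 + C / N%:R ^+ 2 * psi k.
  move=> kN; have [xk|xk] := ltP `|x - k%:R / N%:R| d.
    apply: le_trans (dP _ _ _ xk) _; first by rewrite in_itv/= x0 x1.
    by rewrite lerDl mulr_ge0 ?sqr_ge0// divr_ge0 ?exprn_ge0.
  apply: (@le_trans _ _ (2 * M)).
    apply: le_trans (ler_normB _ _) _.
    by rewrite mulr_natl mulr2n lerD //; exact: gM.
  rewrite -[leLHS]add0r; apply: lerD; first exact: ltW.
  have -> : C / N%:R ^+ 2 * psi k = 2 * M * ((x - k%:R / N%:R) ^+ 2 / d ^+ 2).
    by rewrite /C /psi; field; rewrite nN0 gt_eqF.
  rewrite ler_peMr ?mulr_ge0// ler_pdivlMr ?exprn_gt0// mul1r.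
  by rewrite -[leRHS]real_normK ?num_real// lerXn2r ?nnegrE// ltW.
(* Here [s] is 1 or -1, which treats the two signs of the error at once. *)
have B (s : R) : s ^+ 2 = 1 -> s * (g x - (bern N phi).[x]) <= e.
  move=> s1.
  have -> : s * (g x - (bern N phi).[x]) =
      (bern N (fun k => - s * phi k + 0 * phi k + s * g x)).[x].
    by rewrite bern_linear; ring.
  apply: (@le_trans _ _ (bern N (fun k => C / N%:R ^+ 2 * psi k + 0 * psi k + e / 2)).[x]).
    apply: le_bern => // k /key; rewrite mul0r addr0 [in leRHS]addrC mul0r addr0.
    apply: le_trans; rewrite -[leRHS]mul1r.
    have -> : 1 = `|s| by apply/eqP; rewrite eq_sym -sqrp_eq1// -normrX s1 normr1.
    by rewrite -normrM; apply: le_trans (ler_norm _); rewrite mulrBr addrC mulNr.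
  rewrite bern_linear /psi bern_variance subrr expr0n/= add0r mul0r addr0.
  rewrite [leRHS]splitr lerD2r; apply: le_trans NC.
  have -> : C / N%:R ^+ 2 * (N%:R * x * (1 - x)) = C / N%:R * (x * (1 - x)) by field.
  by apply: ler_piMr; [exact: divr_ge0|nra].
rewrite ler_norml; apply/andP; split.
  by rewrite lerNl -mulN1r; apply: B; rewrite sqrrN expr1n.
by rewrite -[leLHS]mul1r; apply: B; rewrite expr1n.
Qed.

Lemma weierstrass (f : R -> R) (M A e : R) : continuous f ->
  (forall x, `|f x| <= M) -> 0 < A -> 0 < e ->
  exists p : {poly R}, forall x, `|x| <= A -> `|f x - p.[x]| <= e.
Proof.
move=> cf fM A0 e0; pose g y := f (2 * A * y - A).
have cg : continuous g.
  move=> y; apply: (cvg_comp (fun y => 2 * A * y - A) f); last exact: cf.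
  by apply: cvgB; [apply: cvgM; [exact: cvg_cst|exact: cvg_id]|exact: cvg_cst].
have [q qP] := weierstrass01 cg (fun x => fM _) e0.
exists (q \Po ((2 * A)^-1 *: 'X + (2^-1)%:P)) => x xA.
rewrite horner_comp !hornerE; set y := (2 * A)^-1 * x + 2^-1.
have -> : f x = g y by rewrite /g /y; congr f; field; rewrite gt_eqF.
apply: qP; rewrite /y; move: xA; rewrite ler_norml => /andP[h1 h2].
have -> : (2 * A)^-1 * x + 2^-1 = (x + A) / (2 * A) by field; rewrite gt_eqF.
have A2 : 0 < 2 * A by exact: mulr_gt0.
by rewrite ler_pdivrMr// ler_pdivlMr//; apply/andP; split; lra.
Qed.

End weierstrass.

(** * From convergence of moments to convergence of integrals *)

Section method_of_moments.
Variable R : realType.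

Local Notation Ex X := (Rintegral (@semicircle R) setT X).

(* Outside [-3, 3] the error of a polynomial approximation is dominated by a
   high even power of [x / 3], whose mean under measures with nearly semicircular
   moments is at most about [(2 / 3) ^+ (2 * L)]. *)
Lemma weierstrass_power (f : R -> R) (M e : R) : continuous f ->
  (forall x, `|f x| <= M) -> 0 < e ->
  exists (p : {poly R}) (L : nat) (A : R), [/\ 0 <= A, A * (4 / 9) ^+ L <= e &
    forall x, `|f x - p.[x]| <= e + A * (x / 3) ^+ (2 * L)].
Proof.
move=> cf fM e0; have [p pP] := weierstrass cf fM (ltr0n R 3) e0.
have M0 : 0 <= M by apply: le_trans (fM 0).
pose S : R := \sum_(i < size p) `|p`_i|.
have S0 : 0 <= S by apply: sumr_ge0.
(* For [|x| >= 3] the error is at most [(M + S) |x|^D = A (|x| / 3)^D], and the exponent may be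
   raised to [2 L] since [L >= D]. The other lower bound on [L], namely [L0], makes [A (4 / 9)^L]
   small. *)
pose D := size p; pose A := (M + S) * 3 ^+ D.
have A0 : 0 <= A by rewrite mulr_ge0 ?addr_ge0 ?exprn_ge0.
have : (fun L => A * (4 / 9) ^+ L) @ \oo --> A * 0.
  by apply: cvgM; [exact: cvg_cst|apply: cvg_expr; rewrite ger0_norm; lra].
rewrite mulr0 => /cvgrPdist_lt/(_ _ e0)[L0 _ L0P].
pose L := maxn L0 D; exists p, L, A; split => //.
  have := L0P L (leq_maxl _ _); rewrite /= sub0r normrN => /ltW.
  by apply: le_trans; exact: ler_norm.
move=> x; have [x3|/ltW x3] := leP `|x| 3.
  apply: le_trans (pP x x3) _; rewrite lerDl mulr_ge0//.
  by rewrite mulnC exprM sqr_ge0.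
rewrite -[leLHS]add0r lerD ?(ltW e0)//.
have x1 : 1 <= `|x| by apply: le_trans x3; rewrite ler1n.
have px : `|p.[x]| <= S * `|x| ^+ D.
  rewrite horner_coef mulr_suml; apply: le_trans (ler_norm_sum _ _ _) _.
  apply: ler_sum => i _; rewrite normrM normrX ler_wpM2l//.
  by apply: ler_weXn2l => //; exact: ltnW.
apply: (@le_trans _ _ ((M + S) * `|x| ^+ D)).
  apply: le_trans (ler_normB _ _) _; rewrite mulrDl lerD//.
  by apply: le_trans (fM x) _; rewrite ler_peMr// exprn_ege1.
rewrite /A -mulrA ler_wpM2l ?addr_ge0//.
have -> : (x / 3) ^+ (2 * L) = (`|x| / 3) ^+ (2 * L).
  by rewrite !exprM; congr (_ ^+ _); rewrite !exprMn real_normK ?num_real.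
have -> : `|x| ^+ D = 3 ^+ D * (`|x| / 3) ^+ D by rewrite -exprMn mulrC divfK.
rewrite ler_wpM2l ?exprn_ge0//; apply: ler_weXn2l.
  by rewrite ler_pdivlMr// mul1r.
by rewrite (leq_trans (leq_maxr L0 D))// mul2n -addnn leq_addr.
Qed.

Lemma Ex_semicircle_power L : Ex (fun x => (x / 3) ^+ (2 * L)) <= (4 / 9) ^+ L.
Proof.
have fid := @finite_moments_semicircle R.
have fX k : finite_moments (@semicircle R) (fun x => x ^+ k) by exact: finite_momentsX.
have -> : (fun x : R => (x / 3) ^+ (2 * L)) = (fun x => (3 ^- (2 * L)) * x ^+ (2 * L)).
  by apply/funext => x; rewrite exprMn mulrC exprVn.
rewrite ExZ//; have -> : (4 / 9 : R) ^+ L = 3 ^- (2 * L) * 2 ^+ (2 * L).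
  by rewrite !exprM -exprVn -exprMn; congr (_ ^+ _); field.
rewrite ler_wpM2l ?invr_ge0 ?exprn_ge0// -lee_fin -Ex_fine//.
apply: le_trans (semicircle_norm_moment _ _).
rewrite le_eqVlt; apply/orP; left; apply/eqP; apply: eq_integral => x _.
by rewrite !exprM real_normK ?num_real.
Qed.

Lemma method_of_moments (s : nat -> seq R) (f : R -> R) :
  (forall n, size (s n) = n) ->
  (forall k, (n%:R^-1 * \sum_(x <- s n) x ^+ k) @[n --> \oo] --> Ex (fun x => x ^+ k)) ->
  continuous f -> bounded_fun f ->
  (n%:R^-1 * \sum_(x <- s n) f x) @[n --> \oo] --> Ex f.
Proof.
move=> sn smom cf bf.
have [M fM] : exists M : R, forall x, `|f x| <= M.
  case: bf => M [_ MP]; exists (M + 1) => x.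
  by apply: MP => //; rewrite ltrDl.
pose I n (g : R -> R) := n%:R^-1 * \sum_(x <- s n) g x.
have fX k : finite_moments (@semicircle R) (fun x => x ^+ k).
  by apply: finite_momentsX; exact: finite_moments_semicircle.
have fp (p : {poly R}) : finite_moments (@semicircle R) (fun x => p.[x]).
  under eq_fun do rewrite horner_coef.
  by apply: finite_moments_sum => i _; exact: finite_momentsZ.
have mf : measurable_fun setT f by exact: continuous_measurable_fun.
have ff : finite_moments (@semicircle R) f.
  apply: (@le_finite_moments _ _ _ _ _ (cst M)) => //; last exact: finite_moments_cst.
  by move=> x; apply: le_trans (ler_norm _); exact: fM.
have Ip (p : {poly R}) : I n (fun x => p.[x]) @[n --> \oo] --> Ex (fun x => p.[x]).
  have -> : (fun n => I n (fun x => p.[x])) =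
      (fun n => \sum_(i < size p) p`_i * I n (fun x => x ^+ i)).
    apply/funext => n; rewrite /I; under eq_bigr do rewrite horner_coef.
    rewrite exchange_big /= mulr_sumr; apply: eq_bigr => i _.
    by rewrite mulrCA -mulr_sumr.
  rewrite (_ : Ex _ = \sum_(i < size p) p`_i * Ex (fun x => x ^+ i)).
    by apply: cvg_big => [|i _]; [exact: add_continuous|apply: cvgM]; [exact: cvg_cst|exact: smom].
  under eq_Rintegral do rewrite horner_coef.
  rewrite Ex_sum; first by apply: eq_bigr => i _; rewrite ExZ.
  by move=> i _; exact: finite_momentsZ.
(* The three errors combined by [tri] are [2 d], [d] and [3 d], together less than [7 d]. *)
apply/cvgrPdist_le => e e0; pose d := e / 7.
have d0 : 0 < d by exact: divr_gt0.
have [p [L [A [A0 AL fpL]]]] := weierstrass_power cf fM d0.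
pose h (x : R) := (x / 3) ^+ (2 * L).
have Ih : A * I n h @[n --> \oo] --> A * Ex h.
  apply: cvgM; first exact: cvg_cst.
  have -> : h = (fun x => (3 ^- (2 * L) *: 'X^(2 * L)).[x]).
    by apply/funext => x; rewrite /h hornerZ hornerXn exprMn mulrC exprVn.
  exact: Ip.
have AEh : A * Ex h <= d.
  by apply: le_trans AL; rewrite ler_wpM2l//; exact: Ex_semicircle_power.
have fh : finite_moments (@semicircle R) h.
  apply: finite_momentsX; under eq_fun do rewrite mulrC.
  by apply: finite_momentsZ; exact: finite_moments_semicircle.
have Efp : `|Ex f - Ex (fun x => p.[x])| <= 2 * d.
  rewrite -ExB//; have fB := finite_momentsB ff (fp p).
  apply: le_trans (le_norm_Ex fB) _.
  apply: (@le_trans _ _ (Ex (fun x => d + A * h x))).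
    apply: le_Ex => //; first exact: finite_moments_norm.
    by apply: finite_momentsD; [exact: finite_moments_cst|exact: finite_momentsZ].
  rewrite ExD; [|exact: finite_moments_cst|exact: finite_momentsZ].
  rewrite (_ : Ex (fun=> d) = d); last exact: Ex_cst.
  by rewrite ExZ// mulr_natl mulr2n lerD2l.
have aux (u v w : R) : `|u - v| <= w -> u <= w -> v <= 2 * w.
  by rewrite ler_norml => /andP[h1 h2] h3; lra.
have tri (u v w z : R) : `|u - v| <= 2 * d -> `|v - w| <= d -> `|z - w| <= 3 * d ->
    `|u - z| <= e.
  by rewrite /d !ler_norml => /andP[? ?] /andP[? ?] /andP[? ?]; apply/andP; split; lra.
have d3 : 3 * d = d + 2 * d by ring.
near=> n.
have n0 : (0 < n)%N by near: n; exists 1%N.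
have hI : A * I n h <= 2 * d.
  by apply: aux AEh; near: n; move/cvgrPdist_le : Ih; apply.
have hp : `|Ex (fun x => p.[x]) - I n (fun x => p.[x])| <= d.
  by near: n; move/cvgrPdist_le : (Ip p); apply.
have hf : `|I n f - I n (fun x => p.[x])| <= 3 * d.
  rewrite /I -mulrBr -sumrB normrM ger0_norm ?invr_ge0//.
  apply: (@le_trans _ _ (n%:R^-1 * \sum_(x <- s n) (d + A * h x))).
    rewrite ler_wpM2l ?invr_ge0//; apply: le_trans (ler_norm_sum _ _ _) _.
    by apply: ler_sum.
  rewrite big_split /= big_const_seq count_predT sn iter_addr addr0 mulrDr.
  rewrite -[d *+ n]mulr_natl mulKf ?pnatr_eq0 -?lt0n//.
  rewrite -mulr_sumr mulrCA -/(I n h).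
  by rewrite d3 lerD2l.
exact: tri Efp hp hf.
Unshelve. all: by end_near. Qed.

End method_of_moments.

(** * Counting walks by the pattern of their vertex sums *)

Local Close Scope classical_set_scope.

Section patterns.
Context (W E A : finType) (val : W -> E -> A).

(* The pattern of [w] sends each edge to a representative of the set of edges
   with the same value. *)
Definition pattern w : {ffun E -> E} :=
  [ffun e => odflt e [pick e' | val w e' == val w e]].

Lemma val_pattern w e : val w (pattern w e) = val w e.
Proof. by rewrite ffunE; case: pickP => [e' /eqP|/(_ e)]; rewrite ?eqxx. Qed.

Lemma pattern_eq w e e' : (pattern w e == pattern w e') = (val w e == val w e').
Proof.
apply/eqP/eqP => [pe|ve]; first by rewrite -val_pattern pe val_pattern.
rewrite !ffunE (eq_pick (Q := fun x => val w x == val w e')); last first.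
  by move=> x /=; rewrite ve.
by case: pickP => // /(_ e'); rewrite eqxx.
Qed.

Definition reps (rho : {ffun E -> E}) : {set E} := rho @: finset.setT.

(** The number of distinct values of [w]: [reps] holds exactly one edge for each of them. *)
Definition nvals w := #|reps (pattern w)|.

Lemma nvals_sum w : (#|E| = \sum_(r in reps (pattern w)) #|[set e | pattern w e == r]|)%N.
Proof.
rewrite -sum1_card (partition_big (pattern w) (fun r => r \in reps (pattern w))) /=.
  by apply: eq_bigr => r _; rewrite -sum1_card; apply: eq_bigl => e; rewrite finset.inE.
by move=> e _; exact: imset_f.
Qed.

Definition unrepeated w e := [forall e', (e' != e) ==> (val w e' != val w e)].

Lemma fiber_ge2 w r : (forall e, ~~ unrepeated w e) -> r \in reps (pattern w) ->
  (2 <= #|[set e | pattern w e == r]|)%N.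
Proof.
move=> nu /imsetP[e _ ->].
have := nu e; rewrite negb_forall => /existsP[e'].
rewrite negb_imply negbK => /andP[ee' vee'].
have c2 : #|[set e; e']| = 2%N by rewrite cards2 eq_sym ee'.
rewrite -c2; apply: subset_leq_card; apply/fintype.subsetP => f.
rewrite !finset.inE => /orP[/eqP->|/eqP->]; first by rewrite eqxx.
by rewrite pattern_eq.
Qed.

(** Every value takes up at least two edges; the edges in excess of two per value, at least [m] in
    all, produce no further values. *)
Lemma nvals_le w m : (forall e, ~~ unrepeated w e) ->
  (\sum_(r in reps (pattern w)) (#|[set e | pattern w e == r]| - 2) >= m)%N ->
  ((nvals w).*2 + m <= #|E|)%N.
Proof.
move=> nu mP; rewrite (nvals_sum w).
apply: (@leq_trans (\sum_(r in reps (pattern w))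
    (2 + (#|[set e | pattern w e == r]| - 2)))%N).
  by rewrite big_split /= sum_nat_const -/(nvals w) muln2 leq_add2l.
by apply: leq_sum => r /(fiber_ge2 nu) h; rewrite subnKC.
Qed.

Lemma nvals_le_half w : (forall e, ~~ unrepeated w e) -> ((nvals w).*2 <= #|E|)%N.
Proof. by move=> nu; have := @nvals_le w 0 nu; rewrite addn0; apply. Qed.

Lemma nvals_lt_half w e1 e2 e3 : (forall e, ~~ unrepeated w e) ->
  uniq [:: e1; e2; e3] -> val w e2 = val w e1 -> val w e3 = val w e1 ->
  ((nvals w).*2 < #|E|)%N.
Proof.
move=> nu un v2 v3; rewrite -addn1; apply: nvals_le => //.
rewrite (bigD1 (pattern w e1)) ?imset_f ?finset.in_setT//=.
apply: leq_trans (leq_addr _ _); rewrite subn_gt0.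
have <- : #|[set e in [:: e1; e2; e3]]| = 3%N by rewrite cardsE; exact/card_uniqP.
apply: subset_leq_card; apply/fintype.subsetP => f; rewrite !inE pattern_eq.
by move=> /or3P[] /eqP-> //; apply/eqP.
Qed.

(** The counting principle behind all bounds below. The number of patterns does not depend on
    [#|A|]; within one pattern, an element is encoded by [aux] and by its values on the at most [m]
    edges that [Q] selects from the pattern. *)
Lemma card_determined (U : finType) (aux : W -> U) (S : {set W})
    (Q : {ffun E -> E} -> {set E}) m : (0 < #|A|)%N ->
  (forall w, w \in S -> (#|Q (pattern w)| <= m)%N) ->
  (forall w w', w \in S -> w' \in S -> pattern w = pattern w' -> aux w = aux w' ->
     (forall e, e \in Q (pattern w) -> val w e = val w' e) -> w = w') ->
  (#|S| <= #|{ffun E -> E}| * (#|U| * #|A| ^ m))%N.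
Proof.
move=> A0 Qm det.
rewrite -sum1_card (partition_big pattern predT)//=.
apply: (@leq_trans (\sum_(rho : {ffun E -> E}) (#|U| * #|A| ^ m))%N); last first.
  by rewrite sum_nat_const.
apply: leq_sum => rho _; rewrite sum1_card.
rewrite -[X in (X <= _)%N](cardsE _); set B := finset.finset _.
(* The bound on [Q rho] is only available if some element of [S] has the pattern [rho]. *)
have [->|/set0Pn[w0 w0B]] := eqVneq B finset.set0; first by rewrite cards0.
pose f w : U * {ffun {e | e \in Q rho} -> A} := (aux w, [ffun e => val w (sval e)]).
have finj : {in B &, injective f}.
  move=> w w'; rewrite !finset.inE => /andP[wS /eqP wr] /andP[w'S /eqP w'r] [aw /ffunP vw].
  apply: det => //; first by rewrite wr w'r.
  by move=> e; rewrite wr => eQ; have := vw (exist _ e eQ); rewrite !ffunE.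
rewrite -(card_in_imset finj); apply: leq_trans (max_card _) _.
rewrite card_prod card_ffun card_sig leq_mul2l; apply/orP; right.
move: w0B; rewrite finset.inE => /andP[w0S /eqP w0r].
by rewrite leq_pexp2l// -w0r; exact: Qm.
Qed.

End patterns.

(** * Walks and their vertex sums *)

Section walks.
Variables n k : nat.

Definition walk := {ffun 'I_k.+1 -> 'I_n}.

(** Indexing by [nat] avoids casts between ordinals when walks are cut or extended. The index is
    meaningful for [j <= k]; beyond that, [inord] falls back to the first vertex. *)
Definition vx (p : walk) (j : nat) : 'I_n := p (inord j).
Definition vsum p j : nat := (vx p j + vx p j.+1)%N.
Definition closed_walk p := vx p 0 == vx p k.
Definition edges p := [seq (vx p j, vx p j.+1) | j <- iota 0 k].

Lemma size_edges p : size (edges p) = k.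
Proof. by rewrite size_map size_iota. Qed.

Lemma vsum_subproof p j : (vsum p j < n + n)%N.
Proof. by rewrite /vsum; have := ltn_ord (vx p j); have := ltn_ord (vx p j.+1); lia. Qed.

Definition vsum_ord p (j : 'I_k) : 'I_(n + n) := Ordinal (vsum_subproof p j).

Lemma walk_forward (p q : walk) i m : (i <= m)%N -> vx p i = vx q i ->
  (forall j, (i <= j < m)%N -> vsum p j = vsum q j) -> vx p m = vx q m.
Proof.
move=> im pqi H; have : forall d, (i + d <= m)%N -> vx p (i + d) = vx q (i + d).
  elim=> [|d IH] dm; first by rewrite addn0.
  have h1 := IH (ltnW (leq_trans (leq_addr _ _) _)).
  apply/val_inj => /=; have := H (i + d)%N; rewrite /vsum -addnS.
  have -> : vx p (i + d) = vx q (i + d) by apply: IH; lia.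
  by lia.
by move=> /(_ (m - i)%N); rewrite subnKC//; exact.
Qed.

Lemma walk_backward (p q : walk) i m : (i <= m)%N -> vx p m = vx q m ->
  (forall j, (i <= j < m)%N -> vsum p j = vsum q j) -> vx p i = vx q i.
Proof.
move=> im pqm H; have : forall d, (d <= m - i)%N -> vx p (m - d) = vx q (m - d).
  elim=> [|d IH] dm; first by rewrite subn0.
  apply/val_inj => /=; have := H (m - d.+1)%N; rewrite /vsum.
  have -> : (m - d.+1).+1 = (m - d)%N by lia.
  rewrite IH; last by lia.
  by lia.
by move=> /(_ (m - i)%N (leqnn _)); rewrite subKn.
Qed.

Lemma walk_eqP (p q : walk) i : (i <= k)%N -> vx p i = vx q i ->
  (forall j, (j < k)%N -> vsum p j = vsum q j) -> p = q.
Proof.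
move=> ik pqi H; apply/ffunP => j; rewrite -[j]inord_val -/(vx p j) -/(vx q j).
have [ij|/ltnW ji] := leqP i j.
  by apply: (walk_forward ij pqi) => l jl; apply: H; have := ltn_ord j; lia.
by apply: (walk_backward ji pqi) => l jl; apply: H; lia.
Qed.

End walks.

Section walk_counting.
Variables (n k : nat).
Local Notation E := 'I_k.
Local Notation W := (walk n k).
Local Notation pat := (pattern (@vsum_ord n k)).

Lemma vsum_ordE (p q : W) (j j' : 'I_k) : (vsum_ord p j == vsum_ord q j') = (vsum p j == vsum q j').
Proof. by []. Qed.

Lemma pattern_agree (p q : W) (e : 'I_k) : pat p = pat q ->
  vsum p (pat p e) = vsum q (pat p e) -> vsum p e = vsum q e.
Proof.
move=> pq h; have := congr1 val (val_pattern (@vsum_ord n k) p e).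
have := congr1 val (val_pattern (@vsum_ord n k) q e).
by rewrite /= -pq => <- <-.
Qed.

Lemma card_walks_nvals m : (0 < n)%N ->
  (#|[set p : W | (nvals (@vsum_ord n k) p <= m)%N]|
   <= #|{ffun 'I_k -> 'I_k}| * (n * (n + n) ^ m))%N.
Proof.
move=> n0; have := @card_determined W E _ (@vsum_ord n k) _ (fun p : W => vx p 0)
  [set p : W | (nvals (@vsum_ord n k) p <= m)%N] (@reps E) m.
rewrite !card_ord; apply; first by rewrite addn_gt0 n0.
  by move=> p; rewrite finset.inE.
move=> p q _ _ pq pq0 H; apply: (@walk_eqP n k p q 0) => // j jk.
apply: (pattern_agree (e := Ordinal jk) pq).
by have /(congr1 val) := H _ (imset_f (pat p) (finset.in_setT (Ordinal jk))).
Qed.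

(* Given [vx p i] and all vertex sums other than the one at [j], the walk is
   determined up to [vx p j]; fixing the distance from there to [vx p j.+1]
   leaves two possibilities. *)
Lemma card_walks_jump m i j o tau : (0 < n)%N -> (i + o <= j < k)%N ->
  (#|[set p : W | [&& (nvals (@vsum_ord n k) p <= m.+1)%N,
       [forall l : 'I_k, (i <= l < j)%N ==> (vsum p l != vsum p j)] &
       `|(vx p (i + o))%:Z - (vx p j.+1)%:Z|%N == tau]]|
   <= #|{ffun 'I_k -> 'I_k}| * (n * 2 * (n + n) ^ m))%N.
Proof.
move=> n0 /andP[ij jk]; set S := finset.finset _.
pose ej := Ordinal jk.
(* The auxiliary data are the vertex at [i], from which the walk is rebuilt in both directions, and
   the order of the two vertices at distance [tau]. Dropping the class of [j] from the recorded sums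
   lowers [m.+1] to [m]. *)
have := @card_determined W E _ (@vsum_ord n k) _
  (fun p : W => (vx p i, (vx p (i + o) <= vx p j.+1)%N)) S
  (fun rho => reps rho :\ rho ej) m.
rewrite card_prod card_bool !card_ord; apply; first by rewrite addn_gt0 n0.
  move=> p; rewrite finset.inE => /and3P[pm _ _].
  have := cardsD1 (pat p ej) (reps (pat p)); rewrite imset_f ?finset.in_setT//=.
  by move=> h; move: pm; rewrite /nvals h add1n ltnS.
move=> p q; rewrite !finset.inE => /and3P[_ /forallP pij /eqP pt] /and3P[_ _ /eqP qt].
move=> pq [pqi pqo] H.
have agree (e : E) : vsum p e != vsum p j -> vsum p e = vsum q e.
  move=> ej'; apply: (pattern_agree pq).
  apply: (congr1 (@nat_of_ord _) (H (pat p e) _)).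
  rewrite finset.in_setD1 imset_f ?finset.in_setT// andbT.
  by rewrite pattern_eq vsum_ordE.
have fwd l : (i <= l <= j)%N -> vx p l = vx q l.
  move=> /andP[il lj]; apply: (walk_forward il pqi) => l' l'l.
  have l'k : (l' < k)%N by lia.
  apply: (agree (Ordinal l'k)).
  by have /implyP := pij (Ordinal l'k); apply => /=; lia.
have pqj : vx p j = vx q j by apply: fwd; lia.
have pqio : vx p (i + o) = vx q (i + o) by apply: fwd; lia.
have pqj1 : vx p j.+1 = vx q j.+1.
  apply/val_inj => /=; move: pt qt pqo; rewrite pqio => pt qt.
  by case: leqP; case: leqP => //; lia.
have pqsj : vsum p j = vsum q j by rewrite /vsum pqj pqj1.
apply: (@walk_eqP n k p q i) => // [|l lk]; first by lia.
(* The sum at [j] has been recovered from its two vertices, and the pattern carries it over to every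
   other edge of its class. *)
have [lj|lj] := eqVneq (vsum p l) (vsum p j); last exact: (agree (Ordinal lk)).
apply: (pattern_agree (e := Ordinal lk) pq).
have -> : pat p (Ordinal lk) = pat p ej by apply/eqP; rewrite pattern_eq vsum_ordE lj.
have := congr1 val (val_pattern (@vsum_ord n k) p ej).
have := congr1 val (val_pattern (@vsum_ord n k) q ej).
by rewrite -pq /= => -> ->.
Qed.

End walk_counting.

(** * Moments along closed walks *)

Section walk_moments.
Variables (R : realType) (n : nat).
(** The size [n] is fixed and [mu] stands for [mixed_moment]; the hypotheses keep what the
    combinatorics needs, so that no probability enters this section. *)
Variable mu : seq ('I_n * 'I_n) -> R.
Variable K : nat -> R.
Variable c : nat -> R.
Hypothesis n_gt0 : (0 < n)%N.
Hypothesis mu_perm : forall s t, perm_eq s t -> mu s = mu t.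
Hypothesis mu_bound : forall s, `|mu s| <= K (size s).
Hypothesis mu_cat : forall s t : seq ('I_n * 'I_n),
  (forall e f, e \in s -> f \in t -> (e.1 + e.2 != f.1 + f.2 :> nat)%N) ->
  mu (s ++ t) = mu s * mu t.
Hypothesis mu1 : forall e, mu [:: e] = 0.
Hypothesis mu_sqr : forall x y, mu [:: (x, y); (y, x)] = 1.
Hypothesis c_ge0 : forall tau, 0 <= c tau.
Hypothesis mu_cov : forall x y x' y' : 'I_n, (x + y = x' + y')%N ->
  `|mu [:: (x, y); (x', y')]| <= c `|x%:Z - x'%:Z|%N + c `|y%:Z - x'%:Z|%N.

Lemma K_ge0 k : 0 <= K k.
Proof.
apply: le_trans (normr_ge0 (mu (nseq k (Ordinal n_gt0, Ordinal n_gt0)))) _.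
by apply: le_trans (mu_bound _) _; rewrite size_nseq.
Qed.

Lemma mu_split k (p : walk n k) (J : pred nat) :
  (forall i j, (i < k)%N -> (j < k)%N -> J i -> ~~ J j -> vsum p i != vsum p j) ->
  mu (edges p) = mu [seq (vx p j, vx p j.+1) | j <- iota 0 k & J j] *
                 mu [seq (vx p j, vx p j.+1) | j <- iota 0 k & ~~ J j].
Proof.
move=> H; rewrite -mu_cat.
  apply: mu_perm; rewrite -map_cat perm_sym; apply: perm_map.
  by apply/permPl; exact: perm_filterC.
move=> e f /mapP[i + ->] /mapP[j + ->]; rewrite !mem_filter !mem_iota /=.
by move=> /andP[Ji ik] /andP[Jj jk]; exact: H.
Qed.

Lemma mu_unrepeated k (p : walk n k) (e : 'I_k) :
  unrepeated (@vsum_ord n k) p e -> mu (edges p) = 0.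
Proof.
move=> /forallP eu; rewrite (@mu_split _ _ (pred1 (e : nat))) => [|i j ik jk /eqP-> /= je].
  by rewrite filter_pred1_uniq ?iota_uniq ?mem_iota//= mu1 mul0r.
rewrite eq_sym; apply: (implyP (eu (Ordinal jk))).
by apply: contra je => /eqP/(congr1 val)/= ->.
Qed.

(** If all sums are repeated and there are at least [k / 2] distinct ones, each occurs exactly
    twice, so a third edge cannot share the sum of [i] and [j]. *)
Lemma vsum_neq k (p : walk n k) (i j l : 'I_k) :
  ~~ ((nvals (@vsum_ord n k) p).*2 < k)%N ->
  (forall e, ~~ unrepeated (@vsum_ord n k) p e) ->
  i != j -> l != i -> l != j -> vsum p i = vsum p j -> vsum p i != vsum p l.
Proof.
move=> nk nu ij li lj vij; apply: contra nk => /eqP vil.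
have := @nvals_lt_half _ _ _ (@vsum_ord n k) p i j l nu.
rewrite card_ord; apply; last 2 first.
- by apply/eqP; rewrite vsum_ordE vij.
- by apply/eqP; rewrite vsum_ordE vil.
by rewrite /= !inE negb_or ij (eq_sym i l) li (eq_sym j l) lj.
Qed.

(** The first [h] steps form [h.-1] adjacent pairs; in particular [h = 0] and [h = 1] give the same,
    empty condition. *)
Definition backtrack_free k h (p : walk n k) :=
  all (fun j => vsum p j != vsum p j.+1) (iota 0 h.-1).

(** The condition counted by [card_walks_jump]. It is used with [j.-1] in place of [j], so that
    [tau] is the distance from [p_(i + o)] to [p_j]; the offset [o], 0 or 1, selects one of the two
    terms of [mu_cov]. *)
Definition jump k i j o tau (p : walk n k) :=
  [&& ((nvals (@vsum_ord n k) p).*2 <= k)%N,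
      [forall l : 'I_k, (i <= l < j)%N ==> (vsum p l != vsum p j)] &
      `|(vx p (i + o))%:Z - (vx p j.+1)%:Z|%N == tau].

(* A walk without a value of multiplicity one or three has its values paired;
   the first repetition [vsum p i = vsum p j] then bounds [mu] by a covariance. *)
Lemma mu_backtrack_free k (p : walk n k) : (0 < k)%N -> backtrack_free k p ->
  `|mu (edges p)| <= ((nvals (@vsum_ord n k) p).*2 < k)%N%:R * K k +
    (~~ odd k)%:R * \sum_(i < k) \sum_(j < k | (i < j)%N) \sum_(o < 2 | (i + o < j)%N)
      \sum_(tau < n) (jump i j.-1 o tau p)%:R * (c tau * K (k - 2)).
Proof.
move=> k0 /allP nb; set A := _%:R * K k; set B := _ * _.
have A0 : 0 <= A by rewrite mulr_ge0 ?K_ge0.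
have term0 i j o (tau : nat) : 0 <= (jump i j o tau p)%:R * (c tau * K (k - 2)).
  by rewrite !mulr_ge0 ?K_ge0.
have B0 : 0 <= B.
  by rewrite mulr_ge0//; do 4! (apply: sumr_ge0 => ? _); exact: term0.
have [[e eu]|nu] := pselect (exists e, unrepeated (@vsum_ord n k) p e).
  by rewrite (mu_unrepeated eu) normr0 addr_ge0.
have {}nu e : ~~ unrepeated (@vsum_ord n k) p e by apply/negP => eu; apply: nu; exists e.
have [nk|nk] := boolP ((nvals (@vsum_ord n k) p).*2 < k)%N.
  rewrite -[leLHS]addr0 lerD// /A nk mul1r.
  by apply: le_trans (mu_bound _) _; rewrite size_edges.
have nkE : ((nvals (@vsum_ord n k) p).*2 = k)%N.
  by have := nvals_le_half nu; rewrite card_ord; lia.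
have ek : ~~ odd k by rewrite -nkE odd_double.
rewrite -[leLHS]add0r lerD// /B ek mul1r.
(* Taking the least index [j] whose sum has occurred before makes the sums before [j] pairwise
   distinct, as [jump] demands. *)
pose rep (j : nat) := (j < k)%N && has (fun i => vsum p i == vsum p j) (iota 0 j).
have [j0 rj0] : exists j, rep j.
  pose e0 := Ordinal k0; have := nu e0; rewrite negb_forall => /existsP[e1].
  rewrite negb_imply negbK vsum_ordE => /andP[e10 /eqP v10]; exists e1.
  rewrite /rep ltn_ord/=; apply/hasP; exists 0%N; last by rewrite v10.
  by rewrite mem_iota /= add0n lt0n; apply: contra e10 => /eqP e1E; apply/eqP/val_inj.
have [j /andP[jk /hasP[i + /eqP vij]] jmin] := ex_minnP (ex_intro _ j0 rj0).
rewrite mem_iota /= add0n => ij.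
have dist l l' : (l < l')%N -> (l' < j)%N -> vsum p l != vsum p l'.
  move=> ll' l'j; apply/negP => /eqP vll'; have := jmin l'; rewrite /rep.
  rewrite (ltn_trans l'j jk) /=; have -> : has (fun i => vsum p i == vsum p l') (iota 0 l').
    by apply/hasP; exists l; rewrite ?mem_iota//= vll'.
  by move=> /(_ isT); rewrite leqNgt l'j.
(* Without backtracks the two equal sums are not adjacent; hence [i + o <= j.-1] for both offsets,
   as the count requires. *)
have i1j : (i.+1 < j)%N.
  rewrite ltn_neqAle ij andbT; apply/negP => /eqP ijE.
  have := nb i; rewrite mem_iota /= add0n => /(_ _)/eqP; rewrite ijE vij.
  by move=> h; apply: h => //; lia.
have ik : (i < k)%N by exact: ltn_trans jk.
pose ei := Ordinal ik; pose ej := Ordinal jk.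
have eij : ei != ej by apply/negP => /eqP/(congr1 val)/= ijE; move: ij; rewrite ijE ltnn.
pose tau o := `|(vx p (i + o))%:Z - (vx p j)%:Z|%N.
have tauP o : (tau o < n)%N.
  by rewrite /tau; have := ltn_ord (vx p (i + o)); have := ltn_ord (vx p j); lia.
have jP o : jump i j.-1 o (tau o) p.
  rewrite /jump /tau (ltn_predK ij) eqxx andbT nkE leqnn /=.
  apply/forallP => l; apply/implyP => /andP[il lj]; apply: dist => //.
  by rewrite (ltn_predK ij).
(* All terms of the fourfold sum are nonnegative; those at the actual [i], [j] and distances [tau o]
   are kept. *)
have single : \sum_(o < 2) c (tau o) * K (k - 2) <=
    \sum_(i < k) \sum_(j < k | (i < j)%N) \sum_(o < 2 | (i + o < j)%N)
      \sum_(tau < n) (jump i j.-1 o tau p)%:R * (c tau * K (k - 2)).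
  rewrite (bigD1 ei)//= -[leLHS]addr0 lerD//; last first.
    by do 4! (apply: sumr_ge0 => ? _); exact: term0.
  rewrite (bigD1 ej)//= -[leLHS]addr0 lerD//; last first.
    by do 3! (apply: sumr_ge0 => ? _); exact: term0.
  rewrite [leRHS](eq_bigl predT) => [|o]; last first.
    by rewrite /= -ltn_subRL; apply: leq_trans (ltn_ord o) _; lia.
  apply: ler_sum => o _; rewrite (bigD1 (Ordinal (tauP o)))//= jP mul1r.
  by rewrite lerDl; apply: sumr_ge0 => ? _; exact: term0.
apply: le_trans single; rewrite big_ord_recl big_ord1 -mulrDl.
rewrite (@mu_split _ _ (pred2 i j)) => [|a b ak bk ab /= ]; last first.
  rewrite negb_or => /andP[bi bj].
  have vb := vsum_neq nk nu eij _ _ vij (l := Ordinal bk).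
  have {}vb : vsum p i != vsum p b by apply: vb; [exact: bi|exact: bj].
  by case/orP: ab => /eqP-> //; rewrite -vij.
rewrite normrM; apply: ler_pM => //.
  have -> : mu [seq (vx p l, vx p l.+1) | l <- iota 0 k & pred2 i j l] =
      mu [:: (vx p i, vx p i.+1); (vx p j, vx p j.+1)].
    apply: mu_perm; rewrite -[X in perm_eq _ X]/(map (fun l => (vx p l, vx p l.+1)) [:: i; j]).
    apply: perm_map; apply: uniq_perm; first by rewrite filter_uniq ?iota_uniq.
      by rewrite /= inE neq_ltn ij.
    move=> l; rewrite mem_filter mem_iota /= !inE add0n andbC.
    by case: eqVneq => [->|_]; [rewrite ik|case: eqVneq => [->|_]; rewrite ?jk ?andbF].
  apply: le_trans (mu_cov _) _; first exact: vij.
  by rewrite /tau addn0 addn1.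
apply: le_trans (mu_bound _) _; rewrite size_map size_filter.
have := count_predC (pred2 i j) (iota 0 k); rewrite size_iota.
have -> : count (pred2 i j) (iota 0 k) = 2%N.
  rewrite -(@eq_count _ (predU (pred1 i) (pred1 j))) ?count_predUI; last by [].
  have := count_predUI (pred1 i) (pred1 j) (iota 0 k).
  rewrite !count_uniq_mem ?iota_uniq// !mem_iota /= !add0n ik jk /=.
  rewrite (_ : count (predI _ _) _ = 0%N) ?addn0//.
  apply/eqP; rewrite -leqn0 leqNgt -has_count; apply/hasPn => l _ /=.
  by apply/negP => /andP[/eqP-> /eqP E]; move: ij; rewrite E ltnn.
by move=> /(canRL (addKn _)) <-.
Qed.

Let patterns k : R := #|{ffun 'I_k -> 'I_k}|%:R.

Lemma double_exp_le k m : (m <= k)%N -> ((n + n) ^ m <= 2 ^ k * n ^ m)%N.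
Proof.
by move=> mk; rewrite addnn -mul2n expnMn leq_mul2r leq_exp2l// mk orbT.
Qed.

Lemma card_nvals k m : (m <= k)%N ->
  #|[set p : walk n k | (nvals (@vsum_ord n k) p <= m)%N]|%:R <=
  patterns k * 2 ^+ k * (n * n ^ m)%:R :> R.
Proof.
move=> mk; rewrite -natrX -!natrM ler_nat.
apply: leq_trans (card_walks_nvals _ _ n_gt0) _.
rewrite -[leqRHS]mulnA leq_mul2l; apply/orP; right.
by rewrite [leqRHS]mulnCA leq_mul2l double_exp_le ?orbT.
Qed.

Lemma card_jump k i j o tau : (1 < k)%N -> (i + o <= j < k)%N ->
  #|[set p : walk n k | jump i j o tau p]|%:R <=
  patterns k * 2 ^+ k.+1 * (n * n ^ k./2.-1)%:R :> R.
Proof.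
move=> k1 ij; rewrite -natrX -!natrM ler_nat.
have := @card_walks_jump n k k./2.-1 i j o tau n_gt0 ij.
have -> : k./2.-1.+1 = k./2 by rewrite prednK// half_gt0.
rewrite (_ : finset.finset _ = [set p : walk n k | jump i j o tau p]); last first.
  by apply/finset.setP => p; rewrite !finset.inE /jump geq_half_double.
move=> /leq_trans; apply.
rewrite -[leqRHS]mulnA leq_mul2l; apply/orP; right.
have h : (k./2.-1 <= k)%N by lia.
apply: leq_trans (leq_mul (leqnn (n * 2)) (double_exp_le h)) _.
by rewrite expnS leq_eqVlt; apply/orP; left; apply/eqP; ring.
Qed.

(** The first term bounds the walks with fewer than [k / 2] distinct sums. In the second,
    [k * k * 2] counts the triples [(i, j, o)], and each distance [tau] contributes [c tau] times a
    bound on the number of jumps; pairing needs [k] even. *)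
Lemma sum_backtrack_free k : (0 < k)%N ->
  `|\sum_(p : walk n k | closed_walk p && backtrack_free k p) mu (edges p)| <=
  patterns k * 2 ^+ k * K k * (n * n ^ k.-1./2)%:R +
  (~~ odd k)%:R * (k%:R * k%:R * 2 * K (k - 2) * patterns k * 2 ^+ k.+1 *
     (n * n ^ k./2.-1)%:R * \sum_(tau < n) c tau).
Proof.
move=> k0; apply: le_trans (ler_norm_sum _ _ _) _.
pose A (p : walk n k) := ((nvals (@vsum_ord n k) p).*2 < k)%N%:R * K k.
pose B (p : walk n k) := \sum_(i < k) \sum_(j < k | (i < j)%N) \sum_(o < 2 | (i + o < j)%N)
      \sum_(tau < n) (jump i j.-1 o tau p)%:R * (c tau * K (k - 2)).
have A0 p : 0 <= A p by rewrite mulr_ge0 ?K_ge0.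
have B0 p : 0 <= B p.
  by do 4! (apply: sumr_ge0 => ? _); rewrite !mulr_ge0 ?K_ge0.
apply: (@le_trans _ _ (\sum_(p : walk n k) (A p + (~~ odd k)%:R * B p))).
  rewrite big_mkcond; apply: ler_sum => p _; case: ifP => [/andP[_ bp]|_].
    exact: mu_backtrack_free.
  by rewrite addr_ge0// mulr_ge0.
rewrite big_split /= lerD//.
  rewrite -mulr_suml -natr_sum [leRHS]mulrAC ler_wpM2r ?K_ge0//.
  have -> : (\sum_(p : walk n k) ((nvals (@vsum_ord n k) p).*2 < k)%N)%N =
      #|[set p : walk n k | (nvals (@vsum_ord n k) p <= k.-1./2)%N]|.
    rewrite -sum1dep_card [RHS]big_mkcond /=; apply: eq_bigr => p _.
    by rewrite geq_half_double -[in RHS]ltnS prednK//; case: ltnP.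
  by apply: card_nvals; lia.
rewrite -mulr_sumr; have [ok|ek] := boolP (odd k); first by rewrite !mul0r.
rewrite !mul1r; have k1 : (1 < k)%N by case: k k0 ek {A B A0 B0} => [|[]].
pose D := patterns k * 2 ^+ k.+1 * (n * n ^ k./2.-1)%:R : R.
have step (i j o tau : nat) : (i + o < j)%N -> (j < k)%N ->
    \sum_(p : walk n k) (jump i j.-1 o tau p)%:R * (c tau * K (k - 2)) <=
    D * (c tau * K (k - 2)).
  move=> ioj jk; rewrite -mulr_suml ler_wpM2r ?mulr_ge0 ?K_ge0//.
  have := @card_jump k i j.-1 o tau k1; rewrite -sum1dep_card natr_sum.
  rewrite big_mkcond /=; move=> h; apply: le_trans (h _); last by lia.
  by apply: ler_sum => p _; case: ifP.
have -> : \sum_(p : walk n k) B p =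
    \sum_(i < k) \sum_(j < k | (i < j)%N) \sum_(o < 2 | (i + o < j)%N) \sum_(tau < n)
      \sum_(p : walk n k) (jump i j.-1 o tau p)%:R * (c tau * K (k - 2)).
  rewrite /B exchange_big; apply: eq_bigr => i _.
  rewrite exchange_big; apply: eq_bigr => j _.
  rewrite exchange_big; apply: eq_bigr => o _.
  by rewrite exchange_big.
set C := \sum_(tau < n) c tau.
have C0 : 0 <= C by apply: sumr_ge0.
have D0 : 0 <= D by rewrite !mulr_ge0 ?exprn_ge0.
pose F := D * (C * K (k - 2)).
have F0 : 0 <= F by rewrite !mulr_ge0 ?K_ge0.
apply: (@le_trans _ _ (\sum_(i < k) \sum_(j < k) \sum_(o < 2) F)).
  apply: ler_sum => i _; rewrite big_mkcond; apply: ler_sum => j _.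
  have FF : 0 <= \sum_(o < 2) F by apply: sumr_ge0.
  case: ifP => // ij; rewrite big_mkcond; apply: ler_sum => o _.
  case: ifP => // ioj.
  apply: (@le_trans _ _ (\sum_(tau < n) D * (c tau * K (k - 2)))).
    by apply: ler_sum => tau _; apply: step.
  by rewrite /F /C mulr_suml mulr_sumr.
rewrite !sumr_const !card_ord /F -!mulrnA -mulr_natl !natrM.
rewrite le_eqVlt; apply/orP; left; apply/eqP; rewrite /D; ring.
Qed.

(** The detour [p_h, y, p_h] takes the place of the vertex [p_h], and the later vertices move by
    two. *)
Definition insert_backtrack k h (p : walk n k) (y : 'I_n) : walk n k.+2 :=
  [ffun i : 'I_k.+3 => if (i <= h)%N then vx p i
                       else if (i == h.+1 :> nat) then y else vx p (i - 2)].

Definition remove_backtrack k h (p : walk n k.+2) : walk n k :=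
  [ffun i : 'I_k.+1 => if (i <= h)%N then vx p i else vx p i.+2].

Lemma vx_insert k h (p : walk n k) (y : 'I_n) j : (j <= k.+2)%N ->
  vx (insert_backtrack h p y) j = if (j <= h)%N then vx p j
    else if (j == h.+1)%N then y else vx p (j - 2).
Proof. by move=> jk; rewrite /vx ffunE inordK. Qed.

Lemma vx_remove k h (p : walk n k.+2) j : (j <= k)%N ->
  vx (remove_backtrack h p) j = if (j <= h)%N then vx p j else vx p j.+2.
Proof. by move=> jk; rewrite /vx ffunE inordK. Qed.

Lemma walk_ext k (p q : walk n k) : (forall j, (j <= k)%N -> vx p j = vx q j) -> p = q.
Proof.
by move=> H; apply/ffunP => j; rewrite -[j]inord_val; apply: H; rewrite -ltnS.
Qed.

Lemma insert_remove k h (p : walk n k.+2) : (h <= k)%N -> vx p h = vx p h.+2 ->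
  insert_backtrack h (remove_backtrack h p) (vx p h.+1) = p.
Proof.
move=> hk ph; apply: walk_ext => j jk; rewrite vx_insert//.
case: leqP => [jh|hj]; first by rewrite vx_remove ?jh//; lia.
case: eqVneq => [->//|jh1]; rewrite vx_remove; last by lia.
case: leqP => [jh|hj2].
  have jE : j = h.+2 by lia.
  by rewrite jE !subSS subn0.
by congr (vx p _); lia.
Qed.

Lemma remove_insert k h (p : walk n k) (y : 'I_n) : (h <= k)%N ->
  remove_backtrack h (insert_backtrack h p y) = p.
Proof.
move=> hk; apply: walk_ext => j jk; rewrite vx_remove//.
case: leqP => jh; rewrite vx_insert; try lia; first by rewrite jh.
rewrite ifF; last by lia.
by rewrite ifF; [congr (vx p _); lia|lia].
Qed.

Lemma insert_closed k h (p : walk n k) (y : 'I_n) : (h <= k)%N ->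
  closed_walk (insert_backtrack h p y) = closed_walk p.
Proof.
move=> hk; rewrite /closed_walk !vx_insert//=.
have -> : (k.+2 <= h)%N = false by lia.
by rewrite !subSS subn0 ifF//; lia.
Qed.

Lemma vsum_insert k h (p : walk n k) (y : 'I_n) : (h <= k)%N ->
  [/\ forall j, (j < h)%N -> vsum (insert_backtrack h p y) j = vsum p j,
      vsum (insert_backtrack h p y) h = (vx p h + y)%N,
      vsum (insert_backtrack h p y) h.+1 = (vx p h + y)%N &
      forall j, (h <= j < k)%N -> vsum (insert_backtrack h p y) j.+2 = vsum p j].
Proof.
move=> hk; split=> [j jh|||j jk]; rewrite /vsum !vx_insert; try lia.
- by rewrite (ltnW jh) jh.
- by rewrite leqnn ltnn eqxx.
- rewrite ltnn eqxx !subSS subn0 ifF; last by lia.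
  by rewrite ifF; [rewrite addnC|lia].
- rewrite !subSS !subn0 ifF; last by lia.
  rewrite ifF; last by lia.
  rewrite ifF; last by lia.
  by rewrite ifF//; lia.
Qed.

Lemma edges_insert k h (p : walk n k) (y : 'I_n) : (h <= k)%N ->
  perm_eq (edges (insert_backtrack h p y)) ([:: (vx p h, y); (y, vx p h)] ++ edges p).
Proof.
move=> hk; set q := insert_backtrack h p y.
have -> : edges q = take h (edges p) ++ [:: (vx p h, y); (y, vx p h)] ++ drop h (edges p).
  rewrite /edges -map_take -map_drop take_iota drop_iota add0n (minn_idPl hk).
  have -> : iota 0 k.+2 = iota 0 h ++ [:: h; h.+1] ++ iota h.+2 (k - h).
    have -> : k.+2 = (h + (2 + (k - h)))%N by lia.
    by rewrite iotaD add0n iotaD /= addn2.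
  rewrite !map_cat; congr (_ ++ (_ ++ _)).
  - apply/eq_in_map => j; rewrite mem_iota => /andP[_ jh].
    by rewrite !vx_insert; try lia; rewrite (ltnW jh) jh.
  - rewrite /= /q !vx_insert; try lia.
    rewrite leqnn ltnn eqxx !subSS subn0 ifF; last by lia.
    by rewrite ifF//; lia.
  - rewrite -[h.+2]add2n iotaDl -map_comp; apply/eq_in_map => j.
    rewrite mem_iota subnKC// => jk; rewrite /= /q !vx_insert; try lia.
    rewrite !add2n ifF; last by lia.
    rewrite ifF; last by lia.
    rewrite ifF; last by lia.
    rewrite ifF; last by lia.
    by congr (vx p _, vx p _); lia.
by rewrite perm_catCA cat_take_drop.
Qed.

(** Passing from [h.+1] to [h.+2] excludes the walks whose sums at [h] and [h.+1] agree. Cutting out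
    their detour identifies them with pairs of a shorter closed walk and a middle vertex [y]. *)
Lemma sum_remove_backtrack k h : (h <= k)%N ->
  \sum_(p : walk n k.+2 | closed_walk p && backtrack_free h.+1 p) mu (edges p) =
  \sum_(p : walk n k.+2 | closed_walk p && backtrack_free h.+2 p) mu (edges p) +
  \sum_(p : walk n k | closed_walk p) \sum_(y < n)
    (backtrack_free h.+1 (insert_backtrack h p y))%:R *
    mu (edges (insert_backtrack h p y)).
Proof.
move=> hk.
have bS (p : walk n k.+2) :
    backtrack_free h.+2 p = backtrack_free h.+1 p && (vsum p h != vsum p h.+1).
  by rewrite /backtrack_free -[h.+2.-1]addn1 iotaD all_cat /= andbT.
rewrite [LHS](bigID (fun p => vsum p h != vsum p h.+1)) /=; congr (_ + _).
  by apply: eq_bigl => p; rewrite bS andbA.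
rewrite pair_big_dep /= (reindex_onto (fun py : walk n k * 'I_n => insert_backtrack h py.1 py.2)
  (fun p => (remove_backtrack h p, vx p h.+1))) /=; last first.
  move=> p /andP[_]; rewrite negbK /vsum addnC eqn_add2l => /eqP/val_inj.
  exact: insert_remove.
rewrite [LHS]big_mkcond [RHS]big_mkcond; apply: eq_bigr => -[p y] _ /=.
have [_ v1 v2 _] := vsum_insert p y hk.
rewrite v1 v2 eqxx andbT insert_closed// remove_insert// vx_insert; last by lia.
rewrite ltnn !eqxx andbT.
case: (closed_walk p) => //=; case: (backtrack_free _ _) => /=.
  by rewrite mul1r.
by rewrite mul0r.
Qed.

(** When [p_h + y] is a new sum, the two inserted steps are independent of the others and contribute
    the second moment 1; newness also settles the only additional backtrack condition, the one
    between the sums at [h.-1] and [h]. *)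
Lemma good_insert k h (p : walk n k) (y : 'I_n) : (h <= k)%N ->
  (forall j, (j < k)%N -> vsum p j != (vx p h + y)%N) ->
  backtrack_free h.+1 (insert_backtrack h p y) = backtrack_free h p /\
  mu (edges (insert_backtrack h p y)) = mu (edges p).
Proof.
move=> hk good; have [v0 v1 v2 v3] := vsum_insert p y hk; split.
  case: h hk v0 v1 v2 v3 good => [//|h] hk v0 v1 v2 v3 good.
  have iE : iota 0 h.+1 = iota 0 h ++ [:: h] by rewrite -addn1 iotaD.
  rewrite /backtrack_free -!pred_Sn iE all_cat [all _ [:: h]]/=.
  rewrite (v0 h (ltnSn h)) v1 (good h) ?andbT//.
  apply: eq_in_all => j; rewrite mem_iota => /andP[_ jh].
  by rewrite !v0//; lia.
rewrite (mu_perm (edges_insert p y hk)) mu_cat ?mu_sqr ?mul1r// => e f.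
rewrite !inE => eE /mapP[j + ->] /=; rewrite mem_iota /= => jk.
rewrite -/(vsum p j) eq_sym; case/orP: eE => /eqP-> /=; first exact: good.
by rewrite addnC; exact: good.
Qed.

(** The sum [p_h + y] now occurs at least three times, which pushes the number of distinct sums
    strictly below half the length. *)
Lemma bad_insert k h (p : walk n k) (y : 'I_n) j : (h <= k)%N -> (j < k)%N ->
  vsum p j = (vx p h + y)%N ->
  `|mu (edges (insert_backtrack h p y))| <=
    (nvals (@vsum_ord n k.+2) (insert_backtrack h p y) <= k.+1./2)%N%:R * K k.+2.
Proof.
move=> hk jk bad; set q := insert_backtrack h p y.
have [[e eu]|nu] := pselect (exists e, unrepeated (@vsum_ord n k.+2) q e).
  by rewrite (mu_unrepeated eu) normr0 mulr_ge0 ?K_ge0.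
have {}nu e : ~~ unrepeated (@vsum_ord n k.+2) q e by apply/negP => eu; apply: nu; exists e.
have [v0 v1 v2 v3] := vsum_insert p y hk.
pose j' := if (j < h)%N then j else j.+2.
have j'k : (j' < k.+2)%N by rewrite /j'; case: ifP; lia.
have h1k : (h.+1 < k.+2)%N by lia.
have h0k : (h < k.+2)%N by lia.
have vj' : vsum q j' = (vx p h + y)%N.
  by rewrite /j'; case: ltnP => jh; [rewrite v0|rewrite v3 ?jh].
have -> : (nvals (@vsum_ord n k.+2) q <= k.+1./2)%N.
  rewrite geq_half_double -ltnS.
  have := @nvals_lt_half _ _ _ (@vsum_ord n k.+2) q (Ordinal h0k) (Ordinal h1k) (Ordinal j'k) nu.
  rewrite card_ord; apply.
  - by rewrite /= !inE negb_or /j' -!val_eqE /=; case: ifP; lia.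
  - by apply/eqP; rewrite vsum_ordE /= v1 v2.
  - by apply/eqP; rewrite vsum_ordE /= v1 vj'.
by rewrite mul1r; apply: le_trans (mu_bound _) _; rewrite size_edges.
Qed.

Lemma mu_nvals k (p : walk n k) :
  `|mu (edges p)| <= (nvals (@vsum_ord n k) p <= k./2)%N%:R * K k.
Proof.
have [[e eu]|nu] := pselect (exists e, unrepeated (@vsum_ord n k) p e).
  by rewrite (mu_unrepeated eu) normr0 mulr_ge0 ?K_ge0.
have {}nu e : ~~ unrepeated (@vsum_ord n k) p e by apply/negP => eu; apply: nu; exists e.
have := nvals_le_half nu; rewrite card_ord geq_half_double => ->.
by rewrite mul1r; apply: le_trans (mu_bound _) _; rewrite size_edges.
Qed.

(** Good middle vertices cancel against the term with factor [n]. For the bad ones, the first error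
    counts the extended walks, on which insertion is injective; the second counts the short walks
    with at most [k] bad [y] each, since every sum of [p] determines one such [y]. *)
Lemma sum_backtrack_recurrence k h : (h <= k)%N ->
  `|\sum_(p : walk n k.+2 | closed_walk p && backtrack_free h.+1 p) mu (edges p) -
    \sum_(p : walk n k.+2 | closed_walk p && backtrack_free h.+2 p) mu (edges p) -
    n%:R * \sum_(p : walk n k | closed_walk p && backtrack_free h p) mu (edges p)| <=
  patterns k.+2 * 2 ^+ k.+2 * K k.+2 * (n * n ^ k.+1./2)%:R +
  k%:R * patterns k * 2 ^+ k * K k * (n * n ^ k./2)%:R.
Proof.
move=> hk; rewrite sum_remove_backtrack// [X in X - n%:R * _]addrAC subrr add0r.
pose bad (p : walk n k) (y : 'I_n) := [exists j : 'I_k, vsum p j == (vx p h + y)%N].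
pose A (p : walk n k) (y : 'I_n) := bad p y &&
   (nvals (@vsum_ord n k.+2) (insert_backtrack h p y) <= k.+1./2)%N.
pose B (p : walk n k) (y : 'I_n) := bad p y && (nvals (@vsum_ord n k) p <= k./2)%N.
have -> : n%:R * \sum_(p : walk n k | closed_walk p && backtrack_free h p) mu (edges p) =
    \sum_(p : walk n k | closed_walk p) \sum_(y < n) (backtrack_free h p)%:R * mu (edges p).
  rewrite mulr_sumr [LHS]big_mkcondr; apply: eq_bigr => p _.
  rewrite sumr_const card_ord mulr_natl.
  by case: ifP; rewrite ?mul1r ?mul0r ?mul0rn.
rewrite -sumrB; apply: le_trans (ler_norm_sum _ _ _) _.
apply: (@le_trans _ _ (\sum_(p : walk n k) \sum_(y < n)
    ((A p y)%:R * K k.+2 + (B p y)%:R * K k))).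
  rewrite big_mkcond; apply: ler_sum => p _; case: ifP => _; last first.
    by apply: sumr_ge0 => y _; rewrite addr_ge0 ?mulr_ge0 ?K_ge0.
  rewrite -sumrB; apply: le_trans (ler_norm_sum _ _ _) _; apply: ler_sum => y _.
  have [/existsP[j /eqP jb]|] := boolP (bad p y); last first.
    rewrite negb_exists => /forallP gd.
    have [|-> ->] := @good_insert k h p y hk; first by move=> j jk; exact: (gd (Ordinal jk)).
    by rewrite subrr normr0 addr_ge0 ?mulr_ge0 ?K_ge0.
  have bp : bad p y by apply/existsP; exists j; apply/eqP.
  apply: le_trans (ler_normB _ _) _; rewrite lerD// normrM ?/A ?/B bp /=.
    apply: le_trans (bad_insert hk (ltn_ord j) jb).
    by rewrite -[leRHS]mul1r ler_wpM2r// normr_nat lern1 leq_b1.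
  apply: le_trans (mu_nvals p).
  by rewrite -[leRHS]mul1r ler_wpM2r// normr_nat lern1 leq_b1.
under eq_bigr do rewrite big_split /=.
rewrite big_split /= lerD//.
  under eq_bigr do rewrite -mulr_suml.
  rewrite -mulr_suml [leRHS]mulrAC ler_wpM2r ?K_ge0//.
  apply: le_trans (@card_nvals k.+2 k.+1./2 _); last by lia.
  rewrite pair_big /= -natr_sum ler_nat.
  pose ins (py : walk n k * 'I_n) := insert_backtrack h py.1 py.2.
  have insI : injective ins.
    move=> [p y] [p' y'] E; congr (_, _).
      by rewrite -(remove_insert p y hk) -(remove_insert p' y' hk) -/(ins (p, y)) E.
    have := congr1 (fun q : walk n k.+2 => vx q h.+1) E.
    by rewrite !vx_insert ?ltnn ?eqxx//; lia.
  apply: (@leq_trans #|[set py | (nvals (@vsum_ord n k.+2) (ins py) <= k.+1./2)%N]|).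
    rewrite -sum1dep_card [leqRHS]big_mkcond /=; apply: leq_sum => py _.
    by rewrite /A; case: (bad _ _); case: ifP.
  rewrite -(card_imset _ insI); apply: subset_leq_card; apply/fintype.subsetP => q.
  by move=> /imsetP[py]; rewrite !finset.inE => ? ->.
under eq_bigr do rewrite -mulr_suml.
rewrite -mulr_suml [leRHS]mulrAC ler_wpM2r ?K_ge0//.
apply: (@le_trans _ _ (k%:R * #|[set p : walk n k | (nvals (@vsum_ord n k) p <= k./2)%N]|%:R)).
  rewrite pair_big /= -natr_sum -natrM ler_nat mulnC.
  rewrite -sum1dep_card big_distrl /= [leqRHS]big_mkcond /= -(pair_big xpredT xpredT (fun p y => (B p y : nat))) /=.
  apply: leq_sum => p _; rewrite /B; case: ifP => pk; last first.
    by rewrite big1// => y _; rewrite andbF.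
  rewrite mul1n -[k in leqRHS]card_ord -sum1_card.
  apply: (@leq_trans (\sum_(y < n) \sum_(j < k) (vsum p j == vx p h + y)%N)).
    apply: leq_sum => y _; rewrite andbT /bad.
    case: existsP => [[j jy]|//]; rewrite (bigD1 j)//= jy.
    by rewrite leq_addr.
  rewrite exchange_big /=; apply: leq_sum => j _.
  rewrite -(big_mkcond (fun y : 'I_n => vsum p j == vx p h + y)%N (fun=> 1%N)) /=.
  rewrite sum1dep_card; apply/card_le1_eqP => y y'; rewrite !finset.inE.
  by move=> /eqP-> /eqP/addnI/val_inj.
rewrite -!mulrA ler_wpM2l// mulrA; apply: card_nvals; lia.
Qed.

End walk_moments.

(** * Four closed walks *)

Section four_circuits.
Variables n k : nat.
Hypothesis n_gt0 : (0 < n)%N.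

Local Notation W := {ffun 'I_4 -> walk n k}.
Local Notation E := ('I_4 * 'I_k)%type.

Definition vsum4 (w : W) (e : E) : 'I_(n + n) := vsum_ord (w e.1) e.2.

Local Notation pat := (pattern vsum4).

(** The vertices up to [j0] are found forward from the start, the later ones backward from the end,
    which equals the start; the sum at [j0] is never crossed. *)
Lemma closed_walk_determined (p q : walk n k) (j0 : 'I_k) :
  closed_walk p -> closed_walk q -> vx p 0 = vx q 0 ->
  (forall j : 'I_k, j != j0 -> vsum p j = vsum q j) -> p = q.
Proof.
move=> /eqP cp /eqP cq pq0 H.
have H' j : (j < k)%N -> j != j0 :> nat -> vsum p j = vsum q j.
  by move=> jk jj0; apply: (H (Ordinal jk)).
have pj0 : vx p j0 = vx q j0.
  apply: (walk_forward (leq0n j0) pq0) => j /andP[_ jj0].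
  by apply: H'; [exact: ltn_trans jj0 _|rewrite ltn_eqF].
have pj1 : vx p j0.+1 = vx q j0.+1.
  apply: (walk_backward (ltn_ord j0)) => [|j /andP[jj0 jk]]; first by rewrite -cp -cq.
  by apply: H'; rewrite // gtn_eqF.
apply: (walk_eqP (leq0n k) pq0) => j jk; have [->|jj0] := eqVneq j (j0 : nat).
  by rewrite /vsum pj0 pj1.
exact: H'.
Qed.

Lemma vsum4_agree (w w' : W) (e : E) : pat w = pat w' ->
  vsum4 w (pat w e) = vsum4 w' (pat w e) -> vsum4 w e = vsum4 w' e.
Proof. by move=> ww' h; rewrite -(val_pattern vsum4 w e) h ww' val_pattern. Qed.

Lemma vsum4_class (w w' : W) (e f : E) : pat w = pat w' ->
  vsum4 w f = vsum4 w e -> vsum4 w e = vsum4 w' e -> vsum4 w f = vsum4 w' f.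
Proof.
move=> ww' fe h; rewrite fe h; apply/esym/eqP.
by rewrite -(pattern_eq vsum4 w') -ww' pattern_eq fe.
Qed.

Lemma four_circuits_eq (w w' : W) :
  [ffun l => vx (w l) 0] = [ffun l => vx (w' l) 0] ->
  (forall e, vsum4 w e = vsum4 w' e) -> w = w'.
Proof.
move=> /ffunP s0 H; apply/ffunP => l.
apply: (@walk_eqP n k _ _ 0) => // [|j jk]; first by have := s0 l; rewrite !ffunE.
exact: (congr1 val (H (l, Ordinal jk))).
Qed.

Definition once (w : W) (e : E) :=
  [forall j, (j != e.2) ==> (vsum4 w (e.1, j) != vsum4 w e)].

Definition closed4 (w : W) := [forall l, closed_walk (w l)].

Local Notation patterns := #|{ffun E -> E}|.

Lemma card_starts : #|{ffun 'I_4 -> 'I_n}| = (n ^ 4)%N.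
Proof. by rewrite card_ffun !card_ord. Qed.

Lemma card_nvals4 m :
  (#|[set w : W | (nvals vsum4 w <= m)%N]| <= patterns * (n ^ 4 * (n + n) ^ m))%N.
Proof.
have := @card_determined W E _ vsum4 _ (fun w : W => [ffun l => vx (w l) 0])
  [set w : W | (nvals vsum4 w <= m)%N] (@reps E) m.
rewrite card_starts card_ord; apply; first by rewrite addn_gt0 n_gt0.
  by move=> w; rewrite finset.inE.
move=> w w' _ _ ww' s0 H; apply: four_circuits_eq => // e.
by apply: vsum4_agree => //; apply: H; apply: imset_f; rewrite finset.in_setT.
Qed.

(* The value of an edge occurring once in its circuit is determined by the
   other values because the circuit closes up. *)
Lemma once_determined (w w' : W) (e : E) : closed4 w -> closed4 w' ->
  pat w = pat w' -> [ffun l => vx (w l) 0] = [ffun l => vx (w' l) 0] -> once w e ->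
  (forall j, vsum4 w (e.1, j) != vsum4 w e -> vsum4 w (e.1, j) = vsum4 w' (e.1, j)) ->
  vsum4 w e = vsum4 w' e.
Proof.
move=> /forallP cw /forallP cw' ww' /ffunP s0 /forallP oe H.
have wE : w e.1 = w' e.1.
  apply: (closed_walk_determined (j0 := e.2)) => //; first by have := s0 e.1; rewrite !ffunE.
  by move=> j je; apply: (congr1 val (H j _)); apply: (implyP (oe j)).
by rewrite /vsum4 wE.
Qed.

Lemma card_nvals4_once m (e0 : E) :
  (#|[set w : W | [&& closed4 w, (nvals vsum4 w <= m.+1)%N & once w e0]]|
   <= patterns * (n ^ 4 * (n + n) ^ m))%N.
Proof.
set S := finset.finset _.
have := @card_determined W E _ vsum4 _ (fun w : W => [ffun l => vx (w l) 0]) S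
  (fun rho => reps rho :\ rho e0) m.
rewrite card_starts card_ord; apply; first by rewrite addn_gt0 n_gt0.
  move=> w; rewrite finset.inE => /and3P[_ wm _].
  have := cardsD1 (pat w e0) (reps (pat w)); rewrite imset_f ?finset.in_setT//=.
  by move=> h; move: wm; rewrite /nvals h add1n ltnS.
move=> w w'; rewrite !finset.inE => /and3P[cw _ oe] /and3P[cw' _ _] ww' s0 H.
have agree e : vsum4 w e != vsum4 w e0 -> vsum4 w e = vsum4 w' e.
  move=> ee0; apply: vsum4_agree => //; apply: H.
  by rewrite finset.in_setD1 imset_f ?finset.in_setT// andbT pattern_eq.
have agree0 : vsum4 w e0 = vsum4 w' e0 by apply: once_determined => // j; exact: agree.
apply: four_circuits_eq => // e; have [ee0|] := eqVneq (vsum4 w e) (vsum4 w e0).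
  exact: vsum4_class ee0 agree0.
exact: agree.
Qed.

(** The last condition fixes the order of recovery. The circuit of [e1] avoids the value of [e0], so
    the value of [e1] is found first; only then is the circuit of [e0], which may contain that
    value, known apart from [e0]. *)
Lemma card_nvals4_once2 m (e0 e1 : E) :
  (#|[set w : W | [&& closed4 w, (nvals vsum4 w <= m.+2)%N, once w e0, once w e1 &
      [forall j, vsum4 w (e1.1, j) != vsum4 w e0]]]|
   <= patterns * (n ^ 4 * (n + n) ^ m))%N.
Proof.
set S := finset.finset _.
have := @card_determined W E _ vsum4 _ (fun w : W => [ffun l => vx (w l) 0]) S
  (fun rho => (reps rho :\ rho e0) :\ rho e1) m.
rewrite card_starts card_ord; apply; first by rewrite addn_gt0 n_gt0.
  move=> w; rewrite finset.inE => /and5P[_ wm _ _ /forallP d].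
  have := cardsD1 (pat w e0) (reps (pat w)); rewrite imset_f ?finset.in_setT//=.
  have := cardsD1 (pat w e1) (reps (pat w) :\ pat w e0).
  rewrite finset.in_setD1 imset_f ?finset.in_setT// andbT pattern_eq.
  have -> : vsum4 w e1 != vsum4 w e0 by have := d e1.2; rewrite -surjective_pairing.
  by move=> h1 h0; move: wm; rewrite /nvals h0 h1 !add1n !ltnS.
move=> w w'; rewrite !finset.inE => /and5P[cw _ oe0 oe1 /forallP d] /and5P[cw' _ _ _ _] ww' s0 H.
have agree e : vsum4 w e != vsum4 w e0 -> vsum4 w e != vsum4 w e1 -> vsum4 w e = vsum4 w' e.
  move=> ee0 ee1; apply: vsum4_agree => //; apply: H.
  by rewrite !finset.in_setD1 imset_f ?finset.in_setT// andbT !pattern_eq ee0 ee1.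
have agree1 : vsum4 w e1 = vsum4 w' e1.
  by apply: once_determined => // j; apply: agree; exact: d.
have agree0 : vsum4 w e0 = vsum4 w' e0.
  apply: once_determined => // j je0; have [je1|] := eqVneq (vsum4 w (e0.1, j)) (vsum4 w e1).
    exact: vsum4_class je1 agree1.
  exact: agree.
apply: four_circuits_eq => // e; have [ee0|ee0] := eqVneq (vsum4 w e) (vsum4 w e0).
  exact: vsum4_class ee0 agree0.
have [ee1|] := eqVneq (vsum4 w e) (vsum4 w e1); first exact: vsum4_class ee1 agree1.
exact: agree.
Qed.

Definition linked (w : W) (l : 'I_4) :=
  [exists j, exists e : E, (e.1 != l) && (vsum4 w (l, j) == vsum4 w e)].

Definition relevant (w : W) := [&& closed4 w, [forall e, ~~ unrepeated vsum4 w e]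
  & [forall l, linked w l]].

Lemma other_circuit (l l' : 'I_4) : exists l'' : 'I_4, (l'' != l) && (l'' != l').
Proof.
have /card_gt0P[l'' ] : (0 < #|~: [set l; l']|)%N.
  have := cardsC [set l; l']; rewrite card_ord cards2; case: (l != l') => /= ?; lia.
by rewrite !finset.inE negb_or => ?; exists l''.
Qed.

Lemma fiber_ge (w : W) (e : E) (s : seq E) : uniq s ->
  (forall f, f \in s -> vsum4 w f = vsum4 w e) ->
  (size s <= #|[set f | pat w f == pat w e]|)%N.
Proof.
move=> us se; have <- : #|[set f in s]| = size s by rewrite cardsE; exact/card_uniqP.
apply: subset_leq_card; apply/fintype.subsetP => f; rewrite !finset.inE pattern_eq.
by move=> /se ->.
Qed.

Lemma onceN (w : W) (e : E) : ~~ once w e ->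
  exists j, j != e.2 /\ vsum4 w (e.1, j) = vsum4 w e.
Proof.
rewrite negb_forall => /existsP[j]; rewrite negb_imply negbK => /andP[je /eqP ve].
by exists j.
Qed.

(** The [4 k] edges have at most [2 k] values. In each case two powers of [n] are saved: by missing
    values, by edges whose value is recovered from closedness, or by one of each. *)
Lemma relevant_cases (w : W) : (0 < k)%N -> relevant w ->
  [|| (nvals vsum4 w <= k.*2.-2)%N,
      (nvals vsum4 w <= k.*2.-1)%N && [exists e, once w e] |
      (nvals vsum4 w <= k.*2)%N && [exists e0, exists e1, [&& once w e0, once w e1 &
         [forall j, vsum4 w (e1.1, j) != vsum4 w e0]]]].
Proof.
have sub2 m : (4 <= m -> 2 <= m - 2)%N by lia.
move=> k0 /and3P[_ /forallP nu /forallP lk].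
have cE : #|{: E}| = (4 * k)%N by rewrite card_prod !card_ord.
have nv : (nvals vsum4 w <= k.*2)%N by have := nvals_le_half nu; rewrite cE; lia.
have [//|nv2] := leqP (nvals vsum4 w) k.*2.-2; rewrite orFb nv andTb.
have linkP l : exists j e, e.1 != l /\ vsum4 w (l, j) = vsum4 w e.
  have /existsP[j /existsP[e /andP[el /eqP v]]] := lk l; by exists j, e.
have [j0 [f0 [f0l v0]]] := linkP ord0.
(* The circuit [l] lies outside the first link, so that its own link gives a second, separate
   constraint. *)
have [l] := other_circuit ord0 f0.1 => /andP[l0 lf0].
have [j1 [f1 [f1l v1]]] := linkP l.
have [nv1|nv1] := leqP (nvals vsum4 w) k.*2.-1; apply/orP.
  left; rewrite andTb; apply/existsP; apply: contrapT => no.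
  have {}no e : ~~ once w e by apply/negP => oe; apply: no; exists e.
  (* With [2 k - 1] values the total excess over two edges per value is 2. If no edge is alone in
     its circuit, a linking value occurs twice in each of two circuits and already uses up this
     excess. *)
  have ex m : (\sum_(r in reps (pat w)) (#|[set f | pat w f == r]| - 2) >= m)%N -> (m <= 2)%N.
    by move=> /(nvals_le nu); rewrite cE; lia.
  have [a [aj0 va]] := onceN (no (ord0, j0)).
  have [b [bf0 vb]] := onceN (no f0).
  rewrite /= in aj0 va.
  have u4 : uniq [:: (ord0, j0); (ord0, a); f0; (f0.1, b)].
    rewrite /= !inE !negb_or !xpair_eqE eqxx /= (eq_sym j0) aj0 /=.
    have f0E (x : 'I_4 * 'I_k) : x.1 != f0.1 -> x != f0 by apply: contra => /eqP ->.
    rewrite (eq_sym (ord0 : 'I_4)) (negbTE f0l) /= !f0E ?(eq_sym (ord0 : 'I_4))//=.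
    by rewrite andbT; case: f0 bf0 {f0l v0 lf0 vb f0E} => x y /= h; rewrite xpair_eqE eqxx eq_sym.
  have f4 : (4 <= #|[set f | pat w f == pat w (ord0, j0)]|)%N.
    apply: (fiber_ge u4) => f; rewrite !inE.
    by case/or4P => /eqP-> //; rewrite ?vb v0.
  have rP e : pat w e \in reps (pat w) by rewrite imset_f ?finset.in_setT.
  (* Either the circuit [l] also contains the first linking value, which then has five edges and
     excess 3, or its own link has another value, and the two excesses add up to 4. *)
  have [/existsP[i /eqP vi]|] := boolP [exists i, vsum4 w (l, i) == vsum4 w (ord0, j0)].
    have u5 : uniq [:: (l, i); (ord0, j0); (ord0, a); f0; (f0.1, b)].
      rewrite cons_uniq u4 andbT !inE !negb_or !xpair_eqE (negbTE l0) (negbTE lf0) /=.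
      by rewrite andbT; apply: contra lf0 => /eqP <-.
    have f5 : (5 <= #|[set f | pat w f == pat w (ord0, j0)]|)%N.
      apply: (fiber_ge u5) => f; rewrite in_cons => /orP[/eqP->//|].
      by rewrite !inE; case/or4P => /eqP-> //; rewrite ?vb v0.
    have /ex// : (3 <= \sum_(r in reps (pat w)) (#|[set f | pat w f == r]| - 2))%N.
    rewrite (bigD1 (pat w (ord0, j0)))//=; apply: leq_trans (leq_addr _ _).
    by rewrite leq_subRL//; exact: ltnW (ltnW (ltnW f5)).
  rewrite negb_exists => /forallP ni.
  have [a' [aj1 va']] := onceN (no (l, j1)).
  have [b' [bf1 vb']] := onceN (no f1).
  rewrite /= in aj1 va'.
  have u4' : uniq [:: (l, j1); (l, a'); f1; (f1.1, b')].
    rewrite /= !inE !negb_or !xpair_eqE eqxx /= (eq_sym j1) aj1 /=.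
    have f1E (x : 'I_4 * 'I_k) : x.1 != f1.1 -> x != f1 by apply: contra => /eqP ->.
    rewrite (eq_sym l) (negbTE f1l) /= !f1E ?(eq_sym l)//=.
    by rewrite andbT; case: f1 bf1 {f1l v1 vb' f1E} => x y /= h; rewrite xpair_eqE eqxx eq_sym.
  have f4' : (4 <= #|[set f | pat w f == pat w (l, j1)]|)%N.
    apply: (fiber_ge u4') => f; rewrite !inE.
    by case/or4P => /eqP-> //; rewrite ?vb' v1.
  have /ex// : (4 <= \sum_(r in reps (pat w)) (#|[set f | pat w f == r]| - 2))%N.
  rewrite (bigD1 (pat w (ord0, j0)))//= (bigD1 (pat w (l, j1)))/=; last first.
    by rewrite rP pattern_eq; exact: ni.
  rewrite addnA; apply: leq_trans (leq_addr _ _).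
  exact: leq_add (sub2 _ f4) (sub2 _ f4').
(* With [2 k] values each occurs exactly twice, so both occurrences of a linking value are spent on
   different circuits. *)
right; apply/existsP; exists (ord0, j0); apply/existsP; exists (l, j1).
have no3 e1 e2 e3 : uniq [:: e1; e2; e3] -> vsum4 w e2 = vsum4 w e1 ->
    vsum4 w e3 = vsum4 w e1 -> False.
  by move=> u h2 h3; have := nvals_lt_half nu u h2 h3; rewrite cE; lia.
apply/and3P; split; apply/forallP => j /=.
- apply/implyP => jj0; apply/negP => /eqP vj; apply: (no3 (ord0, j0) (ord0, j) f0) => //.
  rewrite /= !inE negb_or xpair_eqE eqxx /= (eq_sym j0) jj0 /= andbT.
  by apply/andP; split; apply: contra f0l => /eqP <-.
- apply/implyP => jj1; apply/negP => /eqP vj; apply: (no3 (l, j1) (l, j) f1) => //.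
  rewrite /= !inE negb_or xpair_eqE eqxx /= (eq_sym j1) jj1 /= andbT.
  by apply/andP; split; apply: contra f1l => /eqP <-.
- apply/negP => /eqP vj; apply: (no3 (ord0, j0) (l, j) f0) => //.
  rewrite /= !inE negb_or xpair_eqE (eq_sym ord0) (negbTE l0) /= andbT.
  apply/andP; split; first by apply: contra f0l => /eqP <-.
  by apply: contra lf0 => /eqP <-.
Qed.

(** The factor [1 + #|E| + #|E|^2] comes from the choice of no, one or two edges in the three cases
    of [relevant_cases]. *)
Lemma card_relevant : (0 < k)%N ->
  (#|[set w : W | relevant w]| <=
   patterns * (1 + #|{: E}| + #|{: E}| * #|{: E}|) * 2 ^ k.*2.-2 * (n ^ 4 * n ^ k.*2.-2))%N.
Proof.
move=> k0; set m := k.*2.-2; pose D := (patterns * (n ^ 4 * (n + n) ^ m))%N.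
have m1 : k.*2.-1 = m.+1 by rewrite /m; lia.
have m2 : k.*2 = m.+2 by rewrite /m; lia.
pose S0 := [set w : W | (nvals vsum4 w <= m)%N].
pose S1 e := [set w : W | [&& closed4 w, (nvals vsum4 w <= m.+1)%N & once w e]].
pose S2 e0 e1 := [set w : W | [&& closed4 w, (nvals vsum4 w <= m.+2)%N, once w e0, once w e1 &
      [forall j, vsum4 w (e1.1, j) != vsum4 w e0]]].
have sub (w : W) : ((relevant w : nat) <= (w \in S0) + \sum_e (w \in S1 e) +
    \sum_e0 \sum_e1 (w \in S2 e0 e1))%N.
  case: (boolP (relevant w)) => //= rw; have /and3P[cw _ _] := rw.
  have := relevant_cases k0 rw; rewrite m1 m2 -/m.
  case/or3P => [h|/andP[h /existsP[e oe]]|/andP[h /existsP[e0 /existsP[e1 /and3P[once0 once1 d]]]]].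
  - have -> : w \in S0 by rewrite finset.inE.
    by rewrite -addnA leq_addr.
  - have wS : w \in S1 e by rewrite finset.inE cw h oe.
    by rewrite (bigD1 e)//= wS; lia.
  - have wS : w \in S2 e0 e1 by rewrite finset.inE cw h once0 once1 d.
    apply: leq_trans (leq_addl _ _).
    by rewrite (bigD1 e0)//= (bigD1 e1)//= wS -addnA leq_addr.
apply: (@leq_trans ((1 + #|{: E}| + #|{: E}| * #|{: E}|) * D)%N); last first.
  have e : ((n + n) ^ m = 2 ^ m * n ^ m)%N by rewrite addnn -mul2n expnMn.
  by rewrite /D e leq_eqVlt; apply/orP; left; apply/eqP; ring.
have cardE (S : {set W}) : (#|S| = \sum_(w : W) (w \in S))%N.
  by rewrite -sum1_card big_mkcond; apply: eq_bigr => w _; case: ifP.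
rewrite cardE.
apply: (@leq_trans (\sum_(w : W) ((w \in S0) + \sum_e (w \in S1 e) +
    \sum_e0 \sum_e1 (w \in S2 e0 e1)))%N).
  by apply: leq_sum => w _; rewrite finset.inE.
rewrite !big_split /= !mulnDl mul1n; apply: leq_add; first apply: leq_add.
- by rewrite -cardE; exact: card_nvals4.
- rewrite exchange_big /= -sum_nat_const; apply: leq_sum => e _.
  by rewrite -cardE; exact: card_nvals4_once.
- rewrite exchange_big /= -mulnA -sum_nat_const; apply: leq_sum => e0 _.
  rewrite exchange_big /= -sum_nat_const; apply: leq_sum => e1 _.
  by rewrite -cardE; exact: card_nvals4_once2.
Qed.

End four_circuits.

(** * Convergence of the expected moments *)

Local Open Scope classical_set_scope.

Section expected_moments.
Context d (T : measurableType d) (R : realType) (P : probability T R).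
Variable a : forall n : nat, 'I_n -> 'I_n -> {RV P >-> R}.
Local Notation Sc X := (Rintegral (@semicircle R) setT X).

Hypothesis A1 : condA1 a.
Hypothesis A2 : condA2 a.
Hypothesis A3 : condA3 a.
Hypothesis C1 : condC1 a.

Let sqrn n : R := Num.sqrt n%:R.

Definition walk_mean n k h : R :=
  (n%:R * sqrn n ^+ k)^-1 *
  \sum_(p : walk n k | closed_walk p && backtrack_free h p) mixed_moment a (edges p).

Let sqrn_gt0 n : (0 < n)%N -> 0 < sqrn n.
Proof. by move=> n0; rewrite sqrtr_gt0 ltr0n. Qed.

Let sqrn_sqr n : sqrn n ^+ 2 = n%:R.
Proof. by rewrite sqr_sqrtr. Qed.

Let sqrn_ge1 n : (0 < n)%N -> 1 <= sqrn n.
Proof. by move=> n0; rewrite -[leLHS]sqrtr1 ler_sqrt ?ltr0n// ler1n. Qed.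

(** Falling short of [k / 2] distinct sums costs at least half a power of [n]. *)
Lemma walk_power_le n k m : (0 < n)%N -> (m.*2 < k)%N ->
  (n%:R * sqrn n ^+ k)^-1 * (n * n ^ m)%:R <= (sqrn n)^-1.
Proof.
move=> n0 mk; have s0 := sqrn_gt0 n0.
have nn0 : n%:R != 0 :> R by rewrite pnatr_eq0 -lt0n.
rewrite natrM natrX -sqrn_sqr -exprM mul2n invfM mulrACA mulVf; last first.
  by rewrite expf_neq0// gt_eqF.
rewrite mul1r mulrC ler_pdivrMr ?exprn_gt0//.
rewrite -(prednK (leq_trans (ltn0Sn _) mk)) exprS mulKf ?gt_eqF//.
by apply: ler_weXn2l; [exact: sqrn_ge1|lia].
Qed.

Lemma cvg_sqrn_inv : (sqrn n)^-1 @[n --> \oo] --> (0 : R).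
Proof.
have h : n%:R^-1 @[n --> \oo] --> (0 : R).
  rewrite gtr0_cvgV0; first exact: cvgr_idn.
  by exists 1%N => // n /=; rewrite ltr0n.
have -> : (fun n => (sqrn n)^-1) = (fun n => Num.sqrt (n%:R^-1)).
  by apply/funext => n; rewrite sqrtrV.
rewrite -[X in _ --> X]sqrtr0; apply: (cvg_comp _ Num.sqrt); last exact: sqrt_continuous.
exact: h.
Qed.

Let K := projT1 (cid (mixed_moment_bound A2)).
Let KP n (s : seq ('I_n * 'I_n)) : `|mixed_moment a s| <= K (size s).
Proof. exact: (projT2 (cid (mixed_moment_bound A2))). Qed.
Let c := projT1 (cid C1).
Let cP := projT2 (cid C1).

Let c_ge0 n tau : 0 <= c n tau.
Proof. by case: cP. Qed.

Let mu_cov n (x y x' y' : 'I_n) : (x + y = x' + y')%N ->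
  `|mixed_moment a [:: (x, y); (x', y')]| <=
  c n `|x%:Z - x'%:Z|%N + c n `|y%:Z - x'%:Z|%N.
Proof.
apply: mixed_moment_cov => // p q r s pq rs pqrs.
by case: cP => _ /(_ n p q r s pq rs pqrs)[].
Qed.

Lemma cvg_cov_sum : (n%:R^-1 * \sum_(tau < n) c n tau) @[n --> \oo] --> (0 : R).
Proof.
case: cP => _ _ /eqoP co; apply/cvgrPdist_le => e e0.
near=> n.
have n0 : (0 < n)%N by near: n; exists 1%N.
rewrite sub0r normrN normrM normfV ler_pdivrMl ?normr_gt0 ?pnatr_eq0 -?lt0n//.
by rewrite mulrC; near: n; exact: co e e0.
Unshelve. all: by end_near. Qed.

Let le_mul_norm (C x y : R) : 0 <= x -> x <= y -> C * x <= `|C| * y.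
Proof.
move=> x0 xy; apply: le_trans (ler_norm _) _.
by rewrite normrM (ger0_norm x0) ler_wpM2l.
Qed.

Lemma walk_mean_diag k : (0 < k)%N -> walk_mean n k k @[n --> \oo] --> (0 : R).
Proof.
move=> k0.
pose C : R := #|{ffun 'I_k -> 'I_k}|%:R * 2 ^+ k * K k.
pose D : R := k%:R * k%:R * 2 * K (k - 2) * #|{ffun 'I_k -> 'I_k}|%:R * 2 ^+ k.+1.
have bnd n : (0 < n)%N -> `|walk_mean n k k| <=
    `|C| * (sqrn n)^-1 + `|D| * (n%:R^-1 * \sum_(tau < n) c n tau).
  move=> n0; rewrite /walk_mean normrM ger0_norm; last first.
    by rewrite invr_ge0 mulr_ge0 ?exprn_ge0// ltW// sqrn_gt0.
  have w0 : 0 <= (n%:R * sqrn n ^+ k)^-1.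
    by rewrite invr_ge0 mulr_ge0 ?exprn_ge0// ltW// sqrn_gt0.
  have S0 : 0 <= \sum_(tau < n) c n tau by apply: sumr_ge0 => tau _; exact: c_ge0.
  have := @sum_backtrack_free R n (@mixed_moment _ _ _ _ a n) K (c n) n0
    (@mixed_moment_perm _ _ _ _ a n) (@KP n) (mixed_moment_cat A2 A3 (n := n))
    (mixed_moment1 A1 (n := n)) (c_ge0 n) (@mu_cov n) k k0.
  move=> /(ler_wpM2l w0) /le_trans; apply; rewrite mulrDr lerD//.
    rewrite mulrCA; apply: le_mul_norm; first by rewrite mulr_ge0.
    by apply: walk_power_le => //; lia.
  have [ok|ek] := boolP (odd k).
    by rewrite mul0r mulr0 !mulr_ge0// invr_ge0.
  rewrite mul1r -/D -mulrA mulrCA; apply: le_mul_norm; first by rewrite !mulr_ge0.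
  rewrite mulrA ler_wpM2r//.
  have nn0 : n%:R != 0 :> R by rewrite pnatr_eq0 -lt0n.
  (* For even [k], the count [n * n ^ (k / 2 - 1)] over [n * n ^ (k / 2)] leaves [n ^ -1] in front
     of the sum of [c]. *)
  have -> : sqrn n ^+ k = n%:R ^+ k./2.-1.+1.
    by rewrite -sqrn_sqr -exprM; congr (_ ^+ _); lia.
  have nm0 : n%:R ^+ k./2.-1 != 0 :> R by rewrite expf_neq0.
  rewrite natrM natrX exprS le_eqVlt; apply/orP; left; apply/eqP; field.
  by rewrite nn0 nm0.
apply/cvgr0Pnorm_le => e e0.
have : (`|C| * (sqrn n)^-1 + `|D| * (n%:R^-1 * \sum_(tau < n) c n tau)) @[n --> \oo]
    --> `|C| * 0 + `|D| * 0.
  apply: cvgD; apply: cvgM; try exact: cvg_cst.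
    exact: cvg_sqrn_inv.
  exact: cvg_cov_sum.
rewrite !mulr0 addr0 => /cvgr0Pnorm_le/(_ e e0).
move=> H; near=> n.
have n0 : (0 < n)%N by near: n; exists 1%N.
by apply: le_trans (bnd n n0) _; apply: le_trans (ler_norm _) _; near: n.
Unshelve. all: by end_near. Qed.

Lemma walk_mean_recurrence k h : (h <= k)%N ->
  (walk_mean n k.+2 h.+1 - walk_mean n k.+2 h.+2 - walk_mean n k h) @[n --> \oo] --> (0 : R).
Proof.
move=> hk.
pose C : R := #|{ffun 'I_k.+2 -> 'I_k.+2}|%:R * 2 ^+ k.+2 * K k.+2.
pose D : R := k%:R * #|{ffun 'I_k -> 'I_k}|%:R * 2 ^+ k * K k.
have bnd n : (0 < n)%N ->
    `|walk_mean n k.+2 h.+1 - walk_mean n k.+2 h.+2 - walk_mean n k h| <=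
    (`|C| + `|D|) * (sqrn n)^-1.
  move=> n0.
  have s0 := sqrn_gt0 n0.
  have w0 : 0 <= (n%:R * sqrn n ^+ k.+2)^-1.
    by rewrite invr_ge0 mulr_ge0 ?exprn_ge0// ltW// sqrn_gt0.
  have nn0 : n%:R != 0 :> R by rewrite pnatr_eq0 -lt0n.
  have -> : walk_mean n k h = (n%:R * sqrn n ^+ k.+2)^-1 * (n%:R *
      \sum_(p : walk n k | closed_walk p && backtrack_free h p) mixed_moment a (edges p)).
    rewrite /walk_mean mulrA -[k.+2]addn2 exprD sqrn_sqr; congr (_ * _).
    have sk0 : sqrn n ^+ k != 0 by rewrite expf_neq0// gt_eqF.
    by field; rewrite ?nn0 ?sk0.
  rewrite -!mulrBr normrM ger0_norm//.
  have := @sum_backtrack_recurrence R n (@mixed_moment _ _ _ _ a n) K n0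
    (@mixed_moment_perm _ _ _ _ a n) (@KP n) (mixed_moment_cat A2 A3 (n := n))
    (mixed_moment1 A1 (n := n)) (mixed_moment_sqr A1 (n := n)) k h hk.
  move=> /(ler_wpM2l w0) /le_trans; apply; rewrite mulrDr mulrDl lerD//.
    rewrite mulrCA; apply: le_mul_norm; first by rewrite mulr_ge0.
    by apply: walk_power_le => //; lia.
  rewrite mulrCA; apply: le_mul_norm; first by rewrite mulr_ge0.
  by apply: walk_power_le => //; lia.
apply/cvgr0Pnorm_le => e e0.
have : ((`|C| + `|D|) * (sqrn n)^-1) @[n --> \oo] --> (`|C| + `|D|) * 0.
  by apply: cvgM; [exact: cvg_cst|exact: cvg_sqrn_inv].
rewrite !mulr0 => /cvgr0Pnorm_le/(_ e e0).
move=> H; near=> n.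
have n0 : (0 < n)%N by near: n; exists 1%N.
by apply: le_trans (bnd n n0) _; apply: le_trans (ler_norm _) _; near: n.
Unshelve. all: by end_near. Qed.

(** The recurrence expresses the mean at [(k, h)] by those at [(k, h + 1)] and [(k - 2, h - 1)], so
    the outer induction is on [k] and the inner one on [k - h], down to the diagonal. Since it
    starts at [h = 1], the case [h = 0] is first rewritten as [h = 1]. *)
Lemma cvg_walk_mean k h : (h <= k)%N ->
  walk_mean n k h @[n --> \oo] --> Sc (fun x => x ^+ (k - h) * cheb h x).
Proof.
have fx := @finite_moments_semicircle R.
have fxc j h' : finite_moments (@semicircle R) (fun x => x ^+ j * cheb h' x).
  by apply: finite_momentsM; [exact: finite_momentsX|exact: finite_moments_cheb].
have [m] := ubnP k; elim: m k h => // m IHm k h /ltnSE km.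
have [e] := ubnP (k - h); elim: e h => // e IHe h /ltnSE khe hk.
have [kh|kh] := eqVneq k h.
  rewrite -{}kh subnn; under eq_Rintegral do rewrite expr0 mul1r.
  rewrite semicircle_cheb; have [k0|k0] := eqVneq k 0%N; last first.
    by apply: walk_mean_diag; rewrite lt0n.
  rewrite k0; apply: cvg_near_cst; exists 1%N => // n /= n0.
  rewrite /walk_mean expr0 mulr1 (eq_bigr (fun=> 1)) => [|p _]; last exact: mixed_moment_nil.
  rewrite (eq_bigl predT) => [|p]; last by rewrite /closed_walk eqxx.
  by rewrite sumr_const card_ffun !card_ord expn1 mulVf// pnatr_eq0 -lt0n.
have hk' : (h < k)%N by rewrite ltn_neqAle eq_sym kh.
case: h => [|h] in khe hk kh hk' *.
  have -> : (fun n => walk_mean n k 0) = (fun n => walk_mean n k 1) by [].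
  have -> : Sc (fun x => x ^+ (k - 0) * cheb 0 x) = Sc (fun x => x ^+ (k - 1) * cheb 1 x).
    by apply: eq_Rintegral => x _; rewrite /= mulr1 subn0 subn1 -exprSr prednK.
  by apply: IHe => //; lia.
case: k => [//|[//|k]] in km IHe khe hk kh hk' *.
have -> : (fun n => walk_mean n k.+2 h.+1) = (fun n => walk_mean n k.+2 h.+2 + walk_mean n k h +
   (walk_mean n k.+2 h.+1 - walk_mean n k.+2 h.+2 - walk_mean n k h)).
  by apply/funext => n; ring.
rewrite -[X in _ --> X]addr0; apply: cvgD; last exact: walk_mean_recurrence.
have -> : Sc (fun x => x ^+ (k.+2 - h.+1) * cheb h.+1 x) =
    Sc (fun x => x ^+ (k.+2 - h.+2) * cheb h.+2 x) + Sc (fun x => x ^+ (k - h) * cheb h x).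
  rewrite -ExD//; apply: eq_Rintegral => x _.
  have -> : (k.+2 - h.+1 = (k - h).+1)%N by lia.
  by rewrite !subSS chebSS exprS; ring.
apply: cvgD; first by apply: IHe; lia.
by apply: IHm; lia.
Qed.

Lemma cvg_closed_walk_mean k : walk_mean n k 0 @[n --> \oo] --> Sc (fun x => x ^+ k).
Proof.
have := @cvg_walk_mean k 0 isT; rewrite subn0.
by under eq_Rintegral do rewrite mulr1.
Qed.

End expected_moments.

(** * Concentration *)

Local Open Scope classical_set_scope.

Section fourth_moment.
Context d (T : measurableType d) (R : realType) (P : probability T R).
Variable a : forall n : nat, 'I_n -> 'I_n -> {RV P >-> R}.
Local Notation Ex X := (Rintegral P setT X).

Hypothesis A1 : condA1 a.
Hypothesis A2 : condA2 a.
Hypothesis A3 : condA3 a.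

Definition centered n (s : seq ('I_n * 'I_n)) (w : T) : R :=
  monomial a s w - mixed_moment a s.

Lemma finite_moments_centered n (s : seq ('I_n * 'I_n)) : finite_moments P (centered s).
Proof.
apply: finite_momentsB; first exact: finite_moments_monomial.
exact: finite_moments_cst.
Qed.

Let fmon n (s : seq ('I_n * 'I_n)) : finite_moments P (monomial a s).
Proof. exact: finite_moments_monomial. Qed.

Let fprod n (ls : seq (seq ('I_n * 'I_n))) :
  finite_moments P (fun w => \prod_(s <- ls) centered s w).
Proof. by apply: finite_moments_prod => s _; exact: finite_moments_centered. Qed.

(** Expands one centered factor; [t] accumulates the monomials split off so far, which lets the
    inductions below run over the list of circuits. *)
Lemma Ex_centered_cons n (G : T -> R) (s t : seq ('I_n * 'I_n)) : finite_moments P G ->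
  Ex (fun w => G w * centered s w * monomial a t w) =
  Ex (fun w => G w * monomial a (s ++ t) w) -
  mixed_moment a s * Ex (fun w => G w * monomial a t w).
Proof.
move=> fG; rewrite -ExZ; last exact: finite_momentsM.
rewrite -ExB; last 2 first.
- exact: finite_momentsM.
- by apply: finite_momentsZ; exact: finite_momentsM.
by apply: eq_Rintegral => w _; rewrite monomial_cat /centered; ring.
Qed.

Lemma Ex_centered_bound m k q : exists2 C : R, 0 <= C &
  forall n (ls : seq (seq ('I_n * 'I_n))) (t : seq ('I_n * 'I_n)), size ls = m ->
  all (fun s => size s == k) ls -> size t = q ->
  `|Ex (fun w => (\prod_(s <- ls) centered s w) * monomial a t w)| <= C.
Proof.
have [K KP] := mixed_moment_bound A2.
elim: m q => [|m IH] q.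
  exists `|K q| => // n ls t /size0nil -> _ tq; apply: le_trans (ler_norm _).
  under eq_Rintegral do rewrite big_nil mul1r.
  by rewrite -tq; exact: KP.
have [C0 C00 CP0] := IH (k + q)%N; have [C1 C10 CP1] := IH q.
exists (C0 + `|K k| * C1) => [|n [//|s ls] t [sm] /= /andP[/eqP sk lk] tq].
  by rewrite addr_ge0// mulr_ge0.
under eq_Rintegral do rewrite big_cons [centered _ _ * _]mulrC.
rewrite Ex_centered_cons//; apply: le_trans (ler_normB _ _) _; apply: lerD.
  by apply: CP0 => //; rewrite size_cat sk tq.
rewrite normrM ler_pM//; last exact: CP1.
by apply: le_trans (ler_norm _); rewrite -sk; exact: KP.
Qed.

(** Expanding the other centered factors leaves monomials in edges satisfying [gd], and
    [centered s0] is orthogonal to each of them by the hypothesis. *)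
Lemma Ex_centered_eq0 n (gd : pred ('I_n * 'I_n)) (s0 : seq ('I_n * 'I_n)) :
  (forall t, all gd t -> mixed_moment a (s0 ++ t) = mixed_moment a s0 * mixed_moment a t) ->
  forall (ls : seq (seq ('I_n * 'I_n))) t, all (all gd) ls -> all gd t ->
  Ex (fun w => centered s0 w * (\prod_(s <- ls) centered s w) * monomial a t w) = 0.
Proof.
move=> H ls; elim: ls => [|s ls IH] t /=.
  move=> _ gt; under eq_Rintegral do rewrite big_nil mulr1 -[centered _ _]mul1r.
  rewrite (@Ex_centered_cons n (cst 1) s0 t); last exact: finite_moments_cst.
  under eq_Rintegral do rewrite mul1r.
  rewrite -/(mixed_moment a (s0 ++ t)) H//.
  by under eq_Rintegral do rewrite mul1r; rewrite subrr.
move=> /andP[gs gls] gt.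
under eq_Rintegral do rewrite big_cons [centered s _ * _]mulrC mulrA.
rewrite Ex_centered_cons; last first.
  by apply: finite_momentsM => //; exact: finite_moments_centered.
by rewrite !IH ?all_cat ?gs// mulr0 subrr.
Qed.

Local Notation W n k := {ffun 'I_4 -> walk n k}.

Lemma prod_centered_split n k (w : W n k) (l0 : 'I_4) x :
  \prod_l centered (edges (w l)) x = centered (edges (w l0)) x *
  \prod_(s <- [seq edges (w l) | l <- enum (predC1 l0)]) centered s x.
Proof. by rewrite (bigD1 l0)//= big_map big_enum. Qed.

Lemma Ex_prod_centered_eq0 n k (w : W n k) (l0 : 'I_4) (gd : pred ('I_n * 'I_n)) :
  (forall t, all gd t -> mixed_moment a (edges (w l0) ++ t) =
                         mixed_moment a (edges (w l0)) * mixed_moment a t) ->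
  (forall l (j : 'I_k), l != l0 -> gd (vx (w l) j, vx (w l) j.+1)) ->
  Ex (fun x => \prod_l centered (edges (w l)) x) = 0.
Proof.
move=> H gl.
have := Ex_centered_eq0 H (ls := [seq edges (w l) | l <- enum (predC1 l0)]) (t := [::]).
move=> <- //; last first.
  apply/allP => s /mapP[l]; rewrite mem_enum inE => ll0 ->.
  apply/allP => e /mapP[j]; rewrite mem_iota => /andP[_ jk] ->.
  by apply: (gl l (Ordinal jk)).
apply: eq_Rintegral => x _; rewrite (prod_centered_split _ l0).
by rewrite /monomial big_nil mulr1.
Qed.

Lemma Ex_prod_centered_unrepeated n k (w : W n k) e :
  unrepeated (@vsum4 n k) w e -> Ex (fun x => \prod_l centered (edges (w l)) x) = 0.
Proof.
move=> /forallP ue; pose v := vsum (w e.1) e.2.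
have uv (f : 'I_4 * 'I_k) : f != e -> vsum (w f.1) f.2 != v.
  by move=> fe; apply: (implyP (ue f)).
apply: (@Ex_prod_centered_eq0 n k w e.1 (fun f => f.1 + f.2 != v :> nat)%N); last first.
  by move=> l j le1; apply: (uv (l, j)); apply: contra le1 => /eqP <-.
(* The unrepeated entry splits off with mean zero, so both sides of the required factorization
   vanish; the right one by the case of empty [t]. *)
have zero t : all (fun f : 'I_n * 'I_n => f.1 + f.2 != v :> nat)%N t ->
    mixed_moment a (edges (w e.1) ++ t) = 0.
  move=> tv; pose f j := (vx (w e.1) j, vx (w e.1) j.+1).
  have pe : perm_eq (edges (w e.1) ++ t) ([:: f e.2] ++ (map f (rem (e.2 : nat) (iota 0 k)) ++ t)).
    rewrite catA perm_cat2r; apply: (perm_map f (t := (e.2 : nat) :: rem (e.2 : nat) (iota 0 k))).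
    apply: perm_to_rem; by rewrite mem_iota /= add0n.
  rewrite (mixed_moment_perm _ pe) mixed_moment_cat// ?mixed_moment1 ?mul0r// => f1 f2.
  rewrite inE => /eqP ->; rewrite mem_cat => /orP[/mapP[j + ->]|f2t].
    rewrite mem_rem_uniq ?iota_uniq// !inE mem_iota /= add0n => /andP[je jk].
    rewrite eq_sym; apply: (uv (e.1, Ordinal jk)).
    by apply: contra je => /eqP <-.
  by rewrite eq_sym; exact: (allP tv).
by move=> t tv; rewrite zero// -[edges _]cats0 zero// mul0r.
Qed.

Lemma Ex_prod_centered_unlinked n k (w : W n k) l :
  ~~ linked w l -> Ex (fun x => \prod_l centered (edges (w l)) x) = 0.
Proof.
move=> nl.
apply: (@Ex_prod_centered_eq0 n k w l
  (fun f : 'I_n * 'I_n => all (fun e : 'I_n * 'I_n => e.1 + e.2 != f.1 + f.2 :> nat)%N (edges (w l)))).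
  move=> t /allP gt; apply: mixed_moment_cat => // e f el ft.
  exact: (allP (gt f ft)).
move=> l' j l'l; apply/allP => e /mapP[i + ->]; rewrite mem_iota => /andP[_ ik].
apply: contra nl => /eqP v; apply/existsP; exists (Ordinal ik); apply/existsP; exists (l', j).
by rewrite l'l; apply/eqP/val_inj.
Qed.

Lemma Ex_prod_centered_relevant k : exists2 C : R, 0 <= C & forall n (w : W n k),
  `|Ex (fun x => \prod_l ((closed_walk (w l))%:R * centered (edges (w l)) x))| <=
  (relevant w)%:R * C.
Proof.
have [C C0 CP] := Ex_centered_bound 4 k 0; exists C => // n w.
have [cw|] := boolP (closed4 w); last first.
  move=> ncw; have /existsP[l ncl] : [exists l, ~~ closed_walk (w l)] by rewrite -negb_forall.
  under eq_Rintegral do rewrite (bigD1 l)//= (negbTE ncl) !mul0r.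
  by rewrite (Ex_cst P 0) normr0 mulr_ge0.
have -> : Ex (fun x => \prod_l ((closed_walk (w l))%:R * centered (edges (w l)) x)) =
    Ex (fun x => \prod_l centered (edges (w l)) x).
  apply: eq_Rintegral => x _; apply: eq_bigr => l _.
  by rewrite (forallP cw) mul1r.
have [rw|] := boolP (relevant w).
  rewrite mul1r; have := CP n [seq edges (w l) | l <- enum 'I_4] [::].
  rewrite size_map size_enum_ord => /(_ erefl _ erefl).
  have -> : all (fun s => size s == k) [seq edges (w l) | l <- enum 'I_4].
    by apply/allP => s /mapP[l _ ->]; rewrite size_edges.
  move=> /(_ isT); congr (`|_| <= _); apply: eq_Rintegral => x _.
  by rewrite big_map big_enum /monomial big_nil mulr1.
rewrite /relevant cw /= negb_and => /orP[|].
  rewrite negb_forall => /existsP[e]; rewrite negbK => /Ex_prod_centered_unrepeated ->.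
  by rewrite normr0 mulr_ge0.
rewrite negb_forall => /existsP[l] /Ex_prod_centered_unlinked ->.
by rewrite normr0 mulr_ge0.
Qed.

Definition trace_mean n k (w : T) : R :=
  (n%:R * Num.sqrt n%:R ^+ k)^-1 *
  \sum_(p : walk n k | closed_walk p) monomial a (edges p) w.

Lemma finite_moments_trace_mean n k : finite_moments P (trace_mean n k).
Proof. by apply: finite_momentsZ; apply: finite_moments_sum. Qed.

Lemma trace_mean_centered n k w : trace_mean n k w - walk_mean a n k 0 =
  (n%:R * Num.sqrt n%:R ^+ k)^-1 *
  \sum_(p : walk n k) (closed_walk p)%:R * centered (edges p) w.
Proof.
rewrite /trace_mean /walk_mean -mulrBr; congr (_ * _).
under [X in _ - X]eq_bigl do rewrite andbT.
rewrite -sumrB big_mkcond; apply: eq_bigr => p _.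
by case: ifP => _; rewrite ?mul1r ?mul0r.
Qed.

Lemma trace_mean_fourth_moment k : (0 < k)%N -> exists C : R, forall n, (0 < n)%N ->
  Ex (fun w => (trace_mean n k w - walk_mean a n k 0) ^+ 4) <= C * n%:R ^- 2.
Proof.
move=> k0; have [C C0 CP] := Ex_prod_centered_relevant k.
pose M := (#|{ffun 'I_4 * 'I_k -> 'I_4 * 'I_k}| *
  (1 + #|{: 'I_4 * 'I_k}| + #|{: 'I_4 * 'I_k}| * #|{: 'I_4 * 'I_k}|) * 2 ^ k.*2.-2)%N.
exists (C * M%:R) => n n0.
pose c : R := (n%:R * Num.sqrt n%:R ^+ k)^-1.
have s0 : 0 < Num.sqrt n%:R :> R by rewrite sqrtr_gt0 ltr0n.
have nn0 : n%:R != 0 :> R by rewrite pnatr_eq0 -lt0n.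
have c0 : 0 <= c by rewrite invr_ge0 mulr_ge0// exprn_ge0// ltW.
pose F (w : W n k) x := \prod_l ((closed_walk (w l))%:R * centered (edges (w l)) x).
have fF w : finite_moments P (F w).
  by apply: finite_moments_prod => l _; apply: finite_momentsZ; exact: finite_moments_centered.
have -> : (fun w => (trace_mean n k w - walk_mean a n k 0) ^+ 4) =
    (fun x => c ^+ 4 * \sum_(w : W n k) F w x).
  apply/funext => x; rewrite trace_mean_centered exprMn; congr (_ * _).
  by rewrite -[4%N in LHS]card_ord -prodr_const bigA_distr_bigA.
rewrite ExZ; last exact: finite_moments_sum.
rewrite Ex_sum//; apply: (@le_trans _ _ (c ^+ 4 * \sum_(w : W n k) (relevant w)%:R * C)).
  rewrite ler_wpM2l ?exprn_ge0//; apply: ler_sum => w _.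
  by apply: le_trans (ler_norm _) _; exact: CP.
rewrite -mulr_suml -natr_sum.
have -> : (\sum_(w : W n k) relevant w)%N = #|[set w : W n k | relevant w]%SET|.
  by rewrite -sum1dep_card [RHS]big_mkcond; apply: eq_bigr => w _; case: (relevant w).
have := @card_relevant n k n0 k0; rewrite -/M -(ler_nat R) => h.
apply: (@le_trans _ _ (c ^+ 4 * ((M * (n ^ 4 * n ^ k.*2.-2))%N%:R * C))).
  by rewrite ler_wpM2l ?exprn_ge0// ler_wpM2r.
(* This normalization against the [n ^ (4 + 2 k - 2)] of the relevant families leaves [n ^ -2]. *)
have cE : c ^+ 4 = n%:R ^- 4 * n%:R ^- k.*2.
  rewrite /c exprVn exprMn invfM -exprM; congr (_ * _^-1).
  rewrite (_ : (k * 4 = 2 * k.*2)%N); last by lia.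
  by rewrite exprM sqr_sqrtr.
have kE : k.*2 = (k.*2.-2 + 2)%N by lia.
have nk0 : n%:R ^+ k.*2.-2 != 0 :> R by rewrite expf_neq0.
rewrite cE [in X in X * _]kE exprD !natrM !natrX le_eqVlt; apply/orP; left; apply/eqP.
by field; rewrite nk0 nn0.
Qed.

End fourth_moment.

(** * Almost sure convergence *)

Section trace_walks.
Variables (R : comNzRingType) (n : nat) (M : 'M[R]_n.+1).

Definition walk_cons k (x : 'I_n.+1) (p : walk n.+1 k) : walk n.+1 k.+1 :=
  [ffun i : 'I_k.+2 => if i == 0 :> nat then x else vx p i.-1].

Definition walk_behead k (p : walk n.+1 k.+1) : walk n.+1 k := [ffun i : 'I_k.+1 => vx p i.+1].

Lemma vx_cons k x (p : walk n.+1 k) j : (j <= k.+1)%N ->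
  vx (walk_cons x p) j = if j == 0%N then x else vx p j.-1.
Proof. by move=> jk; rewrite /vx ffunE inordK. Qed.

Lemma edges_cons k x (p : walk n.+1 k) :
  edges (walk_cons x p) = (x, vx p 0) :: edges p.
Proof.
rewrite /edges /= !vx_cons//= -[1%N]addn0 iotaDl -map_comp; congr (_ :: _).
by apply/eq_in_map => j; rewrite mem_iota /= add0n => jk; rewrite !vx_cons; try lia.
Qed.

Lemma mx_exp_walks k x y : (M ^+ k) x y =
  \sum_(p : walk n.+1 k | (vx p 0 == x) && (vx p k == y)) \prod_(e <- edges p) M e.1 e.2.
Proof.
elim: k x => [|k IH] x.
  rewrite expr0 mxE (eq_bigr (fun=> 1)) => [|p _]; last by rewrite big_nil.
  have [->|xy] := eqVneq x y; last first.
    by rewrite big1// => p /andP[/eqP-> /eqP E]; rewrite E eqxx in xy.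
  rewrite (big_pred1 [ffun=> y])// => p; rewrite andbb; apply/eqP/eqP => [<-|->].
    by apply/ffunP => i; rewrite ffunE /vx; congr (p _); apply/val_inj; rewrite /= inordK// (ord1 i).
  by rewrite /vx ffunE.
rewrite exprS mxE.
transitivity (\sum_(p : walk n.+1 k | vx p k == y) M x (vx p 0) *
    \prod_(e <- edges p) M e.1 e.2).
  under eq_bigr do rewrite IH mulr_sumr big_mkcondl.
  rewrite exchange_big /=; apply: eq_bigr => p _.
  by rewrite -big_mkcond (big_pred1 (vx p 0)).
rewrite [RHS](reindex_onto (@walk_cons k x) (@walk_behead k)) /=; last first.
  move=> p /andP[/eqP p0 _]; apply/ffunP => j; rewrite !ffunE.
  case: eqVneq => [j0|j0]; first by rewrite -p0 /vx; congr (p _); apply/val_inj; rewrite /= inordK.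
  rewrite /vx ffunE /vx; congr (p _); apply/val_inj => /=.
  rewrite !inordK ?prednK ?lt0n//; have := ltn_ord j; lia.
apply: eq_big => [p|p _]; last by rewrite edges_cons big_cons.
rewrite !vx_cons// eqxx /=.
have -> : walk_behead (walk_cons x p) = p.
  apply/ffunP => j; rewrite ffunE vx_cons//= /vx; congr (p _).
  by apply/val_inj; rewrite /= inordK.
by rewrite !eqxx andbT.
Qed.

Lemma trace_exp_walks k :
  \tr (M ^+ k) = \sum_(p : walk n.+1 k | closed_walk p) \prod_(e <- edges p) M e.1 e.2.
Proof.
rewrite /mxtrace; under eq_bigr do rewrite mx_exp_walks big_mkcond.
rewrite exchange_big /= [RHS]big_mkcond; apply: eq_bigr => p _.
rewrite -big_mkcond /closed_walk; case: eqVneq => [<-|p0k].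
  by rewrite (big_pred1 (vx p 0))// => x; rewrite andbb eq_sym.
by rewrite big_pred0// => x; apply/negbTE/negP => /andP[/eqP u /eqP v]; rewrite u v eqxx in p0k.
Qed.

End trace_walks.

Local Open Scope classical_set_scope.

Section almost_sure_moments.
Context d (T : measurableType d) (R : realType) (P : probability T R).
Variable a : forall n : nat, 'I_n -> 'I_n -> {RV P >-> R}.
Local Notation Ex X := (Rintegral P setT X).

Lemma eigval_moment n k w : (0 < n)%N ->
  n%:R^-1 * \sum_(x <- eigvals (random_mx a n w)) x ^+ k = trace_mean a n k w.
Proof.
case: n => [//|n] _; rewrite -trace_exp_eigvals; last exact: tr_random_mx.
rewrite trace_exp_walks /trace_mean invfM -mulrA; congr (_ * _).
rewrite mulr_sumr; apply: eq_bigr => p _.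
have entryE (e : 'I_n.+1 * 'I_n.+1) : random_mx a n.+1 w e.1 e.2 =
    (Num.sqrt n.+1%:R)^-1 * entry a e w.
  by rewrite mxE /entry; case: ifP.
under eq_bigr do rewrite entryE.
by rewrite big_split /= big_const_seq count_predT size_edges -exprVn -Monoid.iteropE.
Qed.

(** The series of the nonnegative [Y n] has finite mean, hence is finite almost everywhere, and
    there its terms tend to 0. *)
Lemma ae_cvg0_of_summable (Y : nat -> T -> R) (C : R) :
  (forall n, finite_moments P (Y n)) -> (forall n w, 0 <= Y n w) ->
  (forall n, Ex (Y n) <= C * n.+1%:R ^- 2) ->
  {ae P, forall w, Y n w @[n --> \oo] --> (0 : R)}.
Proof.
move=> fY Y0 YC.
have mY n : measurable_fun setT (fun w => (Y n w)%:E).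
  by apply/measurable_EFinP; case: (fY n).
have Y0' n w : (0 <= (Y n w)%:E)%E by rewrite lee_fin.
have iY : P.-integrable setT (fun w => \sum_(0 <= n <oo) (Y n w)%:E)%E.
  apply/integrableP; split; first exact: ge0_emeasurable_sum.
  under eq_integral do rewrite gee0_abs ?nneseries_ge0//.
  rewrite integral_nneseries//.
  apply: (@le_lt_trans _ _ (2 * `|C|)%:E); last exact: ltry.
  apply: lime_le; first by apply: is_cvg_nneseries => n _ _; apply: integral_ge0.
  apply: nearW => N.
  under eq_bigr do rewrite Ex_fine//.
  rewrite sumEFin lee_fin.
  (* Telescoping: [1 / u^2 <= 2 (1 / u - 1 / (u + 1))] for [u >= 1], which bounds the partial sums
     by [2 |C|]. *)
  pose g i : R := - i.+1%:R^-1.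
  apply: (@le_trans _ _ (\sum_(0 <= i < N) 2 * `|C| * (g i.+1 - g i))).
    apply: ler_sum => i _; apply: le_trans (YC i) _.
    rewrite -mulrA mulrCA; apply: le_trans (ler_wpM2r _ (ler_norm C)) _.
      by rewrite invr_ge0 exprn_ge0.
    rewrite ler_wpM2l// /g opprK addrC.
    have -> : i.+2%:R = i.+1%:R + 1 :> R by rewrite natr1.
    have u1 : 1 <= i.+1%:R :> R by rewrite ler1n.
    move: u1; move: (i.+1%:R : R) => u u1.
    have -> : 2 * (u^-1 - (u + 1)^-1) = 2 / (u * (u + 1)) by field; lra.
    have uu : 0 < u * (u + 1) by nra.
    by rewrite ler_pdivlMr// mulrC ler_pdivrMr ?exprn_gt0//; nra.
  rewrite -mulr_sumr telescope_sumr// ler_piMr ?mulr_ge0//.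
  by rewrite /g invr1 opprK gerDr oppr_le0.
have := integrable_ae measurableT iY; apply: filterS => w /(_ I) fin.
have bnd N : \sum_(0 <= i < N) Y i w <= fine (\sum_(0 <= n <oo) (Y n w)%:E)%E.
  rewrite -lee_fin fineK// -sumEFin; apply: nneseries_lim_ge => //.
apply: cvg_series_cvg_0; apply: nondecreasing_is_cvgn.
  apply/nondecreasing_seqP => N; rewrite /series /= big_nat_recr//= lerDl//.
by exists (fine (\sum_(0 <= n <oo) (Y n w)%:E)%E) => _ [N _ <-]; exact: bnd.
Qed.

Hypothesis A1 : condA1 a.
Hypothesis A2 : condA2 a.
Hypothesis A3 : condA3 a.
Hypothesis C1 : condC1 a.

Lemma ae_cvg_moment k : {ae P, forall w,
  (n%:R^-1 * \sum_(x <- eigvals (random_mx a n w)) x ^+ k) @[n --> \oo] -->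
  Rintegral (@semicircle R) setT (fun x => x ^+ k)}.
Proof.
have [->|k0] := eqVneq k 0%N.
  apply: aeW => w; under [X in _ --> X]eq_Rintegral do rewrite expr0.
  rewrite (Ex_cst (@semicircle R) 1); apply: cvg_near_cst; exists 1%N => // n /= n0.
  rewrite (eq_bigr (fun=> 1)) => [|x _]; last by rewrite expr0.
  rewrite big_const_seq count_predT size_eigvals; last exact: tr_random_mx.
  by rewrite iter_addr addr0 mulVf// pnatr_eq0 -lt0n.
rewrite -lt0n in k0; have [C CP] := trace_mean_fourth_moment A1 A2 A3 k0.
pose Y n w := (trace_mean a n.+1 k w - walk_mean a n.+1 k 0) ^+ 4.
have : {ae P, forall w, Y n w @[n --> \oo] --> (0 : R)}.
  apply: (@ae_cvg0_of_summable Y C) => [n|n w|n].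
  - apply: finite_momentsX; apply: finite_momentsB; last exact: finite_moments_cst.
    exact: finite_moments_trace_mean.
  - by rewrite /Y (exprM _ 2 2) sqr_ge0.
  - exact: CP.
apply: filterS => w Yw.
rewrite -cvg_shiftS /=.
have -> : (fun n => n.+1%:R^-1 * \sum_(x <- eigvals (random_mx a n.+1 w)) x ^+ k) =
    (fun n => walk_mean a n.+1 k 0 + (trace_mean a n.+1 k w - walk_mean a n.+1 k 0)).
  by apply/funext => n; rewrite eigval_moment// addrC subrK.
rewrite -[Rintegral _ _ _]addr0; apply: cvgD.
  by rewrite (cvg_shiftS (fun n => walk_mean a n k 0)); exact: cvg_closed_walk_mean.
apply/cvgr0Pnorm_lt => e e0.
have e4 : 0 < e ^+ 4 by exact: exprn_gt0.
move/cvgr0Pnorm_lt/(_ _ e4) : Yw; apply: filterS => n.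
by rewrite /Y normrX ltr_pXn2r ?nnegrE ?(ltW e0).
Qed.

Lemma ae_weak_cvg_semicircle :
  {ae P, forall w, weak_cvg (fun n => esd (random_mx a n w)) (@semicircle R)}.
Proof.
(* The exceptional sets of the countably many moments are joined before [f] is introduced, so one
   null set serves all test functions. *)
have := ae_foralln ae_cvg_moment; apply: filterS => w mom f cf bf.
have mf : measurable_fun setT f by exact: continuous_measurable_fun.
have iE n : (\int[esd (random_mx a n w)]_x (f x)%:E =
    (n%:R^-1 * \sum_(x <- eigvals (random_mx a n w)) f x)%:E)%E.
  by apply: integral_esd => //; exact: tr_random_mx.
under eq_fun do rewrite iE.
have [M fM] : exists M : R, forall x, `|f x| <= M.
  case: bf => M [_ MP]; exists (M + 1) => x.
  by apply: MP => //; rewrite ltrDl.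
rewrite Ex_fine; last first.
  apply: (@le_finite_moments _ _ _ _ _ (cst M)) => //; last exact: finite_moments_cst.
  by move=> x; apply: le_trans (ler_norm _); exact: fM.
apply: cvg_EFin; first by apply: nearW.
apply: (@method_of_moments R (fun n => eigvals (random_mx a n w))) => // n.
by apply: size_eigvals; exact: tr_random_mx.
Qed.

End almost_sure_moments.

Theorem theorem2p2 (d : measure_display) (T : measurableType d) (R : realType)
    (P : probability T R) (a : forall n : nat, 'I_n -> 'I_n -> {RV P >-> R}) :
  condA1 a -> condA2 a -> condA3 a -> condC1 a ->
  {ae P, forall w, weak_cvg (fun n => esd (random_mx a n w)) (@semicircle R)}.
Proof. exact: ae_weak_cvg_semicircle. Qed.
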